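(* Let $d\ge 1$ and let $f\in C(\mathbb{R}^d,\mathbb{R}^d)$. Let $\mathcal{F}_{\mathrm{ass}}(f)=\{x\mapsto Ax+b : A\in\mathbb{R}^{d\times d}, b\in\mathbb{R}^d\}\cup\{f,-f\}$. Suppose $f$ satisfies at least one of the following conditions: 1) $f$ is coordinate-separable, globally Lipschitz continuous and nonlinear; 2) $f$ is coordinate-separable, locally Lipschitz continuous, nonlinear, and, in the case $d=1$, $f$ is not a quadratic function of the form $ax^2+bx+c$; 3) $f$ is continuously differentiable and $L^1$ integrable on $\mathbb{R}^d$, $\|x\|^d\|\nabla f(x)\|$ is bounded on $\mathbb{R}^d$, and $\int_{\mathbb{R}^d} f(x)\,dx\neq 0$ (as a vector in $\mathbb{R}^d$). Then for every compact set $\Omega\subset\mathbb{R}^d$ the hypothesis space $\mathcal{H}(\mathcal{F}_{\mathrm{ass}}(f))$ has the $C(\Omega)$-UAP for $\mathrm{Diff}_0(\mathbb{R}^d)$; that is, for every $g\in \mathrm{Diff}_0(\mathbb{R}^d)$ and every $\varepsilon>0$ there is $h\in\mathcal{H}(\mathcal{F}_{\mathrm{ass}}(f))$ with $\|g(x)-h(x)\|\le\varepsilon$ for all $x\in\Omega$.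
   Context: For a vector field $v:\mathbb{R}^d\to\mathbb{R}^d$ and $\tau\ge 0$, the flow map $\phi_v^\tau$ sends $x_0$ to $x(\tau)$, where $x$ solves $\dot x(t)=v(x(t))$, $x(0)=x_0$. If $v$ is only locally Lipschitz, solutions may blow up in finite time, so $\phi_v^\tau$ may be defined only on a subset of $\mathbb{R}^d$; in that case the approximating element $h$ is required to be defined on $\Omega$. For a set (control family) $\mathcal{F}$ of vector fields, the hypothesis space is $$\mathcal{H}(\mathcal{F})=\{\phi_{f_n}^{\tau_n}\circ\cdots\circ\phi_{f_2}^{\tau_2}\circ\phi_{f_1}^{\tau_1} : f_i\in\mathcal{F},\ \tau_i\ge 0,\ n\in\mathbb{N}\}.$$ $\mathrm{Diff}_0(\mathbb{R}^d)$ is the set of orientation-preserving diffeomorphisms of $\mathbb{R}^d$. $f$ is coordinate-separable if $f(x)=(f_1(x_1),\dots,f_d(x_d))$ for all $x=(x_1,\dots,x_d)\in\mathbb{R}^d$, where each $f_i$ is a scalar function of one real variable. A vector-valued function is nonlinear if at least one of its components is nonlinear; a scalar function is nonlinear if it is not affine (not of the form $x\mapsto a\cdot x+c$). *)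

(* Defs.v *)
From HB Require Import structures.
From mathcomp Require Import all_boot all_order all_algebra.
From mathcomp Require Import all_classical all_reals all_analysis.

Set Implicit Arguments.
Unset Strict Implicit.
Unset Printing Implicit Defensive.

Import Order.TTheory GRing.Theory Num.Theory.
Import numFieldNormedType.Exports.

Local Open Scope classical_set_scope.
Local Open Scope ring_scope.

(* Points of R^d are row vectors, so x |-> A x + b reads x *m A^T + b; the norm
   on vectors and matrices is the library's max norm (all norms being equivalent
   in finite dimension, no statement below depends on this choice). *)

Section flows.
Context {R : realType} {d : nat}.
Implicit Types (v : 'rV[R]_d -> 'rV[R]_d) (tau : R).

(* [solves_to v tau x0 y]: some solution of x' = v(x), x(0) = x0 on [0, tau]
   satisfies x(tau) = y. Asking for a two-sided derivative at 0 and tau is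
   harmless: only the values of x on [0, tau] matter, and a solution on [0, tau]
   can be continued affinely on both sides. *)
Definition solves_to v tau (x0 y : 'rV[R]_d) : Prop :=
  exists x : R -> 'rV[R]_d,
    [/\ x 0 = x0,
        forall t : R, 0 <= t <= tau -> is_derive t 1 x (v (x t))
      & x tau = y].

(* The flow map as a partial function: [None] when no solution lives up to time
   tau (blow-up), or when the final value is not unique (this cannot happen for a
   locally Lipschitz v). *)
Definition flow v tau : 'rV[R]_d -> option 'rV[R]_d := fun x0 =>
  if pselect (exists! y, solves_to v tau x0 y) is left e
  then Some (projT1 (cid e)) else None.

Fixpoint flow_comp (n : nat) (f : nat -> 'rV[R]_d -> 'rV[R]_d)
    (tau : nat -> R) : 'rV[R]_d -> option 'rV[R]_d :=
  if n is m.+1 then pcomp (flow (f m) (tau m)) (flow_comp m f tau) else Some.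

Definition hypothesis_space (F : set ('rV[R]_d -> 'rV[R]_d)) :
    set ('rV[R]_d -> option 'rV[R]_d) :=
  [set h | exists (n : nat) (f : nat -> 'rV[R]_d -> 'rV[R]_d) (tau : nat -> R),
     (forall i, (i < n)%N -> F (f i) /\ 0 <= tau i) /\ h = flow_comp n f tau].

Definition F_ass (f : 'rV[R]_d -> 'rV[R]_d) : set ('rV[R]_d -> 'rV[R]_d) :=
  [set v | exists (A : 'M[R]_d) (b : 'rV[R]_d), v = fun x => x *m A^T + b]
  `|` [set f; fun x => - f x].

(* The approximant h has to be defined on all of Omega. *)
Definition C_UAP (Omega : set 'rV[R]_d)
    (H : set ('rV[R]_d -> option 'rV[R]_d))
    (G : set ('rV[R]_d -> 'rV[R]_d)) : Prop :=
  forall g, G g -> forall eps : R, 0 < eps ->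
  exists2 h, H h & forall x, Omega x ->
    exists2 y, h x = Some y & `|g x - y| <= eps.

End flows.

Section regularity.
Context {R : realType} {d : nat}.
Implicit Types f g : 'rV[R]_d -> 'rV[R]_d.

(* The library's 'J f x is the transpose of the usual Jacobian matrix, which
   affects neither its determinant nor its max norm. *)
Definition C1 f : Prop :=
  (forall x, differentiable f x) /\ continuous (fun x => 'J f x).

Definition Diff0 : set ('rV[R]_d -> 'rV[R]_d) :=
  [set g | [/\ C1 g,
      exists g', [/\ cancel g g', cancel g' g & C1 g']
    & forall x, 0 < \det ('J g x)]].

Definition coordinate_separable f : Prop :=
  exists phi : 'I_d -> R -> R, forall x, f x = \row_i phi i (x 0 i).

Definition scalar_nonlinear (u : 'rV[R]_d -> R) : Prop :=
  ~ exists (a : 'rV[R]_d) (c : R), forall x, u x = \sum_i a 0 i * x 0 i + c.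

Definition nonlinear f : Prop :=
  exists i, scalar_nonlinear (fun x => f x 0 i).

Definition locally_lipschitz f : Prop :=
  forall x : 'rV[R]_d, exists2 U, nbhs x U & [lipschitz f y | y in U].

End regularity.

Section lebesgue.
Context {R : realType}.
Local Open Scope ereal_scope.

(* Lebesgue measure on R^n, as a measure on n-tuples of reals: the n-fold product
   of the one-dimensional Lebesgue measure. *)
Fixpoint lebesgue_measure_n (n : nat) : set (n.-tuple R) -> \bar R :=
  if n is m.+1 return set (n.-tuple R) -> \bar R then
    pushforward ((@lebesgue_measure R) \x (@lebesgue_measure_n m))
      (fun p : R * m.-tuple R => [tuple of p.1 :: p.2])
  else \d_[tuple].
Arguments lebesgue_measure_n : clear implicits.

Let consT n (p : (R * n.-tuple R)%type) : n.+1.-tuple R := [tuple of p.1 :: p.2].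

Let measurable_consT n : measurable_fun setT (@consT n).
Proof. exact: measurable_cons. Qed.

Lemma lebesgue_measure_n_sigma_finite n :
  exists mu : {sigma_finite_measure set (n.-tuple R) -> \bar R},
    lebesgue_measure_n n = mu.
Proof.
elim: n => [|n [mu IH]].
  by exists (\d_([tuple] : 0.-tuple R)).
have pE : lebesgue_measure_n n.+1 =
    pushforward ((@lebesgue_measure R) \x mu) (@consT n).
  by rewrite /= IH.
pose L : {sigma_finite_measure set (measurableTypeR R) -> \bar R} :=
  @lebesgue_measure R.
pose P : {measure set _ -> \bar R} := L \x mu.
have sfP : sigma_finite setT P.
  have /sigma_finiteP[F [TF ndF Foo]] := sigma_finiteT L.
  have /sigma_finiteP[G [TG ndG Goo]] := sigma_finiteT mu.
  exists (fun k => F k `*` G k).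
    rewrite -setXTT TF TG predeqE => -[x y]; split => [|[k _ []] /= ? ?].
      move=> [/= [i _ Fix] [j _ Gjy]]; exists (maxn i j) => //; split.
        by move: x Fix; exact/subsetPset/ndF/leq_maxl.
      by move: y Gjy; exact/subsetPset/ndG/leq_maxr.
    by split; exists k.
  move=> k; have [? ?] := Foo k; have [? ?] := Goo k.
  split; first exact: measurableX.
  by rewrite /P /= product_measure1E// lte_mul_pinfty// ge0_fin_numE.
pose m : {measure set (n.+1.-tuple R) -> \bar R} :=
  measure_function_pushforward__canonical__measure_function_Measure
    P (@measurable_consT n).
have sfm : sigma_finite setT m.
  have [F FT mF] := sfP.
  pose u (t : n.+1.-tuple R) : (R * n.-tuple R)%type :=
    (thead t, [tuple of behead t]).
  have uK : cancel (@consT n) u.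
    by move=> -[x t]; rewrite /u /= theadE; congr pair; exact: val_inj.
  have mu_ : measurable_fun setT u.
    apply/measurable_fun_pairP; split => /=; first exact: measurable_tnth.
    exact: measurable_behead.
  exists (fun k => u @^-1` F k).
    by rewrite -preimage_bigcup -FT preimage_setT.
  move=> k; have [mFk Fk] := mF k; split.
    by rewrite -[X in measurable X]setTI; exact: mu_.
  suff -> : m (u @^-1` F k) = P (F k) by [].
  by rewrite /m /= /pushforward -comp_preimage (_ : _ \o _ = id)//; exact/funext.
pose HM := Measure_isSigmaFinite.Build _ _ _ m sfm.
pose M : {sigma_finite_measure set (n.+1.-tuple R) -> \bar R} :=
  HB.pack (Measure.sort m) HM.
by exists M.
Qed.

Section measure_instance.
Variable n : nat.
Local Notation mu := (lebesgue_measure_n n).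

Let mu0 : mu set0 = 0.
Proof.
by have [m ->] := lebesgue_measure_n_sigma_finite n; exact: measure0.
Qed.

Let mu_ge0 A : 0 <= mu A.
Proof.
by have [m ->] := lebesgue_measure_n_sigma_finite n; exact: measure_ge0.
Qed.

Let mu_semi_sigma_additive : semi_sigma_additive mu.
Proof.
have [m ->] := lebesgue_measure_n_sigma_finite n.
exact: measure_semi_sigma_additive.
Qed.

HB.instance Definition _ := isMeasure.Build _ _ _ mu
  mu0 mu_ge0 mu_semi_sigma_additive.

Let mu_sigma_finite : sigma_finite setT mu.
Proof.
by have [m ->] := lebesgue_measure_n_sigma_finite n; exact: sigma_finiteT.
Qed.

HB.instance Definition _ := Measure_isSigmaFinite.Build _ _ _ mu
  mu_sigma_finite.

End measure_instance.

Lemma lebesgue_measure_n_box n (A : 'I_n -> set R) :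
  (forall i, measurable (A i)) ->
  lebesgue_measure_n n [set t | forall i, A i (tnth t i)] =
  \prod_(i < n) lebesgue_measure (A i).
Proof.
elim: n A => [|n IH] A mA.
  by rewrite big_ord0 /= diracE mem_set//= => -[].
rewrite big_ord_recl -IH; last by move=> i; exact: mA.
rewrite [LHS]/= /pushforward.
rewrite (_ : _ @^-1` _ = A ord0 `*`
    [set t : n.-tuple R | forall i, A (lift ord0 i) (tnth t i)]); last first.
  apply/seteqP; split => -[x t] /=.
    move=> At; split; first exact: (At ord0).
    by move=> i; have := At (lift ord0 i); rewrite tnthS.
  move=> [Ax At] i; case: (unliftP ord0 i) => [j ->|-> //].
  by rewrite tnthS; exact: At.
have [m mE] := lebesgue_measure_n_sigma_finite n.
rewrite mE product_measure1E; [by []|exact: mA|].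
rewrite [X in measurable X](_ : _ = \bigcap_(i in [set: 'I_n])
    ((fun t => tnth t i) @^-1` A (lift ord0 i))); last first.
  by apply/seteqP; split => t /= At i; [move=> _|]; exact: At.
apply: fin_bigcap_measurable; first exact: finite_finset.
by move=> i _; rewrite -[X in measurable X]setTI; exact: measurable_tnth.
Qed.

End lebesgue.
Arguments lebesgue_measure_n {R} n A.

Section integration.
Context {R : realType} {d : nat}.
Implicit Types f : 'rV[R]_d -> 'rV[R]_d.

Definition rV_of_tuple (t : d.-tuple R) : 'rV[R]_d := \row_j tnth t j.

Definition L1_integrable f : Prop := forall i,
  (lebesgue_measure_n d).-integrable setT
    (fun t => (f (rV_of_tuple t) 0 i)%:E).

Definition integral_rV f : 'rV[R]_d :=
  \row_i \int[lebesgue_measure_n d]_t f (rV_of_tuple t) 0 i.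

End integration.

(* Main.v *)
Require Import Defs.
From mathcomp Require Import all_boot all_order all_algebra.
From mathcomp Require Import all_classical all_reals all_analysis.
From mathcomp Require Import ring lra.

Set Implicit Arguments.
Unset Strict Implicit.
Unset Printing Implicit Defensive.

Import Order.TTheory GRing.Theory Num.Theory.
Import numFieldNormedType.Exports.

Local Open Scope classical_set_scope.
Local Open Scope ring_scope.

(** The proof works with infinitesimal steps instead of exact flows. Let [H] be
    a set of partially defined maps that is closed under composition. A map is
    reachable ([reach]) on the cube of radius [rho] when elements of [H]
    approximate it there uniformly, and a vector field [v] is a velocity of [H]
    ([vel]) when for every small [t > 0] some element of [H] equals
    [x + t *: v x] up to [o(t)], uniformly on the cube. Velocities are a closed
    convex cone ([vel_add], [vel_closed]): sums come from composing steps, and no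
    differential equation has to be solved for a limit field that is merely
    continuous. Conversely a stable flow of a velocity is reachable ([vel_reach],
    the Lax equivalence principle). The fields of the control family are
    velocities by local existence of solutions ([vel_of_control]).

    Orientation-preserving diffeomorphisms are reachable as soon as all continuous
    fields are velocities ([reach_diffeo]). Affine maps of positive determinant
    are reachable, since the invertible matrices of positive determinant are
    generated by exponentials ([exp_product_det_gt0]). For a diffeomorphism [g]
    the maps [g (expR t *: g^-1 y)] form the flow of a continuous field, so they
    are reachable, and composing such a map with [g (expR (- T) *: x)] gives
    back [g x]. The latter map is affine up to [o(expR (- T))], and the former
    magnifies this error by a multiple of [expR T] only.

    It remains to obtain all continuous fields. The fields [v] such that [v] and
    [- v] are velocities ([field]) form a closed vector space, which contains the
    affine fields and is stable under conjugation by affine maps of positive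
    determinant and by nonlinear shears.

    - If this space contains [x_k ^ n e_k] for all [k] and [n], then linear
      conjugations give [(a . x) ^ n e_k], differentiation in [a] gives all
      polynomial fields, and density gives the rest
      ([field_along_continuous]).
    - If [f] is coordinate-separable and its [k]-th component is not affine, then
      rescaling the [k]-th coordinate alone and subtracting [f] leaves a field
      along [e_k]; averaging it makes it smooth and blowing it up leaves
      [x_k ^ 2 e_k] ([nonaffine_square]). In dimension at least two, shears turn
      one square into all powers ([quadratic_powers]). In dimension one, the
      constants, [x] and [x ^ 2] span a Lie algebra of three dimensions, which is
      why quadratic functions are excluded; any other [f] also gives [x ^ 3], and
      conjugation of [x ^ 3] by the maps [x / (1 - a x)], which the field [x ^ 2]
      makes reachable, gives [x ^ 3 / (1 - a x)], whose expansion in [a] produces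
      the higher powers ([cubic_powers]).
    - If [f] is integrable with integral [c != 0], then the fields
      [s ^ d f (s (x - y))] concentrate at [y] with weight [c] as [s] grows, so
      that their combinations approximate [g x *: c] for every continuous [g]
      ([field_integral]); linear conjugations separate the components. *)

(** * Uniform estimates on compact sets *)

Section compactness.
Context {R : realType}.

Lemma coord_le_norm (m n : nat) (x : 'M[R]_(m, n)) i j : `|x i j| <= `|x|.
Proof. by rewrite [leRHS]mx_normrE; exact: (le_bigmax _ _ (i, j)). Qed.

Lemma norm_le_coord (m n : nat) (x : 'M[R]_(m, n)) c :
  0 <= c -> (forall i j, `|x i j| <= c) -> `|x| <= c.
Proof.
by move=> c0 xc; rewrite [leLHS]mx_normrE; apply: bigmax_le => // -[i j] _.
Qed.

(** Only [x] has to lie in [A]: the estimate also controls points [y] just outside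
    [A], which is what happens to approximations of points of [A]. *)
Lemma compact_unif_cont (X W : normedModType R) (A : set X) (f : X -> W) :
  compact A -> (forall x, A x -> {for x, continuous f}) ->
  forall eps, 0 < eps -> exists2 dlt, 0 < dlt &
  forall x y, A x -> `|x - y| <= dlt -> `|f x - f y| <= eps.
Proof.
move=> /compact_near_coveringP cA cf eps e0.
have := cA R (0^'+) (fun dlt x => forall y, `|x - y| <= dlt -> `|f x - f y| <= eps)
  _ _.
case.
  move=> x Ax; have e20 : 0 < eps / 2 by lra.
  have := cf x Ax; move=> /cvgrPdist_le /(_ _ e20).
  move=> /nbhs_ballP [r /= r0 fr]; have r20 : 0 < r / 2 by lra.
  exists (ball x (r / 2), [set dlt : R | dlt < r / 2]) => /=.
    split; first exact: nbhsx_ballx.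
    by near=> t; near: t; exact: nbhs_right_lt.
  move=> [x' dlt] /=; rewrite -!ball_normE /= => -[xx' dr] y x'y.
  have h1 : `|f x - f x'| <= eps / 2.
    by apply: fr; rewrite -ball_normE /= (lt_le_trans xx')//; lra.
  have h2 : `|f x - f y| <= eps / 2.
    apply: fr; rewrite -ball_normE /= -(subrKA x').
    by rewrite (le_lt_trans (ler_normD _ _))//; lra.
  rewrite -(subrKA (f x)) (le_trans (ler_normD _ _))//.
  by rewrite [X in X + _]distrC; lra.
move=> r /= r0 /(_ (r / 2)); rewrite /ball_ /= => h.
exists (r / 2); first by lra.
move=> x y Ax; apply: h => //; last by lra.
by rewrite sub0r normrN gtr0_norm; lra.
Unshelve. all: by end_near. Qed.

Lemma compact_bound (X W : normedModType R) (A : set X) (f : X -> W) :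
  compact A -> (forall x, A x -> {for x, continuous f}) ->
  exists2 M, 0 < M & forall x, A x -> `|f x| <= M.
Proof.
move=> /compact_near_coveringP cA cf.
have := cA R +oo (fun M x => `|f x| <= M) _ _.
case.
  move=> x Ax.
  have := cf x Ax; move=> /cvgrPdist_le /(_ _ ltr01) fr.
  exists ([set y | `|f x - f y| <= 1], [set M : R | `|f x| + 1 <= M]) => /=.
    split; first exact: fr.
    by near=> t; near: t; apply: nbhs_pinfty_ge; rewrite num_real.
  move=> [y M] /= [fxy]; apply: le_trans.
  rewrite -[f y](subrK (f x)) addrC (le_trans (ler_normD _ _))// lerD2l.
  by rewrite distrC.
move=> M [_ h]; exists (Num.max (M + 1) 1).
  by rewrite lt_max ltr01 orbT.
move=> x Ax; rewrite le_max; apply/orP; left; apply: h => //; lra.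
Unshelve. all: by end_near. Qed.

Lemma ball_compact (d : nat) (rho : R) : compact [set x : 'rV[R]_d | `|x| <= rho].
Proof.
apply: bounded_closed_compact.
  exists rho; split; first by rewrite num_real.
  by move=> M rM x /= xr; apply: le_trans xr _; exact: ltW.
rewrite (_ : [set _ | _] = closed_ball_ Num.norm (0 : 'rV[R]_d) rho).
  exact: closed_closed_ball_.
by apply/seteqP; split => x /=; rewrite /closed_ball_ /= sub0r normrN.
Qed.

Lemma seg_compact (rho : R) : compact [set x : R | `|x| <= rho].
Proof.
rewrite (_ : [set _ | _] = [set` `[- rho, rho]]); first exact: segment_compact.
by apply/seteqP; split => x /=; rewrite in_itv /= ler_norml.
Qed.

Lemma ball_unif_cont (d : nat) (W : normedModType R) (f : 'rV[R]_d -> W) :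
  continuous f -> forall rho eps, 0 < eps -> exists2 dlt, 0 < dlt &
  forall x y, `|x| <= rho -> `|x - y| <= dlt -> `|f x - f y| <= eps.
Proof.
move=> cf rho eps /(compact_unif_cont (@ball_compact d rho) (fun x _ => cf x)).
by case=> dl d0 h; exists dl => // x y; exact: h.
Qed.

Lemma ball_bound (d : nat) (W : normedModType R) (f : 'rV[R]_d -> W) :
  continuous f -> forall rho, exists2 M, 0 < M &
  forall x, `|x| <= rho -> `|f x| <= M.
Proof.
move=> cf rho; have [M M0 h] := compact_bound (@ball_compact d rho) (fun x _ => cf x).
by exists M.
Qed.

End compactness.

(** * Velocities and reachable maps *)

Section approximable_velocities.
Context {R : realType} {d : nat}.
Local Notation V := 'rV[R]_d.
Variable H : set (V -> option V).
Hypothesis H_id : H Some.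
Hypothesis H_comp : forall h k, H h -> H k -> H (pcomp k h).

(** The partial map [h] has to be defined on the whole cube, as in the definition
    of uniform approximation. *)
Definition tracks (h : V -> option V) rho (g : V -> V) eps :=
  forall x, `|x| <= rho -> exists2 y, h x = Some y & `|y - g x| <= eps.

Definition reach (g : V -> V) rho :=
  forall eps, 0 < eps -> exists2 h, H h & tracks h rho g eps.

(** The step [t] is one of all sufficiently small times, not of a sequence of
    times, so that steps of different velocities can be composed with the same
    [t]. *)
Definition vel (v : V -> V) rho :=
  forall eps, 0 < eps -> exists2 t0, 0 < t0 &
  forall t, 0 < t <= t0 ->
  exists2 h, H h & tracks h rho (fun x => x + t *: v x) (eps * t).

(** The error bound [eps * t] is proportional to [t], like [t *: (w x - v x)]; this
    is why uniform limits of velocities are velocities, although flows of limits of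
    Lipschitz fields need not be unique. *)
Lemma vel_closed v rho :
  (forall eps, 0 < eps -> exists2 w, vel w rho &
    forall x, `|x| <= rho -> `|w x - v x| <= eps) -> vel v rho.
Proof.
move=> hv eps e0; have e20 : 0 < eps / 2 by lra.
have [w vw wv] := hv _ e20; have [t0 t00 ht] := vw _ e20.
exists t0 => // t /[dup] /andP[tp _] /ht[h Hh hh]; exists h => // x xr.
have [y hxy yw] := hh x xr; exists y => //.
rewrite (_ : y - _ = (y - (x + t *: w x)) + t *: (w x - v x)); last first.
  by apply/rowP => i; rewrite !mxE; ring.
rewrite (le_trans (ler_normD _ _))// normrZ gtr0_norm//.
have := wv x xr; nra.
Qed.

Lemma velS v rho rho' : rho <= rho' -> vel v rho' -> vel v rho.
Proof.
move=> rr vv eps /vv[t0 t00 ht]; exists t0 => // t /ht[h Hh hh].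
by exists h => // x xr; apply: hh; exact: le_trans rr.
Qed.

Lemma reachS g rho rho' : rho <= rho' -> reach g rho' -> reach g rho.
Proof.
move=> rr vv eps /vv[h Hh hh].
by exists h => // x xr; apply: hh; exact: le_trans rr.
Qed.

Lemma vel_scale c v rho : 0 < c -> vel v rho -> vel (fun x => c *: v x) rho.
Proof.
move=> c0 vv eps e0; have [|t0 t00 ht] := vv (eps / c); first exact: divr_gt0.
exists (t0 / c); first exact: divr_gt0.
move=> t /andP[tp tt]; have [|h Hh hh] := ht (c * t).
  by rewrite mulr_gt0//= mulrC -ler_pdivlMr.
exists h => // x /hh[y hxy yw]; exists y => //.
move: yw; rewrite scalerA [t * c]mulrC [eps / c * _]mulrA divfK//.
by rewrite gt_eqF.
Qed.

(** A step along [v] followed by a step along [w] is a step along [v + w] up to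
    [o(t)], because [w] varies by [o(1)] over the first step. The larger cube gives
    room for the first step. *)
Lemma vel_add v w rho rho' : rho < rho' ->
  (exists2 M, 0 < M & forall x, `|x| <= rho -> `|v x| <= M) -> continuous w ->
  vel v rho -> vel w rho' -> vel (fun x => v x + w x) rho.
Proof.
move=> rr [M M0 vM] cw vv vw eps e0; have e30 : 0 < eps / 3 by lra.
have [t1 t10 h1] := vv _ e30; have [t2 t20 h2] := vw _ e30.
have [dl dl0 wd] := ball_unif_cont cw rho e30.
pose m := Num.min dl (rho' - rho).
have m0 : 0 < m by rewrite lt_min dl0 subr_gt0.
exists (Num.min (Num.min t1 t2) (m / (M + eps / 3))).
  by rewrite !lt_min t10 t20/= divr_gt0//; lra.
move=> t /andP[tp]; rewrite !le_min => /andP[/andP[tt1 tt2]].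
rewrite ler_pdivlMr; last lra.
move=> tm.
have [|k1 Hk1 kk1] := h1 t; first by rewrite tp.
have [|k2 Hk2 kk2] := h2 t; first by rewrite tp.
exists (pcomp k2 k1); first exact: H_comp.
move=> x xr; have [y kxy yx] := kk1 x xr.
have yxm : `|x - y| <= m.
  rewrite distrC (_ : y - x = (y - (x + t *: v x)) + t *: v x).
    rewrite (le_trans (ler_normD _ _))// normrZ gtr0_norm//.
    have := vM x xr; nra.
  by apply/rowP => i; rewrite !mxE; ring.
have : m <= dl /\ m <= rho' - rho by rewrite !ge_min !lexx orbT.
move=> [md mr].
have [|z kyz zy] := kk2 y.
  rewrite -[y](subrK x) (le_trans (ler_normD _ _))// [`|y - x|]distrC; lra.
exists z; first by rewrite /pcomp kxy.
rewrite (_ : z - _ = (z - (y + t *: w y)) + (y - (x + t *: v x))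
   + t *: (w y - w x)).
  rewrite (le_trans (ler_normD _ _))// normrZ gtr0_norm//.
  have := ler_normD (z - (y + t *: w y)) (y - (x + t *: v x)).
  have := wd x y xr (le_trans yxm md); rewrite distrC; nra.
by apply/rowP => i; rewrite !mxE; ring.
Qed.

Lemma reach_comp g k rho rho' s : 0 < s ->
  (forall x, `|x| <= rho -> `|g x| + s <= rho') ->
  (forall eps, 0 < eps -> exists2 dlt, 0 < dlt & forall x y, `|x| <= rho' ->
    `|y| <= rho' -> `|x - y| <= dlt -> `|k x - k y| <= eps) ->
  reach g rho -> reach k rho' -> reach (fun x => k (g x)) rho.
Proof.
move=> s0 gr ck rg rk eps e0; have e20 : 0 < eps / 2 by lra.
have [dl dl0 kd] := ck _ e20.
have [|h1 Hh1 hh1] := rg (Num.min dl s); first by rewrite lt_min dl0.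
have [h2 Hh2 hh2] := rk _ e20.
exists (pcomp h2 h1); first exact: H_comp.
move=> x xr; have [y hxy] := hh1 x xr; rewrite le_min => /andP[yd ys].
have yr : `|y| <= rho'.
  rewrite -[y](subrK (g x)) (le_trans (ler_normD _ _))//.
  have := gr x xr; lra.
have [z hyz zy] := hh2 y yr; exists z; first by rewrite /pcomp hxy.
rewrite -(subrKA (k y)) (le_trans (ler_normD _ _))//.
have : `|k y - k (g x)| <= eps / 2.
  by apply: kd => //; have := gr x xr; lra.
lra.
Qed.

(** Conjugating a velocity field by a reachable change of variables: the error
    made on the change of variables may depend on the time step [t], so it can
    be taken of order [eps * t]. *)
Lemma vel_conj (phi chi w u : V -> V) rho rho' s L : 0 < s -> 0 <= L ->
  (forall x, `|x| <= rho -> `|phi x| + s <= rho') ->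
  (forall y z, `|y| <= rho' -> `|z| <= rho' ->
    `|chi y - chi z| <= L * `|y - z|) ->
  continuous w ->
  (forall eps, 0 < eps -> exists2 t0, 0 < t0 & forall t, 0 < t <= t0 ->
    forall x, `|x| <= rho ->
    `|chi (phi x + t *: w (phi x)) - (x + t *: u x)| <= eps * t) ->
  reach phi rho -> reach chi rho' -> vel w rho' -> vel u rho.
Proof.
move=> s0 L0 phis chiL cw gen rphi rchi vw eps e0.
pose e := eps / (3 * L + 2).
have ee : 0 < e by rewrite divr_gt0//; lra.
have epsE : eps = (3 * L + 2) * e by rewrite mulrC divfK// gt_eqF//; lra.
have [dl dl0 wd] := ball_unif_cont cw rho' ee.
have [M M0 wM] := ball_bound cw rho'.
have [t1 t10 h1] := gen _ ee; have [t2 t20 h2] := vw _ ee.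
exists (Num.min (Num.min t1 t2) (Num.min (dl / e) (s / (M + 3 * e)))).
  by rewrite !lt_min t10 t20/= !divr_gt0//; lra.
move=> t /andP[t0]; rewrite !le_min => /andP[/andP[tt1 tt2]].
rewrite !ler_pdivlMr//; last lra.
move=> /andP[tdl ts].
have et0 : 0 < e * t by exact: mulr_gt0.
have [ha Hha hha] := rphi _ et0; have [hc Hhc hhc] := rchi _ et0.
have [|hb Hhb hhb] := h2 t; first by rewrite t0.
exists (pcomp hc (pcomp hb ha)); first by do 2!apply: H_comp => //.
move=> x xr; have := phis x xr => phixr.
have [y1 hxy1 y1x] := hha x xr.
have y1r : `|y1| <= rho'.
  rewrite -[y1](subrK (phi x)) (le_trans (ler_normD _ _))//; nra.
have [y2 hy12 y2y1] := hhb y1 y1r.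
have y2phi : `|y2 - (phi x + t *: w (phi x))| <= 3 * (e * t).
  rewrite (_ : y2 - _ = (y2 - (y1 + t *: w y1)) + (y1 - phi x)
    + t *: (w y1 - w (phi x))); last first.
    by apply/rowP => i; rewrite !mxE; ring.
  rewrite (le_trans (ler_normD _ _))// normrZ gtr0_norm//.
  have := ler_normD (y2 - (y1 + t *: w y1)) (y1 - phi x).
  have : `|w y1 - w (phi x)| <= e by apply: wd => //; nra.
  nra.
have zr : `|phi x + t *: w (phi x)| + 3 * (e * t) <= rho'.
  have := ler_normD (phi x) (t *: w (phi x)).
  rewrite normrZ gtr0_norm//.
  have : `|w (phi x)| <= M by apply: wM; lra.
  nra.
have y2r : `|y2| <= rho'.
  rewrite -[y2](subrK (phi x + t *: w (phi x))) (le_trans (ler_normD _ _))//.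
  lra.
have [y3 hy23 y3y2] := hhc y2 y2r.
exists y3; first by rewrite /pcomp hxy1 /= hy12.
rewrite -(subrKA (chi y2)) (le_trans (ler_normD _ _))//.
rewrite -[X in _ + `|X|](subrKA (chi (phi x + t *: w (phi x)))).
have := ler_normD (chi y2 - chi (phi x + t *: w (phi x)))
  (chi (phi x + t *: w (phi x)) - (x + t *: u x)).
have := chiL y2 (phi x + t *: w (phi x)) y2r.
have tt : 0 < t <= t1 by rewrite t0.
have := h1 t tt x xr; rewrite epsE.
have zr' : `|phi x + t *: w (phi x)| <= rho' by lra.
move: zr' => /[swap] c1 /[swap] /[apply] c2.
have : L * `|y2 - (phi x + t *: w (phi x))| <= L * (3 * (e * t)) by rewrite ler_wpM2l.
rewrite (_ : (3 * L + 2) * e * t = L * (3 * (e * t)) + 2 * (e * t)); last by ring.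
lra.
Qed.

(** Lax equivalence: stability of the exact flow [Psi] and consistency of the
    one-step maps give convergence. Stability is used by comparing the images
    under [Psi] of the numerical solution at the final time, so that the errors
    of the single steps add up. *)
Lemma vel_reach (Psi : R -> V -> V) (v : V -> V) rho K T L :
  0 < T -> 1 <= L -> rho <= K ->
  (forall x, `|x| <= K + 1 -> Psi 0 x = x) ->
  (forall s t x, 0 <= s -> 0 <= t -> s + t <= T -> `|x| <= K + 1 ->
    Psi t (Psi s x) = Psi (s + t) x) ->
  (forall t x, 0 <= t <= T -> `|x| <= rho -> `|Psi t x| <= K) ->
  (forall t x y, 0 <= t <= T -> `|x| <= K + 1 -> `|y| <= K + 1 ->
    `|Psi t x - Psi t y| <= L * `|x - y|) ->
  (forall eps, 0 < eps -> exists2 t0, 0 < t0 & forall t, 0 < t <= t0 ->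
    forall x, `|x| <= K + 1 -> `|Psi t x - (x + t *: v x)| <= eps * t) ->
  vel v (K + 1) -> reach (Psi T) rho.
Proof.
move=> T0 L1 rK P0 Psg Pst PL Pg vv eps e0.
pose e := Num.min 1 eps / (2 * (L * T)).
have m0 : 0 < Num.min 1 eps by rewrite lt_min ltr01.
have LT0 : 0 < L * T by rewrite mulr_gt0//; lra.
have ee : 0 < e by rewrite divr_gt0//; lra.
have eE : L * (2 * e) * T = Num.min 1 eps.
  rewrite (_ : _ * _ = e * (2 * (L * T))); last by ring.
  by rewrite divfK// gt_eqF//; lra.
have [t1 t10 h1] := Pg _ ee; have [t2 t20 h2] := vv _ ee.
have [n /= [n0 nt]] : exists n : nat, (0 < n)%N /\ T / n%:R <= Num.min t1 t2.
  have tm0 : 0 < Num.min t1 t2 by rewrite lt_min t10.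
  exists (Num.truncn (T / Num.min t1 t2)).+1; split => //.
  rewrite ler_pdivrMr ?ltr0n// mulrC -ler_pdivrMr//.
  by apply: ltW; exact: truncnS_gt.
set t := T / n%:R in nt; have t0 : 0 < t by rewrite divr_gt0// ltr0n.
have nT : n%:R * t = T by rewrite mulrC divfK// pnatr_eq0 -lt0n.
move: nt; rewrite le_min => /andP[tt1 tt2].
have [|h Hh hh] := h2 t; first by rewrite t0.
(* [j] numerical steps from [x] stay within [j * Q <= 1] of the exact orbit, hence
   in the cube of radius [K + 1] on which the one-step estimates hold. *)
exists (iter n (pcomp h) Some).
  by move: (n); elim=> [//|m IH] /=; exact: H_comp.
have main x : `|x| <= rho -> forall j, (j <= n)%N ->
    exists y, [/\ iter j (pcomp h) Some x = Some y, `|y| <= K + 1 &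
      forall s, 0 <= s -> s + j%:R * t <= T ->
        `|Psi s y - Psi (s + j%:R * t) x| <= j%:R * (L * (2 * e) * t)].
  move=> xr; elim=> [_|j IH jn].
    exists x; split => //; first by lra.
    by move=> s _ _; rewrite !mul0r addr0 subrr normr0.
  have [y [hy yK hs]] := IH (ltnW jn).
  have [z hz zy] := hh y yK.
  have jT : j.+1%:R * t <= T by rewrite -nT ler_pM2r// ler_nat.
  have jL : j.+1%:R * (L * (2 * e) * t) <= 1.
    rewrite (_ : _ * _ = L * (2 * e) * (j.+1%:R * t)); last by ring.
    rewrite (@le_trans _ _ (L * (2 * e) * T))//.
      have Le0 : 0 < L * (2 * e) by apply: mulr_gt0; lra.
      rewrite ler_pM2l//.
    by rewrite eE ge_min lexx.
  move: jT jL; rewrite -natr1 => jT jL.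
  have zP : `|z - Psi t y| <= 2 * e * t.
    rewrite -(subrKA (y + t *: v y)) (le_trans (ler_normD _ _))//.
    rewrite [X in _ + X]distrC.
    by have := h1 t _ y yK; rewrite t0 tt1 => /(_ isT); lra.
  have jt0 : 0 <= j%:R * t by rewrite mulr_ge0// ltW.
  have PyK : `|Psi t y - Psi (t + j%:R * t) x| <= j%:R * (L * (2 * e) * t).
    by apply: hs; lra.
  have et0 : 0 < e * t by exact: mulr_gt0.
  have Le : 2 * e * t <= L * (2 * e) * t.
    have : 0 <= (L - 1) * (e * t) by apply: mulr_ge0; lra.
    by lra.
  have PxK : `|Psi (t + j%:R * t) x| <= K by apply: Pst => //; apply/andP; split; lra.
    (* [Q] bounds what one step adds to the error at the final time, after
     transport by the exact flow. *)
set Q := L * (2 * e) * t in Le PyK hs jL *.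
  have PyKQ : `|Psi t y| <= K + j%:R * Q.
    rewrite -[Psi t y](subrK (Psi (t + j%:R * t) x)).
    by rewrite (le_trans (ler_normD _ _))// addrC lerD.
  have zK : `|z| <= K + (j%:R + 1) * Q.
    rewrite -[z](subrK (Psi t y)) (le_trans (ler_normD _ _))//.
    by rewrite mulrDl mul1r addrA addrC lerD// (le_trans zP).
  have PyK1 : `|Psi t y| <= K + 1.
    apply: le_trans PyKQ _; rewrite lerD2l (le_trans _ jL)//.
    by rewrite mulrDl mul1r lerDl (le_trans _ Le)// -mulrA mulr_ge0// ltW.
  have {}zK : `|z| <= K + 1 by apply: le_trans zK _; rewrite lerD2l.
  exists z; split => //; first by rewrite /= /pcomp hy.
  move=> s s0 sT.
  have sT' : s + (j%:R + 1) * t = (t + s) + j%:R * t by ring.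
  rewrite sT' -(subrKA (Psi s (Psi t y))) (le_trans (ler_normD _ _))//.
  rewrite [X in _ + `|X - _|]Psg//; [|lra|lra].
  have s1 : 0 <= s <= T by rewrite s0/=; lra.
  have := PL s z (Psi t y) s1 zK PyK1.
  have : `|Psi (t + s) y - Psi (t + s + j%:R * t) x| <= j%:R * Q.
    by apply: hs; lra.
  have : L * `|z - Psi t y| <= L * (2 * e * t) by rewrite ler_pM2l//; lra.
  rewrite [L * (2 * e * t)]mulrA => a1 a2 a3.
  rewrite mulrDl mul1r [leRHS]addrC lerD//.
  exact: le_trans a3 a1.
move=> x xr; have [y [hy yK /(_ 0)]] := main x xr n (leqnn _).
rewrite lexx add0r nT P0// => /(_ isT (lexx _)) yP; exists y => //.
apply: le_trans yP _; rewrite mulrCA nT eE ge_min lexx orbT//.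
Qed.

End approximable_velocities.

(** * Derivatives and antiderivatives of curves *)

Section derivatives.
Context {R : realType}.

Lemma is_derive_mxP (U : normedModType R) (m n : nat) (M : U -> 'M[R]_(m, n)) t v l :
  is_derive t v M l <-> forall i j, is_derive t v (fun x => M x i j) (l i j).
Proof.
split => [[dM <-] i j|h].
  have /derivable_mxP dij := dM.
  apply: DeriveDef; first exact: dij.
  by rewrite derive_mx// mxE.
have dM : derivable M t v by apply/derivable_mxP => i j; have [] := h i j.
apply: DeriveDef => //; rewrite derive_mx//.
by apply/matrixP => i j; rewrite mxE; have [_] := h i j.
Qed.

Lemma is_derive_cont (f : R -> R) (t l : R) : is_derive t 1 f l -> {for t, continuous f}.
Proof.
move=> [df _]; exact/differentiable_continuous/derivable1_diffP.
Qed.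

Lemma MVT_real (f df : R -> R) (a b : R) : a <= b ->
  (forall t : R, a <= t <= b -> is_derive t 1 f (df t)) ->
  exists2 c, a <= c <= b & f b - f a = df c * (b - a).
Proof.
move=> ab fd; have [||c] := @MVT_segment R f df a b ab.
- by move=> x; rewrite in_itv /= => /andP[ax xb]; apply: fd; rewrite !ltW.
- apply: continuous_in_subspaceT => x; rewrite inE /= in_itv /= => xab.
  exact: is_derive_cont (fd _ xab).
- by rewrite in_itv /= => cab h; exists c.
Qed.

(** The mean value inequality, for the max norm. *)
Lemma MVT_norm (n : nat) (x dx : R -> 'rV[R]_n) (a b M : R) : a <= b ->
  (forall t : R, a <= t <= b -> is_derive t 1 x (dx t)) ->
  (forall t, a <= t <= b -> `|dx t| <= M) -> `|x b - x a| <= M * (b - a).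
Proof.
move=> ab xd dM.
have M0 : 0 <= M by rewrite (le_trans (normr_ge0 _) (dM a _))// lexx.
apply: norm_le_coord => [|i j]; first by rewrite mulr_ge0// subr_ge0.
rewrite ord1 !mxE.
have [|c cab ->] := @MVT_real (fun t => x t 0 j) (fun t => dx t 0 j) a b ab.
  by move=> t /xd /is_derive_mxP; apply.
rewrite normrM (@ger0_norm _ (b - a)) ?subr_ge0//.
rewrite ler_wpM2r ?subr_ge0//; apply: le_trans (dM c cab); exact: coord_le_norm.
Qed.

Lemma antiderivative_uniq (F G u : R -> R) a x : a < 0 -> a < x ->
  F 0 = 0 -> G 0 = 0 ->
  (forall t : R, a < t -> is_derive t 1 F (u t)) ->
  (forall t : R, a < t -> is_derive t 1 G (u t)) -> F x = G x.
Proof.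
move=> a0 ax F0 G0 dF dG.
have d (t : R) : a < t -> is_derive t 1 (fun t => F t - G t) 0.
  move=> at_; rewrite -(subrr (u t)).
  by have := dF t at_; have := dG t at_ => d1 d2; exact: is_deriveB.
apply/eqP; rewrite -subr_eq0; apply/eqP.
have [x0|x0] := leP 0 x.
  have [|c _] := @MVT_real (fun t => F t - G t) (fun=> 0) 0 x x0.
    by move=> t /andP[t0 _]; apply: d; exact: lt_le_trans t0.
  by rewrite F0 G0 mul0r !subr0.
have [|c _] := @MVT_real (fun t => F t - G t) (fun=> 0) x 0 (ltW x0).
  by move=> t /andP[t0 _]; apply: d; exact: lt_le_trans t0.
by rewrite F0 G0 mul0r subrr sub0r => /eqP; rewrite oppr_eq0 => /eqP.
Qed.

(** The integral from a fixed base point [a] is an antiderivative to the right of [a]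
    only. Taking the base point below [x] and normalizing the value at [0] gives one
    function, and by uniqueness it coincides near each point with the integral from
    a common base point. *)
Lemma antiderivative (u : R -> R) : continuous u ->
  exists2 U : R -> R, U 0 = 0 & forall x : R, is_derive x 1 U (u x).
Proof.
move=> cu.
pose G a x : R := \int[lebesgue_measure]_(t in [set` `[a, x]]) u t.
pose A a x := G a x - G a 0.
have dA (a x : R) : a < x -> is_derive x 1 (A a) (u x).
  move=> ax.
  have [||||d e] := @continuous_FTC1_closed R u a x (x + 1).
  - by rewrite ltrDl.
  - apply: continuous_compact_integrable; first exact: segment_compact.
    exact: continuous_subspaceT.
  - exact: ax.
  - exact: cu.
  have d' : is_derive x 1 (G a) (u x) by split; [exact: d|rewrite -derive1E; exact: e].
  rewrite -[u x]subr0; exact: is_deriveB.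
have A0 a : A a 0 = 0 by rewrite /A subrr.
exists (fun x => A (- (`|x| + 1)) x); first exact: A0.
move=> x; pose b := - (`|x| + 2).
have [b0 bx] : b < 0 /\ b < x.
  by rewrite /b; have := ler_norm (- x); rewrite normrN; have := normr_ge0 x; lra.
apply: (@near_eq_is_derive _ _ _ (A b)); last exact: dA.
near=> y.
have yx : `|x - y| < 1.
  near: y; apply/nbhs_ballP; exists 1 => //= z; by rewrite -ball_normE.
pose c := - (`|y| + 1).
have [c0 cy] : c < 0 /\ c < y.
  by rewrite /c; have := ler_norm (- y); rewrite normrN; have := normr_ge0 y; lra.
have bc : b <= c.
  rewrite /b /c; have := ler_normD (y - x) x; rewrite subrK distrC; lra.
apply: (@antiderivative_uniq _ _ u c); [exact: c0|exact: cy|exact: A0|exact: A0| |].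
  move=> t ct; apply: dA; exact: le_lt_trans ct.
move=> t ct; exact: dA.
Unshelve. all: by end_near. Qed.

Lemma antiderivative_rV (n : nat) (u : R -> 'rV[R]_n) : continuous u ->
  exists2 U : R -> 'rV[R]_n, U 0 = 0 & forall x : R, is_derive x 1 U (u x).
Proof.
move=> cu.
have /choice [U hU] : forall i : 'I_n, exists U : R -> R,
    U 0 = 0 /\ forall x : R, is_derive x 1 U (u x 0 i).
  move=> i; have [|U U0 hU] := @antiderivative (fun x => u x 0 i).
    move=> x; apply: (@continuous_comp _ _ _ u (fun y : 'rV[R]_n => y 0 i)).
      exact: cu.
    exact: coord_continuous.
  by exists U.
exists (fun x => \row_i U i x).
  by apply/rowP => i; rewrite !mxE; case: (hU i).
move=> x; apply/is_derive_mxP => i j; rewrite ord1.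
have [_ /(_ x)] := hU j.
by rewrite (_ : (fun _ => _) = U j)//; apply/funext => y; rewrite !mxE.
Qed.

End derivatives.

(** * Existence of solutions for globally Lipschitz fields *)

Section picard.
Context {R : realType} {d : nat}.
Local Notation V := 'rV[R]_d.

(** The intervals of radius [2 * C / 2 ^+ n] about [u n] are nested, so the supremum
    of their left ends lies in all of them. This gives the limit together with its
    rate of convergence. *)
Lemma geometric_cauchy_real (u : nat -> R) (C : R) :
  (forall n, `|u n.+1 - u n| <= C / 2 ^+ n) ->
  exists l, forall n, `|l - u n| <= 2 * C / 2 ^+ n.
Proof.
move=> hu.
have p2 n : 0 < (2 : R) ^+ n by rewrite exprn_gt0.
have half n : 2 * C / 2 ^+ n.+1 = C / 2 ^+ n.
  by rewrite exprS; field; rewrite gt_eqF.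
pose a n := u n - 2 * C / 2 ^+ n; pose b n := u n + 2 * C / 2 ^+ n.
have dbl n : 2 * C / 2 ^+ n = C / 2 ^+ n + C / 2 ^+ n by rewrite -mulrDl -mulr2n mulr_natl.
have aS n : a n <= a n.+1.
  by rewrite /a half dbl; have := hu n; rewrite ler_norml => /andP[]; lra.
have bS n : b n.+1 <= b n.
  by rewrite /b half dbl; have := hu n; rewrite ler_norml => /andP[]; lra.
have C0 n : 0 <= C / 2 ^+ n by apply: le_trans (hu n).
have ab n : a n <= b n by rewrite /a /b dbl; have := C0 n; lra.
have aD n m : a n <= a (n + m)%N.
  by elim: m => [|m IH]; rewrite ?addn0// addnS (le_trans IH).
have bD n m : b (n + m)%N <= b n.
  by elim: m => [|m IH]; rewrite ?addn0// addnS (le_trans (bS _)).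
have abnm n m : a n <= b m.
  by rewrite (le_trans (aD n m))// (le_trans (ab _))// addnC.
have hs : has_sup (range a).
  split; first by exists (a 0%N), 0%N.
  by exists (b 0%N) => _ [n _ <-].
exists (sup (range a)) => n; rewrite ler_norml.
have : a n <= sup (range a) by apply: ub_le_sup; [case: hs|exists n].
have : sup (range a) <= b n by apply: ge_sup; [case: hs|move=> _ [m _ <-]].
by rewrite /a /b; lra.
Qed.

Lemma geometric_cauchy (u : nat -> V) (C : R) :
  (forall n, `|u n.+1 - u n| <= C / 2 ^+ n) ->
  exists l, forall n, `|l - u n| <= 2 * C / 2 ^+ n.
Proof.
move=> hu.
have C0 : 0 <= C by have := le_trans (normr_ge0 _) (hu 0%N); rewrite expr0 divr1.
have /choice [l hl] : forall i : 'I_d, exists l,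
    forall n, `|l - u n 0 i| <= 2 * C / 2 ^+ n.
  move=> i; apply: geometric_cauchy_real => n; apply: le_trans (hu n).
  by have := coord_le_norm (u n.+1 - u n) 0 i; rewrite !mxE.
exists (\row_i l i) => n; apply: norm_le_coord => [|i j].
  by rewrite divr_ge0 ?exprn_ge0// mulr_ge0.
by rewrite ord1 !mxE.
Qed.

Lemma lipschitz_cont (X W : normedModType R) (F : X -> W) (L : R) :
  (forall x y, `|F x - F y| <= L * `|x - y|) -> continuous F.
Proof.
move=> FL x; apply/cvgrPdist_le => e e0; near=> y.
apply: le_trans (FL x y) _.
have L0 : 0 < `|L| + 1 by have := normr_ge0 L; lra.
have : `|x - y| <= e / (`|L| + 1).
  near: y; apply/nbhs_ballP; exists (e / (`|L| + 1)); first exact: divr_gt0.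
  by move=> y; rewrite -ball_normE /= => /ltW.
rewrite ler_pdivlMr//; apply: le_trans; rewrite mulrC.
by rewrite ler_wpM2l//; have := ler_norm L; lra.
Unshelve. all: by end_near. Qed.

(** Freezing a curve outside [[0, T]] turns a curve that is controlled on that
    interval into a curve on the whole line, as needed by two-sided derivatives. *)
Definition restrict_time (T t : R) : R := Num.max 0 (Num.min t T).

Lemma restrict_time_itv T t : 0 <= T -> 0 <= restrict_time T t <= T.
Proof.
by move=> T0; rewrite /restrict_time le_max lexx/= ge_max T0 ge_min lexx orbT.
Qed.

Lemma restrict_time_id T t : 0 <= t <= T -> restrict_time T t = t.
Proof. by case/andP => t0 tT; rewrite /restrict_time min_l// max_r. Qed.

Lemma restrict_time_cont T : continuous (restrict_time T).
Proof.
move=> t; apply: (@continuous_max R R (cst 0) (fun t => Num.min t T)).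
  exact: cvg_cst.
by apply: (@continuous_min R R id (cst T)); [exact: cvg_id|exact: cvg_cst].
Qed.

(** Picard iteration on a time interval so short that each step halves the
    distance. *)
Lemma picard (F : V -> V) (L T : R) (x0 : V) : 0 <= T -> L * T <= 1 / 2 ->
  (forall x y, `|F x - F y| <= L * `|x - y|) ->
  exists2 Y : R -> V, Y 0 = x0 &
    forall t : R, 0 <= t <= T -> is_derive t 1 Y (F (Y t)).
Proof.
move=> T0 LT FL; have cF := lipschitz_cont FL.
have /choice [I hI] : forall u : R -> V, exists Iu : R -> V, continuous u ->
    Iu 0 = 0 /\ forall x : R, is_derive x 1 Iu (u x).
  move=> u; have [cu|ncu] := pselect (continuous u); last by exists 0.
  by have [U U0 dU] := antiderivative_rV cu; exists U.
pose P (X : R -> V) t := x0 + I (F \o X) t.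
have dP X : continuous X -> forall t : R, is_derive t 1 (P X) (F (X t)).
  move=> cX t; have [|_ /(_ t) dI] := hI (F \o X).
    by move=> s; apply: continuous_comp; [exact: cX|exact: cF].
  rewrite -[F (X t)]add0r; apply: is_deriveD.
have P0 X : continuous X -> P X 0 = x0.
  move=> cX; have [|I0 _] := hI (F \o X).
    by move=> s; apply: continuous_comp; [exact: cX|exact: cF].
  by rewrite /P I0 addr0.
have cP X : continuous X -> continuous (P X).
  move=> cX t; apply: differentiable_continuous; apply/derivable1_diffP.
  by have [] := dP X cX t.
have Pstep X Y c t : continuous X -> continuous Y -> 0 <= c ->
    (forall s, 0 <= s <= T -> `|X s - Y s| <= c) -> 0 <= t <= T ->
    `|P X t - P Y t| <= c / 2.
  move=> cX cY c0 XY /andP[t0 tT].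
  have [] : `|(P X t - P Y t) - (P X 0 - P Y 0)| <= (Num.max L 0 * c) * (t - 0).
    apply: (@MVT_norm R d (fun s => P X s - P Y s) (fun s => F (X s) - F (Y s))) => //.
      by move=> s _; apply: is_deriveB; exact: dP.
    move=> s /andP[s0 st]; apply: le_trans (FL _ _) _.
    apply: (@le_trans _ _ (Num.max L 0 * `|X s - Y s|)).
      by rewrite ler_wpM2r// le_max lexx.
    by rewrite ler_wpM2l ?le_max ?lexx ?orbT// XY// s0 (le_trans st).
  rewrite !P0// subrr !subr0 => h; apply: le_trans h _.
  rewrite mulrAC mulrC ler_wpM2l//.
  apply: (@le_trans _ _ (Num.max L 0 * T)).
    by rewrite ler_wpM2l// le_max lexx orbT.
  by rewrite maxr_pMl// mul0r ge_max; apply/andP; split; lra.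
pose X n := iter n P (fun=> x0).
have cX n : continuous (X n).
  by elim: n => [|n IH] /=; [exact: cst_continuous|exact: cP].
have [C C0 hC] : exists2 C, 0 < C & forall t, 0 <= t <= T -> `|X 1%N t - X 0%N t| <= C.
  have [C C0 hC] := @compact_bound R R V [set` `[0, T]] (fun t => X 1%N t - X 0%N t)
    (@segment_compact _ _ _) (fun t _ => continuousB (@cX 1%N t) (@cX 0%N t)).
  by exists C => // t t0T; apply: hC; rewrite /= in_itv.
have Xgeo n t : 0 <= t <= T -> `|X n.+1 t - X n t| <= C / 2 ^+ n.
  elim: n t => [|n IH] t tT; first by rewrite expr0 divr1; exact: hC.
  rewrite exprSr invfM mulrA; apply: (Pstep _ _ _ _ (cX n.+1) (cX n)) => //.
  by rewrite divr_ge0// ?exprn_ge0// ltW.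
pose r := restrict_time T.
have rT t : 0 <= r t <= T by exact: restrict_time_itv.
have /choice [Z hZ] : forall t, exists l, forall n, `|l - X n (r t)| <= 2 * C / 2 ^+ n.
  by move=> t; apply: geometric_cauchy => n; exact: Xgeo.
have small e : 0 < e -> exists n, 2 * C / 2 ^+ n <= e.
  move=> e0; exists (Num.truncn (2 * C / e)).+1.
  rewrite ler_pdivrMr ?exprn_gt0// [e * _]mulrC -ler_pdivrMr//.
  apply: (@le_trans _ _ (Num.truncn (2 * C / e)).+1%:R).
    by apply: ltW; exact: truncnS_gt.
  by rewrite -natrX ler_nat; apply: ltnW; exact: ltn_expl.
have cZ : continuous Z.
  move=> t; apply/cvgrPdist_le => /= e e0.
  have [|n hn] := small (e / 3); first by lra.
  near=> s.
  have : `|X n (r t) - X n (r s)| <= e / 3.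
    near: s.
    have : {for t, continuous (X n \o r)}.
      by apply: continuous_comp; [exact: restrict_time_cont|exact: cX].
    by move=> /cvgrPdist_le; apply; lra.
  have := hZ t n; have := hZ s n; rewrite distrC => h1 h2 h3.
  rewrite -(subrKA (X n (r t))) (le_trans (ler_normD _ _))//.
  rewrite -[X in _ + `|X|](subrKA (X n (r s))).
  have := ler_normD (X n (r t) - X n (r s)) (X n (r s) - Z s); lra.
(* The limit [Z] is frozen outside [[0, T]]; its image under the Picard operator is
   differentiable everywhere and agrees with [Z] on [[0, T]]. *)
exists (P Z); first exact: P0.
move=> t tT; rewrite (_ : P Z t = Z t); first exact: dP.
apply/eqP; rewrite -subr_eq0 -normr_le0; apply/ler_addgt0Pl => e e0; rewrite addr0.
have [|n hn] := small (e / 2); first by lra.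
have b0 m : 0 <= 2 * C / 2 ^+ m by rewrite divr_ge0 ?exprn_ge0// mulr_ge0// ltW.
have ZX s m : 0 <= s <= T -> `|Z s - X m s| <= 2 * C / 2 ^+ m.
  by move=> sT; have := hZ s m; rewrite /r restrict_time_id.
have h1 : `|P Z t - X n.+1 t| <= (2 * C / 2 ^+ n) / 2.
  by apply: (Pstep _ _ _ _ cZ (cX n)) => // s; exact: ZX.
have := ZX t n.+1 tT; rewrite distrC => h2.
have h3 : 2 * C / 2 ^+ n.+1 <= 2 * C / 2 ^+ n.
  by rewrite exprSr invfM mulrA ler_pdivrMr// ler_peMr// ler1n.
rewrite -(subrKA (X n.+1 t)) (le_trans (ler_normD _ _))//.
by lra.
Unshelve. all: by end_near. Qed.

End picard.

(** * Flows of locally Lipschitz fields for short times *)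

Section local_flow.
Context {R : realType} {d : nat}.
Local Notation V := 'rV[R]_d.

Definition lipschitz_on_balls (f : V -> V) := forall rho, exists2 L, 0 < L &
  forall x y, `|x| <= rho -> `|y| <= rho -> `|f x - f y| <= L * `|x - y|.

(** The nearest-point projection onto the cube is nonexpansive for the max norm;
    composing with it makes a locally Lipschitz field globally Lipschitz. *)
Definition proj_cube (rho : R) (x : V) : V :=
  \row_i Num.max (- rho) (Num.min rho (x 0 i)).

Lemma norm_proj_cube rho x : 0 <= rho -> `|proj_cube rho x| <= rho.
Proof.
move=> r0; apply: norm_le_coord => // i j; rewrite ord1 !mxE ler_norml.
rewrite le_max lexx/= ge_max ge_min lexx/= andbT; lra.
Qed.

Lemma proj_cube_id rho x : `|x| <= rho -> proj_cube rho x = x.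
Proof.
move=> xr; apply/rowP => i; rewrite !mxE.
have := le_trans (coord_le_norm x 0 i) xr; rewrite ler_norml => /andP[h1 h2].
by rewrite min_r// max_r.
Qed.

Lemma proj_cube_nexp rho x y : `|proj_cube rho x - proj_cube rho y| <= `|x - y|.
Proof.
apply: norm_le_coord => // i j; rewrite ord1 !mxE.
pose c u := Num.max (- rho) (Num.min rho u).
have cd u v : c v <= c u + `|v - u|.
  have h : - rho <= c u by rewrite /c le_max lexx.
  rewrite {1}/c ge_max; apply/andP; split; first by have := normr_ge0 (v - u); lra.
  have [ru|ur] := leP rho u.
    apply: (@le_trans _ _ rho); first by rewrite ge_min lexx.
    apply: (@le_trans _ _ (c u)); last by rewrite lerDl.
    by rewrite /c le_max le_min lexx ru orbT.
  apply: (@le_trans _ _ v); first by rewrite ge_min lexx orbT.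
  apply: (@le_trans _ _ (u + `|v - u|)); first by have := ler_norm (v - u); lra.
  by rewrite lerD2r /c le_max le_min (ltW ur) lexx orbT.
apply: (@le_trans _ _ `|x 0 j - y 0 j|).
  have := cd (x 0 j) (y 0 j); have := cd (y 0 j) (x 0 j).
  rewrite [`|y 0 j - _|]distrC ler_norml -/(c _) -/(c _) => h1 h2.
  by apply/andP; split; lra.
by have := coord_le_norm (x - y) 0 j; rewrite !mxE.
Qed.

(** Gronwall's argument: the squared Euclidean distance of two solutions, damped by an
    exponential, is nonincreasing. *)
Lemma solution_uniq (f : V -> V) (L rho T : R) (x y : R -> V) : 0 <= T -> 0 <= L ->
  (forall u v, `|u| <= rho -> `|v| <= rho -> `|f u - f v| <= L * `|u - v|) ->
  (forall t, 0 <= t <= T -> `|x t| <= rho) ->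
  (forall t, 0 <= t <= T -> `|y t| <= rho) ->
  (forall t : R, 0 <= t <= T -> is_derive t 1 x (f (x t))) ->
  (forall t : R, 0 <= t <= T -> is_derive t 1 y (f (y t))) ->
  x 0 = y 0 -> x T = y T.
Proof.
move=> T0 L0 fL xr yr dx dy xy0.
pose z t i := x t 0 i - y t 0 i.
pose dz t i := f (x t) 0 i - f (y t) 0 i.
have hz i (t : R) : 0 <= t <= T -> is_derive t 1 (z ^~ i) (dz t i).
  move=> tT; apply: is_deriveB.
    by have /is_derive_mxP := dx t tT; apply.
  by have /is_derive_mxP := dy t tT; apply.
pose S t := \sum_(i < d) z t i ^+ 2.
pose dS t := \sum_(i < d) (2 * z t i * dz t i).
have hS (t : R) : 0 <= t <= T -> is_derive t 1 S (dS t).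
  move=> tT; rewrite (_ : S = \sum_(i < d) (fun t => z t i ^+ 2)); last first.
    by apply/funext => s; rewrite fct_sumE.
  apply: is_derive_sum => i.
  rewrite (_ : (fun t => z t i ^+ 2) = (z ^~ i) * (z ^~ i)); last first.
    by apply/funext => s; rewrite expr2.
  have h := hz i t tT.
  rewrite (_ : 2 * z t i * dz t i = z t i *: dz t i + z t i *: dz t i).
    exact: (@is_deriveM R R (z ^~ i) (z ^~ i) t 1 _ _ h h).
  by rewrite /GRing.scale /=; ring.
pose c := 2 * d%:R * L.
pose g t := S t * expR (- c * t).
have hg (t : R) : 0 <= t <= T ->
    is_derive t 1 g (dS t * expR (- c * t) + S t * (- c * expR (- c * t))).
  move=> tT; have h := hS t tT.
  have he : is_derive t 1 (fun t => expR (- c * t)) (- c * expR (- c * t)).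
    have h1 : is_derive t 1 (fun t : R => - c * t) (- c).
      have := @is_deriveZ R R R id (- c) t 1 1 (is_derive_id _ _).
      by rewrite /GRing.scale/= mulr1.
    rewrite mulrC; exact: (@is_derive1_comp R expR (fun t => - c * t) t _ _ _ h1).
  rewrite addrC [dS t * _]mulrC.
  exact: (@is_deriveM R R S (fun t => expR (- c * t)) t 1 _ _ h he).
have [s /andP[s0 sT]] := MVT_real T0 hg.
rewrite subr0 {1 2}/g; rewrite (_ : S 0 = 0); last first.
  by rewrite /S big1// => i _; rewrite /z xy0 subrr expr0n.
have sT' : 0 <= s <= T by rewrite s0.
have dSS : dS s <= c * S s.
  have -> : c * S s = \sum_(i < d) (2 * (L * S s)).
    by rewrite sumr_const card_ord -mulr_natr /c; ring.
  rewrite /dS.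
  apply: ler_sum => i _; rewrite -mulrA ler_wpM2l//.
  apply: le_trans (ler_norm _) _; rewrite normrM.
  have zS j : `|z s j| ^+ 2 <= S s.
    rewrite real_normK ?num_real// /S (bigD1 j)//= lerDl.
    by apply: sumr_ge0 => k _; exact: sqr_ge0.
  have nS : `|x s - y s| ^+ 2 <= S s.
    have S0 : 0 <= S s by apply: sumr_ge0 => k _; exact: sqr_ge0.
    rewrite -(sqr_sqrtr S0) ler_pXn2r// ?nnegrE// ?sqrtr_ge0//.
    apply: norm_le_coord => [|k j]; first exact: sqrtr_ge0.
    rewrite ord1 !mxE -(@ler_pXn2r _ 2)// ?nnegrE ?sqrtr_ge0// sqr_sqrtr//.
    exact: zS.
  have dzL : `|dz s i| <= L * `|x s - y s|.
    apply: le_trans (fL _ _ (xr s sT') (yr s sT')).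
    by have := coord_le_norm (f (x s) - f (y s)) 0 i; rewrite !mxE.
  have zn : `|z s i| <= `|x s - y s|.
    by have := coord_le_norm (x s - y s) 0 i; rewrite !mxE.
  apply: (@le_trans _ _ (`|x s - y s| * (L * `|x s - y s|))).
    exact: ler_pM.
  by rewrite mulrCA ler_wpM2l.
rewrite mul0r subr0 => gT.
have : S T <= 0.
  rewrite -(pmulr_lle0 _ (expR_gt0 (- c * T))) gT; apply: mulr_le0_ge0 => //.
  rewrite (_ : _ + _ = (dS s - c * S s) * expR (- c * s)); last by ring.
  by rewrite mulr_le0_ge0 ?subr_le0// expR_ge0.
move=> ST; apply/rowP => i; apply/eqP; rewrite -subr_eq0 -(sqrf_eq0 (x T 0 i - _)).
rewrite eq_le sqr_ge0 andbT; apply: le_trans ST.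
by rewrite /S (bigD1 i)//= lerDl; apply: sumr_ge0 => k _; exact: sqr_ge0.
Qed.

(** The solution for the field truncated outside a cube does not leave the cube for a
    short time, so it solves the original equation. Any other solution is bounded on
    the compact time interval, so uniqueness holds and the flow map is defined. *)
Lemma flow_small_time (f : V -> V) rho : 0 <= rho -> lipschitz_on_balls f ->
  exists2 t0, 0 < t0 & exists2 C, 0 < C & forall t x, 0 <= t <= t0 ->
    `|x| <= rho -> exists2 y, flow f t x = Some y &
      `|y - (x + t *: f x)| <= C * t ^+ 2.
Proof.
move=> r0 lf; pose K := rho + 1; have K0 : 0 <= K by rewrite /K; lra.
have [L L0 fL] := lf K.
pose F x := f (proj_cube K x).
have FL x y : `|F x - F y| <= L * `|x - y|.
  apply: le_trans (fL _ _ (norm_proj_cube _ K0) (norm_proj_cube _ K0)) _.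
  by rewrite ler_pM2l// proj_cube_nexp.
pose B := `|f 0| + L * K + 1.
have B0 : 0 < B by rewrite /B; have := normr_ge0 (f 0); nra.
have FB x : `|F x| <= B.
  have := fL (proj_cube K x) 0 (norm_proj_cube _ K0).
  rewrite normr0 subr0 => /(_ K0) h.
  have := ler_normD (f (proj_cube K x) - f 0) (f 0); rewrite subrK.
  by have := norm_proj_cube x K0; rewrite /F /B; nra.
pose t0 := Num.min (1 / (2 * L)) (1 / B).
have t00 : 0 < t0 by rewrite lt_min !divr_gt0//; lra.
exists t0 => //; exists (L * B); first by rewrite mulr_gt0.
move=> t x /andP[tp]; rewrite le_min => /andP[tL tB] xr.
have Lt : L * t <= 1 / 2.
  move: tL; rewrite ler_pdivlMr; last lra.
  lra.
have Bt : B * t <= 1 by move: tB; rewrite ler_pdivlMr// mulrC.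
have [Y Y0 dY] := picard x tp Lt FL.
have Yx s : 0 <= s <= t -> `|Y s - x| <= B * s.
  move=> /andP[s0 st]; rewrite -Y0 -[s in B * s]subr0.
  apply: (@MVT_norm R d Y (fun s => F (Y s)) 0 s B s0) => [u /andP[u0 us]|u _];
    last exact: FB.
  by apply: dY; rewrite u0 (le_trans us).
have YK s : 0 <= s <= t -> `|Y s| <= K.
  move=> /[dup] /andP[s0 st] /Yx h; rewrite -[Y s](subrK x).
  rewrite (le_trans (ler_normD _ _))// addrC lerD//.
  by rewrite (le_trans h)// (le_trans _ Bt)// ler_pM2l.
have dYf (s : R) : 0 <= s <= t -> is_derive s 1 Y (f (Y s)).
  by move=> st; have := dY s st; rewrite /F proj_cube_id// YK.
have solY : solves_to f t x (Y t) by exists Y.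
have uniqY y : solves_to f t x y -> Y t = y.
  move=> [Z [Z0 dZ <-]].
  have cZ s : 0 <= s <= t -> {for s, continuous Z}.
    move=> st; apply: differentiable_continuous; apply/derivable1_diffP.
    by have [] := dZ s st.
  have [M M0 hM] : exists2 M, 0 < M & forall s, 0 <= s <= t -> `|Z s| <= M.
    have [||M M0 h] := @compact_bound R R V [set` `[0, t]] Z.
    - exact: segment_compact.
    - by move=> s; rewrite /= in_itv /=; exact: cZ.
    by exists M => // s st; apply: h; rewrite /= in_itv.
  have [L' L'0 fL'] := lf (Num.max K M).
  apply: (@solution_uniq f L' (Num.max K M) t) => //.
  - exact: ltW.
  - by move=> s st; rewrite le_max YK.
  - by move=> s st; rewrite le_max hM// orbT.
  by rewrite Y0 Z0.
exists (Y t).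
  rewrite /flow; case: pselect => [e|[]]; last by exists (Y t).
  by case: cid => /= y' [sy' _]; rewrite (uniqY _ sy').
have : `|(Y t - t *: f x) - (Y 0 - 0 *: f x)| <= L * (B * t) * (t - 0).
  apply: (@MVT_norm R d (fun s => Y s - s *: f x) (fun s => f (Y s) - f x)) => //.
    move=> s st; apply: is_deriveB; first exact: dYf.
    apply/is_derive_mxP => i j; rewrite ord1.
    rewrite (_ : (fun _ => _) = (fun s => (f x 0 j) *: s)); last first.
      by apply/funext => u; rewrite !mxE mulrC.
    have := @is_deriveZ R R R id (f x 0 j) s 1 1 (is_derive_id _ _).
    by rewrite /GRing.scale/= mulr1.
  move=> s /[dup] st /andP[s0 st']; apply: le_trans (fL _ _ _ _) _.
  - exact: YK.
  - by rewrite (le_trans xr)// /K lerDl.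
  rewrite ler_pM2l// (le_trans (Yx _ _))// ?s0// ler_pM2l//.
rewrite Y0 scale0r !subr0 -!mulrA -expr2 opprD [- x - _]addrC addrA.
by [].
Qed.

Lemma eq_flow_comp n (f g : nat -> V -> V) (s t : nat -> R) x :
  (forall i, (i < n)%N -> f i = g i) -> (forall i, (i < n)%N -> s i = t i) ->
  flow_comp n f s x = flow_comp n g t x.
Proof.
elim: n => [//|n IH] fg st /=.
rewrite /pcomp IH => [|i ni|i ni]; last 2 first.
- by apply: fg; exact: ltnW.
- by apply: st; exact: ltnW.
by rewrite fg// st.
Qed.

Lemma flow_comp_cat n m (f g : nat -> V -> V) (s t : nat -> R) x :
  pcomp (flow_comp m g t) (flow_comp n f s) x =
  flow_comp (m + n) (fun i => if (i < n)%N then f i else g (i - n)%N)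
    (fun i => if (i < n)%N then s i else t (i - n)%N) x.
Proof.
elim: m => [|m IH] /=.
  rewrite add0n /pcomp.
  transitivity (flow_comp n f s x); first by case: (flow_comp n f s x).
  by apply: eq_flow_comp => i ->.
rewrite /pcomp -IH /pcomp ltnNge leq_addl/= addnK.
by case: (flow_comp n f s x).
Qed.

Variable F : set (V -> V).

Lemma hypothesis_space_id : hypothesis_space F Some.
Proof. by exists 0%N, (fun=> id), (fun=> 0). Qed.

Lemma hypothesis_space_comp h k :
  hypothesis_space F h -> hypothesis_space F k -> hypothesis_space F (pcomp k h).
Proof.
move=> [n [f [s [fs ->]]]] [m [g [t [gt ->]]]].
exists (m + n)%N, (fun i => if (i < n)%N then f i else g (i - n)%N),
  (fun i => if (i < n)%N then s i else t (i - n)%N); split.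
  move=> i imn; case: ifPn => [|]; first exact: fs.
  rewrite -leqNgt => ni; apply: gt; by rewrite ltn_subLR// addnC.
by apply/funext => x; exact: flow_comp_cat.
Qed.

(** The flow of a control is a step along it with error [O(t ^+ 2)]. *)
Lemma vel_of_control f rho : F f -> lipschitz_on_balls f ->
  vel (hypothesis_space F) f rho.
Proof.
move=> Ff lf eps e0.
have [|t0 t00 [C C0 h]] := @flow_small_time f (Num.max rho 0) _ lf.
  by rewrite le_max lexx orbT.
exists (Num.min t0 (eps / C)); first by rewrite lt_min t00 divr_gt0.
move=> t /andP[tp]; rewrite le_min ler_pdivlMr// => /andP[tt0 tC].
exists (flow f t).
  exists 1%N, (fun=> f), (fun=> t); split; first by move=> *; split => //; exact: ltW.
  by apply/funext => x /=.
move=> x xr; have [| |y hy hyx] := h t x; first by rewrite ltW.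
  by rewrite le_max xr.
by exists y => //; apply: le_trans hyx _; rewrite expr2 mulrA ler_pM2r// mulrC.
Qed.

End local_flow.

(** * Matrices of positive determinant as products of exponentials *)

Section generation.
Context {R : realFieldType}.

(** Here [1%:M + N] is the exponential of the square-zero matrix [N], and
    [1%:M + (c - 1) *: E] is the exponential of [ln c *: E] for an idempotent [E].
    These two kinds of one-parameter groups have closed forms, so that no matrix
    exponential is needed. *)
Inductive exp_product n : 'M[R]_n -> Prop :=
| exp_product1 : exp_product 1%:M
| exp_product_unip N A : N *m N = 0 -> exp_product A ->
    exp_product (A *m (1%:M + N))
| exp_product_dil E c A : E *m E = E -> 0 < c -> exp_product A ->
    exp_product (A *m (1%:M + (c - 1) *: E)).

Lemma exp_productM n (A B : 'M[R]_n) :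
  exp_product A -> exp_product B -> exp_product (A *m B).
Proof.
move=> hA; elim=> [|N B' N0 _ IH|E c B' EE c0 _ IH]; first by rewrite mulmx1.
  by rewrite mulmxA; apply: exp_product_unip.
by rewrite mulmxA; apply: exp_product_dil.
Qed.

Lemma exp_product_unip1 n (N : 'M[R]_n) : N *m N = 0 -> exp_product (1%:M + N).
Proof.
move=> N0; rewrite -[X in exp_product X]mul1mx.
by apply: exp_product_unip => //; exact: exp_product1.
Qed.

Lemma exp_product_block n (A : 'M[R]_n) : exp_product A ->
  exp_product (block_mx 1%:M 0 0 A : 'M[R]_(1 + n)).
Proof.
elim=> [|N B N0 _ IH|E c B EE c0 _ IH]; first by rewrite -scalar_mx_block; exact: exp_product1.
  rewrite (_ : block_mx _ _ _ _ =
    block_mx 1%:M 0 0 B *m (1%:M + block_mx 0 0 0 N)); last first.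
    by rewrite scalar_mx_block add_block_mx mulmx_block !(addr0, add0r, mulmx0, mul0mx, mul1mx).
  apply: exp_product_unip => //.
  by rewrite mulmx_block !(addr0, add0r, mulmx0, mul0mx, N0) block_mx0.
rewrite (_ : block_mx _ _ _ _ =
  block_mx 1%:M 0 0 B *m (1%:M + (c - 1) *: block_mx 0 0 0 E)); last first.
  by rewrite scalar_mx_block scale_block_mx !scaler0 add_block_mx mulmx_block
    !(addr0, add0r, mulmx0, mul0mx, mul1mx).
apply: exp_product_dil => //.
by rewrite mulmx_block !(addr0, add0r, mulmx0, mul0mx, EE).
Qed.

(** Block elimination with pivot [1]: what remains is the Schur complement. *)
Lemma exp_product_corner1 n (r : 'rV[R]_n) (c : 'cV[R]_n) (Q : 'M[R]_n) :
  exp_product (Q - c *m r) -> exp_product (block_mx 1%:M r c Q : 'M[R]_(1 + n)).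
Proof.
move=> hQ.
rewrite (_ : block_mx _ _ _ _ = (1%:M + block_mx 0 0 c 0) *m
  (block_mx 1%:M 0 0 (Q - c *m r) *m (1%:M + block_mx 0 r 0 0))).
  apply: exp_productM; first apply: exp_product_unip1.
    by rewrite mulmx_block !(addr0, add0r, mulmx0, mul0mx) block_mx0.
  apply: exp_productM; first exact: exp_product_block.
  apply: exp_product_unip1.
  by rewrite mulmx_block !(addr0, add0r, mulmx0, mul0mx) block_mx0.
rewrite !scalar_mx_block !add_block_mx !mulmx_block.
by rewrite !(addr0, add0r, mulmx0, mul0mx, mul1mx, mulmx1) addrC subrK.
Qed.

Lemma mul_delta_mx_neq n (t : R) (i j : 'I_n) : i != j ->
  (t *: delta_mx i j) *m (t *: delta_mx i j) = 0 :> 'M[R]_n.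
Proof.
move=> ij; rewrite -scalemxAl -scalemxAr mul_delta_mx_0 ?scaler0//.
by rewrite eq_sym.
Qed.

Lemma exp_product_unip_inv n (N A : 'M[R]_n) : N *m N = 0 ->
  exp_product (A *m (1%:M + N)) -> exp_product A.
Proof.
move=> N0 h; rewrite (_ : A = A *m (1%:M + N) *m (1%:M + - N)).
  by apply: exp_product_unip; rewrite // mulNmx mulmxN opprK.
have -> : (A *m (1%:M + N)) *m (1%:M + - N) = A *m ((1%:M + N) *m (1%:M + - N)).
  by rewrite mulmxA.
suff -> : (1%:M + N) *m (1%:M + - N) = 1%:M by rewrite mulmx1.
by rewrite mulmxDl mul1mx mulmxDr mulmx1 mulmxN N0 oppr0 addr0 subrK.
Qed.

(** [1%:M + N] is invertible and is the square of [1%:M + 2^-1 *: N]. *)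
Lemma det_unip n (N : 'M[R]_n) : N *m N = 0 -> 0 < \det (1%:M + N).
Proof.
move=> N0; have h : (1%:M + N) = (1%:M + 2^-1 *: N) *m (1%:M + 2^-1 *: N).
  rewrite mulmxDl mul1mx mulmxDr mulmx1 -scalemxAl -scalemxAr N0 !scaler0 addr0.
  rewrite -addrA -scalerDl (_ : 2^-1 + 2^-1 = 1) ?scale1r//.
  by field.
have u : (1%:M + N) *m (1%:M - N) = 1%:M.
  by rewrite mulmxDl mul1mx mulmxBr mulmx1 N0 subr0 subrK.
rewrite lt_neqAle; apply/andP; split; last first.
  by rewrite h det_mulmx -expr2 sqr_ge0.
apply/eqP => d0; have := congr1 determinant u.
by rewrite det_mulmx -d0 mul0r det1 => /esym/eqP; rewrite oner_eq0.
Qed.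

(** Elimination by induction on the size: an off-diagonal entry of the first row,
    made nonzero if necessary, is used to turn the corner into [1], and then the
    Schur complement has the same determinant. Dilations are used only for matrices
    of size one. *)
Lemma exp_product_det_gt0 n (A : 'M[R]_n) : 0 < \det A -> exp_product A.
Proof.
elim: n A => [|n IH] A.
  by move=> _; rewrite (flatmx0 A) -(flatmx0 1%:M); exact: exp_product1.
move=> A0.
have corner (B : 'M[R]_(1 + n)) : 0 < \det B -> B 0 0 = 1 -> exp_product B.
  move=> B0 B1; rewrite -[B]submxK.
  have e1 : ulsubmx B = 1%:M.
    by apply/rowP => i; rewrite !ord1 !mxE (_ : lshift n 0 = 0) ?B1//; apply/val_inj.
  rewrite e1; apply: exp_product_corner1; apply: IH.
  move: B0; rewrite -{1}[B]submxK e1.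
  have -> : block_mx 1%:M (ursubmx B) (dlsubmx B) (drsubmx B) =
    (block_mx 1%:M 0 (dlsubmx B) 1%:M) *m
    (block_mx 1%:M (ursubmx B) 0 (drsubmx B - dlsubmx B *m ursubmx B)).
    by rewrite mulmx_block !(addr0, add0r, mulmx0, mul0mx, mul1mx, mulmx1) addrC subrK.
  by rewrite det_mulmx det_lblock det_ublock !det1 !mul1r.
have offdiag (B : 'M[R]_(1 + n)) (j : 'I_(1 + n)) : 0 < \det B -> j != 0 ->
    B 0 j != 0 -> exp_product B.
  move=> B0 j0 Bj.
  pose N : 'M[R]_(1 + n) := ((1 - B 0 0) / B 0 j) *: delta_mx j 0.
  have NN : N *m N = 0 by exact: mul_delta_mx_neq.
  apply: (exp_product_unip_inv NN); apply: corner.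
    by rewrite det_mulmx mulr_gt0// det_unip.
  rewrite mulmxDr mulmx1 mxE -scalemxAr mxE.
  rewrite mxE (bigD1 j)//= big1 => [|i ij]; last by rewrite mxE (negPf ij) mulr0.
  by rewrite mxE !eqxx mulr1 addr0 mulfVK// addrC subrK.
have [[j j0 Aj]|no] := pselect (exists2 j : 'I_n.+1, j != 0 & A 0 j != 0).
  exact: (offdiag A j).
have Az j : j != 0 -> A 0 j = 0.
  by move=> j0; apply/eqP; apply: contrapT => h; apply: no; exists j => //; apply/negP.
have A00 : A 0 0 != 0.
  apply/eqP => a0; move: A0; rewrite (expand_det_row _ 0) big1 ?ltxx// => j _.
  have [->|j0] := eqVneq j 0; first by rewrite a0 mul0r.
  by rewrite Az// mul0r.
case: n IH A A0 no Az A00 corner offdiag => [|n] IH A A0 no Az A00 corner offdiag.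
  have dA : \det A = A 0 0 by rewrite det_mx11.
  rewrite (_ : A = 1%:M *m (1%:M + (A 0 0 - 1) *: 1%:M)).
    by apply: exp_product_dil; [rewrite mulmx1|rewrite -dA|exact: exp_product1].
  by rewrite mul1mx; apply/matrixP => i j; rewrite !ord1 !mxE eqxx mulr1 addrC subrK.
pose j1 : 'I_n.+2 := lift ord0 ord0.
have j10 : j1 != 0 by [].
pose N : 'M[R]_n.+2 := 1 *: delta_mx 0 j1.
have NN : N *m N = 0 by apply: mul_delta_mx_neq; rewrite eq_sym.
apply: (exp_product_unip_inv NN); apply: (offdiag _ j1) => //.
  by rewrite det_mulmx mulr_gt0// det_unip.
rewrite mulmxDr mulmx1 mxE Az// add0r -scalemxAr mxE mul1r.
rewrite mxE (bigD1 0)//= big1 => [|i i0]; last by rewrite mxE (negPf i0) mulr0.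
by rewrite mxE !eqxx mulr1 addr0.
Qed.

End generation.

(** * Continuity and first-order expansions of matrix-valued maps *)

Section smooth_maps.
Context {R : realType} {d : nat}.
Local Notation V := 'rV[R]_d.

Lemma norm_mulmx (m n p : nat) (A : 'M[R]_(m, n)) (B : 'M[R]_(n, p)) :
  `|A *m B| <= n%:R * `|A| * `|B|.
Proof.
apply: norm_le_coord => [|i j]; first by rewrite !mulr_ge0.
rewrite mxE (le_trans (ler_norm_sum _ _ _))//.
rewrite (_ : _ * _ = \sum_(k < n) (`|A| * `|B|)); last first.
  by rewrite sumr_const card_ord -[RHS]mulr_natl; ring.
by apply: ler_sum => k _; rewrite normrM ler_pM//; exact: coord_le_norm.
Qed.

Lemma cont_rV (X : topologicalType) (m n : nat) (f : X -> 'M[R]_(m, n)) :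
  (forall i j, continuous (fun x => f x i j)) -> continuous f.
Proof.
move=> cf x; apply/cvgrPdist_le => e e0.
have h : \forall y \near x, forall i j, `|f x i j - f y i j| <= e.
  apply: filter_forall => i; apply: filter_forall => j.
  by have /cvgrPdist_le := cf i j x; apply.
apply: filterS h => y hy; apply: norm_le_coord => [|i j]; first exact: ltW.
by rewrite !mxE.
Qed.

Lemma cont_coord (X : topologicalType) (m n : nat) (f : X -> 'M[R]_(m, n)) i j :
  continuous f -> continuous (fun x => f x i j).
Proof.
move=> cf x; apply: (@continuous_comp _ _ _ f (fun M : 'M[R]_(m, n) => M i j)).
  exact: cf.
exact: coord_continuous.
Qed.

Lemma cont_sum (X : topologicalType) (n : nat) (f : 'I_n -> X -> R) :
  (forall i, continuous (f i)) -> continuous (fun x => \sum_i f i x).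
Proof.
by move=> cf x; apply: cvg_big => [|i _]; [exact: add_continuous|exact: cf].
Qed.

Lemma cont_mulmx (X : topologicalType) (m n p : nat) (f : X -> 'M[R]_(m, n))
  (g : X -> 'M[R]_(n, p)) : continuous f -> continuous g ->
  continuous (fun x => f x *m g x).
Proof.
move=> cf cg; apply: cont_rV => i j.
rewrite (_ : (fun _ => _) = (fun x => \sum_k f x i k * g x k j)); last first.
  by apply/funext => x; rewrite mxE.
apply: cont_sum => k x.
apply: (@continuousM _ _ (fun x => f x i k) (fun x => g x k j)).
  exact: (@cont_coord _ _ _ f).
exact: (@cont_coord _ _ _ g).
Qed.

Lemma cont_comp (X Y Z : topologicalType) (f : X -> Y) (g : Y -> Z) :
  continuous f -> continuous g -> continuous (fun x => g (f x)).
Proof. by move=> cf cg x; apply: (@continuous_comp _ _ _ f g); [exact: cf|exact: cg]. Qed.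

Section algebra.
Context {X : topologicalType} {W : normedModType R}.
Implicit Types (f g : X -> W) (s : X -> R).

Lemma contD f g : continuous f -> continuous g -> continuous (fun x => f x + g x).
Proof. by move=> cf cg x; apply: (@cvgD _ W); [exact: cf|exact: cg]. Qed.

Lemma contB f g : continuous f -> continuous g -> continuous (fun x => f x - g x).
Proof. by move=> cf cg x; apply: (@cvgB _ W); [exact: cf|exact: cg]. Qed.

Lemma contN f : continuous f -> continuous (fun x => - f x).
Proof. by move=> cf x; apply: (@cvgN _ W); exact: cf. Qed.

Lemma contZ s f : continuous s -> continuous f -> continuous (fun x => s x *: f x).
Proof. by move=> cs cf x; apply: (@cvgZ _ W); [exact: cs|exact: cf]. Qed.

Lemma contM s t : continuous s -> continuous t -> continuous (fun x => s x * t x).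
Proof. by move=> cs cf x; apply: (@cvgM R); [exact: cs|exact: cf]. Qed.

Lemma contX s n : continuous s -> continuous (fun x => s x ^+ n).
Proof.
move=> cs; elim: n => [|n IH].
  by rewrite (_ : (fun _ => _) = (fun=> 1)); [exact: cst_continuous|exact/funext].
rewrite (_ : (fun _ => _) = (fun x => s x * s x ^+ n)); first exact: contM.
by apply/funext => x; rewrite exprS.
Qed.

End algebra.

Lemma C1_cont (g : V -> V) : C1 g -> continuous g.
Proof. by move=> [dg _] x; exact: differentiable_continuous. Qed.

Lemma is_derive_line (g : V -> V) (x h : V) (t : R) : C1 g ->
  is_derive t 1 (fun t => g (x + t *: h)) (h *m 'J g (x + t *: h)).
Proof.
move=> [dg _].
have dl : is_diff t (fun t : R => x + t *: h) (fun s : R => s *: h).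
  rewrite (_ : (fun s : R => s *: h) = (fun=> 0) + (fun s : R => s *: h)); last first.
    by apply/funext => s; rewrite /= [RHS]add0r.
  have h1 : is_diff t (fun=> x : V) (fun _ : R => 0 : V).
    by apply: is_diff_eq.
  have h2 : is_diff t (fun s : R => s *: h) (fun s : R => s *: h).
    exact: (@is_diff_scalel _ _ _ _).
  exact: is_diffD.
have dc : differentiable (fun t : R => g (x + t *: h)) t.
  by apply: (@differentiable_comp _ _ _ _ (fun t : R => x + t *: h) g).
split; first exact/derivable1_diffP.
rewrite deriveE// (@diff_comp _ _ _ _ (fun t : R => x + t *: h) g)//=.
by rewrite diff_val /= scale1r -deriveE// deriveEjacobian.
Qed.

(** The mean value inequality along the segment turns uniform continuity of the
    Jacobian into a first-order expansion that is uniform on cubes. *)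
Lemma C1_expand (g : V -> V) : C1 g -> forall rho eps, 0 < eps ->
  exists2 dlt, 0 < dlt & forall x h, `|x| <= rho -> `|h| <= dlt ->
    `|g (x + h) - g x - h *m 'J g x| <= eps * `|h|.
Proof.
move=> C1g rho eps e0; have [_ cJ] := C1g.
have e10 : 0 < eps / (d%:R + 1) by rewrite divr_gt0// ltr_wpDl.
have [dl dl0 hJ] := ball_unif_cont cJ rho e10.
exists dl => // x h xr hd.
have : `|(g (x + 1 *: h) - 1 *: (h *m 'J g x)) - (g (x + 0 *: h) - 0 *: (h *m 'J g x))|
    <= (eps * `|h|) * (1 - 0).
  apply: (@MVT_norm R d (fun t => g (x + t *: h) - t *: (h *m 'J g x))
    (fun t => h *m 'J g (x + t *: h) - h *m 'J g x)); first exact: ler01.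
    move=> t _; apply: is_deriveB; first exact: is_derive_line.
    apply/is_derive_mxP => i j.
    rewrite (_ : (fun _ => _) = (fun s => ((h *m 'J g x) i j) *: s)); last first.
      by apply/funext => u; rewrite mxE mulrC.
    have := @is_deriveZ R R R id ((h *m 'J g x) i j) t 1 1 (is_derive_id _ _).
    by rewrite /GRing.scale/= mulr1.
  move=> t /andP[t0 t1]; rewrite -mulmxBr (le_trans (norm_mulmx _ _))//.
  have hh : `|'J g (x + t *: h) - 'J g x| <= eps / (d%:R + 1).
    rewrite -normrN opprB; apply: hJ => //; rewrite opprD addrA subrr sub0r normrN normrZ ger0_norm//.
    by rewrite (le_trans _ hd)// ler_piMl.
  apply: (@le_trans _ _ (d%:R * `|h| * (eps / (d%:R + 1)))).
    by rewrite ler_wpM2l// mulr_ge0.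
  rewrite mulrAC ler_wpM2r//.
  rewrite mulrA ler_pdivrMr; last by rewrite ltr_wpDl.
  by rewrite mulrC ler_pM2l// lerDl.
rewrite !scale0r !scale1r addr0 !subr0 mulr1 => hh.
by rewrite addrAC.
Qed.

Lemma C1_lipschitz (g : V -> V) : C1 g -> lipschitz_on_balls g.
Proof.
move=> C1g rho; have [_ cJ] := C1g.
have [M M0 hM] := ball_bound cJ rho.
exists (d%:R * M + 1); first by rewrite ltr_wpDl// mulr_ge0// ltW.
move=> y x yr xr.
have : `|g (x + 1 *: (y - x)) - g (x + 0 *: (y - x))|
    <= ((d%:R * M + 1) * `|y - x|) * (1 - 0).
  apply: (@MVT_norm R d (fun t => g (x + t *: (y - x)))
    (fun t => (y - x) *m 'J g (x + t *: (y - x)))); first exact: ler01.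
    by move=> t _; exact: is_derive_line.
  move=> t /andP[t0 t1]; rewrite (le_trans (norm_mulmx _ _))//.
  have : `|'J g (x + t *: (y - x))| <= M.
    apply: hM; rewrite (_ : x + _ = (1 - t) *: x + t *: y); last first.
      by apply/rowP => i; rewrite !mxE; ring.
    rewrite (le_trans (ler_normD _ _))// !normrZ !ger0_norm ?subr_ge0//.
    have : (1 - t) * `|x| <= (1 - t) * rho by rewrite ler_wpM2l// subr_ge0.
    have : t * `|y| <= t * rho by rewrite ler_wpM2l.
    lra.
  move=> hh; rewrite mulrAC ler_wpM2r//.
  by rewrite (@le_trans _ _ (d%:R * M))// ?lerDl// ler_wpM2l.
by rewrite scale0r scale1r addr0 subr0 mulr1 [x + _]addrC subrK.
Qed.

End smooth_maps.

(** * Reachability of affine maps *)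

Section reachable_diffeomorphisms.
Context {R : realType} {d : nat}.
Local Notation V := 'rV[R]_d.
Variable H : set (V -> option V).
Hypothesis H_id : H Some.
Hypothesis H_comp : forall h k, H h -> H k -> H (pcomp k h).
Hypothesis vel_affine : forall (A : 'M[R]_d) (b : V) rho,
  vel H (fun x => x *m A + b) rho.

Lemma reach_closed g rho :
  (forall eps, 0 < eps -> exists2 g', reach H g' rho &
    forall x, `|x| <= rho -> `|g' x - g x| <= eps) -> reach H g rho.
Proof.
move=> hg eps e0; have e20 : 0 < eps / 2 by lra.
have [g' rg' gg'] := hg _ e20; have [h Hh hh] := rg' _ e20.
exists h => // x xr; have [y hxy yg] := hh x xr; exists y => //.
rewrite -(subrKA (g' x)) (le_trans (ler_normD _ _))//.
by have := gg' x xr; lra.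
Qed.

Lemma reach_comp_cont g k : continuous g -> continuous k ->
  (forall rho, reach H g rho) -> (forall rho, reach H k rho) ->
  forall rho, reach H (fun x => k (g x)) rho.
Proof.
move=> cg ck rg rk rho; have [M M0 gM] := ball_bound cg rho.
apply: (reach_comp H_comp (rho' := M + 1) ltr01) => [x /gM||//|//]; first lra.
move=> eps e0; have [dl dl0 h] := ball_unif_cont ck (M + 1) e0.
by exists dl => // x y xM _; exact: h.
Qed.

Lemma reach_translation b rho : reach H (fun x => x + b) rho.
Proof.
have -> : (fun x => x + b) = (fun t x => x + t *: b) (1 : R).
  by apply/funext => x; rewrite scale1r.
apply: (@vel_reach _ _ _ H_id H_comp (fun t x => x + t *: b) (fun=> b) rho (`|rho| + `|b|) 1 1) => //.
- by have := ler_norm rho; have := normr_ge0 b; lra.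
- by move=> x _; rewrite scale0r addr0.
- by move=> s t x *; rewrite -addrA -scalerDl.
- move=> t x /andP[t0 t1] xr; rewrite (le_trans (ler_normD _ _))// lerD//.
    by rewrite (le_trans xr)// ler_norm.
  by rewrite normrZ ger0_norm// ler_piMl.
- by move=> t x y *; rewrite mul1r opprD addrACA subrr addr0.
- move=> eps e0; exists 1 => // t /andP[t0 _] x _.
  by rewrite subrr normr0 mulr_ge0// ltW.
have := vel_affine 0 b; rewrite (_ : (fun _ => _) = (fun=> b)); first exact.
by apply/funext => x; rewrite mulmx0 add0r.
Qed.

(** A one-parameter group of matrices with generator [A] is the flow of the linear
    field [A], so the Lax principle applies to it. *)
Lemma reach_matrix_semigroup (M : R -> 'M[R]_d) (A : 'M[R]_d) (c T : R) :
  0 < T -> 1 <= c -> M 0 = 1%:M ->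
  (forall s t, M s *m M t = M (s + t)) ->
  (forall t, 0 <= t <= T -> `|M t| <= c) ->
  (forall eps, 0 < eps -> exists2 t0, 0 < t0 & forall t, 0 < t <= t0 ->
    `|M t - (1%:M + t *: A)| <= eps * t) ->
  forall rho, reach H (fun x => x *m M T) rho.
Proof.
move=> T0 c1 M0 MD Mc MA rho.
have d1 : 1 <= (d%:R + 1 : R) by rewrite lerDr.
have dMc (x : V) (t : R) : 0 <= t <= T -> `|x *m M t| <= (d%:R + 1) * c * `|x|.
  move=> tT; rewrite (le_trans (norm_mulmx _ _))// mulrAC ler_wpM2r//.
  by rewrite ler_pM// ?Mc// lerDl.
pose r := Num.max rho 0.
have dc0 : 1 <= (d%:R + 1) * c.
  by have := ler_pM ler01 ler01 d1 c1; rewrite mulr1.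
apply: (@vel_reach _ _ _ H_id H_comp (fun t x => x *m M t) (fun x => x *m A) rho
  ((d%:R + 1) * c * r) T ((d%:R + 1) * c)) => //.
- have r0 : 0 <= r by rewrite le_max lexx orbT.
  apply: (@le_trans _ _ r); first by rewrite le_max lexx.
  by rewrite ler_peMl.
- by move=> x _; rewrite M0 mulmx1.
- by move=> s t x *; rewrite -mulmxA MD.
- move=> t x tT xr; rewrite (le_trans (dMc x t tT))// ler_wpM2l//; first lra.
  by rewrite le_max xr.
- by move=> t x y tT *; rewrite -mulmxBl; exact: dMc.
- move=> eps e0.
  pose k := (d%:R + 1) * ((d%:R + 1) * c * r + 1).
  have k0 : 0 < k.
    by rewrite mulr_gt0// ltr_wpDl// mulr_ge0// ?le_max ?lexx ?orbT//; lra.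
  have [|t0 t00 ht] := MA (eps / k); first exact: divr_gt0.
  exists t0 => // t /[dup] /andP[t1 _] /ht hM x xr.
  rewrite scalemxAr -{2}[x]mulmx1 -mulmxDr -mulmxBr (le_trans (norm_mulmx _ _))//.
  apply: (@le_trans _ _ (k * (eps / k * t))).
    rewrite ler_pM// ?mulr_ge0//; apply: ler_pM => //.
    by rewrite lerDl.
  by rewrite mulrA mulrCA divff ?mulr1// gt_eqF.
have := vel_affine A 0; rewrite (_ : (fun _ => _) = (fun x => x *m A)); first exact.
by apply/funext => x; rewrite addr0.
Qed.

Lemma expR_small (eps : R) : 0 < eps -> exists2 t0, 0 < t0 &
  forall t, `|t| <= t0 -> `|expR t - 1 - t| <= eps * `|t|.
Proof.
move=> e0.
have : {for (0 : R), continuous expR} by exact: continuous_expR.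
move=> /cvgrPdist_le /(_ _ e0) /nbhs_ballP[r /= r0 h].
exists (r / 2); first by rewrite divr_gt0.
have hc c : `|c| <= r / 2 -> `|expR c - 1| <= eps.
  move=> cr; have := h c; rewrite -ball_normE /= sub0r normrN expR0 distrC; apply.
  by apply: le_lt_trans cr _; lra.
move=> t; have [t0|t0] := leP 0 t; rewrite ?(ger0_norm t0) ?(ltr0_norm t0) => tr.
  have [c /andP[c0 ct]] := @MVT_real R expR expR 0 t t0 (fun s _ => is_derive_expR s).
  rewrite expR0 subr0 => ->.
  rewrite (_ : expR c * t - t = (expR c - 1) * t); last by ring.
  rewrite normrM [`|t|]ger0_norm// ler_wpM2r// hc// ger0_norm//; lra.
have [c /andP[c0 ct]] := @MVT_real R expR expR t 0 (ltW t0) (fun s _ => is_derive_expR s).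
rewrite expR0 => e; rewrite (_ : expR t - 1 - t = (expR c - 1) * t); last first.
  rewrite mulrBl mul1r; congr (_ - _).
  by rewrite -(opprB 1) e sub0r mulrN opprK.
rewrite normrM (ltr0_norm t0); apply: ler_wpM2r; first by rewrite oppr_ge0 ltW.
by rewrite hc// ler0_norm//; lra.
Qed.

Lemma reach_matrix P : 0 < \det P -> forall rho, reach H (fun x => x *m P) rho.
Proof.
move=> /exp_product_det_gt0.
have cM (B : 'M[R]_d) : continuous (fun x : V => x *m B).
  apply: (@cont_mulmx R V _ _ _ id (fun=> B)); [by move=> x|exact: cst_continuous].
elim=> [|N A N0 _ IH|E c A EE c0 _ IH] rho.
- move=> eps e0; exists Some => // x _; exists x => //.
  by rewrite mulmx1 subrr normr0 ltW.
- rewrite (_ : (fun x => _) = (fun x => (x *m A) *m (1%:M + N))); last first.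
    by apply/funext => x; rewrite mulmxA.
  apply: (@reach_comp_cont (fun x => x *m A) (fun x => x *m (1%:M + N)));
    [exact: cM|exact: cM|exact: IH|move=> {}rho].
  rewrite -[N]scale1r.
  apply: (@reach_matrix_semigroup (fun t => 1%:M + t *: N) N (1 + `|1%:M : 'M[R]_d| + `|N|)) => //.
  + by rewrite -addrA lerDl addr_ge0.
  + by rewrite scale0r addr0.
  + move=> s t; rewrite mulmxDl mul1mx mulmxDr mulmx1 -scalemxAl -scalemxAr N0.
    by rewrite !scaler0 addr0 -addrA -scalerDl [t + s]addrC.
  + move=> t /andP[t0 t1]; rewrite (le_trans (ler_normD _ _))// normrZ ger0_norm//.
    have : t * `|N| <= `|N| by rewrite ler_piMl.
    lra.
  + move=> eps e0; exists 1 => // t /andP[t0 _]; by rewrite subrr normr0 mulr_ge0// ltW.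
rewrite (_ : (fun x => _) = (fun x => (x *m A) *m (1%:M + (c - 1) *: E))); last first.
  by apply/funext => x; rewrite mulmxA.
apply: (@reach_comp_cont (fun x => x *m A) (fun x => x *m (1%:M + (c - 1) *: E)));
  [exact: cM|exact: cM|exact: IH|move=> {}rho].
have cE : c = expR (1 * ln c) by rewrite mul1r lnK.
rewrite cE; set l := ln c.
pose m := expR `|l|.
have m1 : 1 <= m by rewrite -expR0 ler_expR.
apply: (@reach_matrix_semigroup (fun t => 1%:M + (expR (t * l) - 1) *: E) (l *: E)
  (1 + `|1%:M : 'M[R]_d| + m * `|E|)) => //.
- by rewrite -addrA lerDl addr_ge0// mulr_ge0//; lra.
- by rewrite mul0r expR0 subrr scale0r addr0.
- move=> s t; rewrite mulmxDl mul1mx mulmxDr mulmx1 -scalemxAl -scalemxAr EE.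
  rewrite -!addrA; congr (_ + _); rewrite scalerA -!scalerDl; congr (_ *: _).
  by rewrite [(s + t) * l]mulrDl expRD; ring.
- move=> t /andP[t0 t1]; rewrite (le_trans (ler_normD _ _))// normrZ.
  have : `|expR (t * l) - 1| <= m.
    have h : expR (t * l) <= m.
      rewrite ler_expR (le_trans (ler_norm _))// normrM ger0_norm//.
      by rewrite ler_piMl.
    by rewrite ler_norml; have := expR_gt0 (t * l); lra.
  move=> h; have : `|expR (t * l) - 1| * `|E| <= m * `|E| by rewrite ler_wpM2r.
  lra.
move=> eps e0.
pose k := (`|l| + 1) * (`|E| + 1).
have k0 : 0 < k by rewrite mulr_gt0// ltr_wpDl.
have [|t0 t00 ht] := @expR_small (eps / k); first exact: divr_gt0.
exists (t0 / (`|l| + 1)); first by rewrite divr_gt0// ltr_wpDl.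
move=> t /andP[tp]; rewrite ler_pdivlMr ?ltr_wpDl// => tl.
rewrite (_ : _ - _ = (expR (t * l) - 1 - t * l) *: E); last first.
  by apply/matrixP => i j; rewrite !mxE; ring.
rewrite normrZ.
have ltl : `|t * l| <= t0.
  rewrite normrM gtr0_norm// (le_trans _ tl)// ler_pM2l// lerDl//.
have := ht (t * l) ltl; rewrite normrM gtr0_norm// => hh.
apply: (@le_trans _ _ ((eps / k * (t * (`|l| + 1))) * (`|E| + 1))).
  rewrite ler_pM// ?lerDl//; apply: le_trans hh _; rewrite ler_wpM2l//.
    by rewrite ltW// divr_gt0.
  by rewrite ler_pM2l// lerDl.
rewrite (_ : _ * (`|E| + 1) = eps * t * (k / k)); last by rewrite /k; field; rewrite !gt_eqF// ltr_wpDl.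
by rewrite divff ?mulr1// gt_eqF.
Qed.

Lemma reach_affine P b : 0 < \det P -> forall rho, reach H (fun x => x *m P + b) rho.
Proof.
move=> P0; apply: (@reach_comp_cont (fun x => x *m P) (fun x => x + b)).
- by apply: (@cont_mulmx R V _ _ _ id (fun=> P)); [move=> x|exact: cst_continuous].
- by move=> x; apply: (@continuousD R V V id (fun=> b)); [|exact: cst_continuous].
- exact: reach_matrix.
- by move=> rho; exact: reach_translation.
Qed.

End reachable_diffeomorphisms.

(** * Reachability of diffeomorphisms *)

Section diffeomorphisms.
Context {R : realType} {d : nat}.
Local Notation V := 'rV[R]_d.
Variable H : set (V -> option V).
Hypothesis H_id : H Some.
Hypothesis H_comp : forall h k, H h -> H k -> H (pcomp k h).
Hypothesis vel_affine : forall (A : 'M[R]_d) (b : V) rho,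
  vel H (fun x => x *m A + b) rho.
Hypothesis vel_cont : forall v : V -> V, continuous v -> forall rho, vel H v rho.

(** The conjugate of the dilation group by a diffeomorphism [g] is the flow of the
    push-forward [v] of the radial field. This field is continuous but need not be
    Lipschitz: the stability needed to follow the flow comes from its explicit
    form. *)
Lemma reach_conj_dilation (g g' : V -> V) : C1 g -> C1 g' ->
  cancel g g' -> cancel g' g -> forall T rho, 0 < T ->
  reach H (fun y => g (expR T *: g' y)) rho.
Proof.
move=> C1g C1g' gK g'K T rho T0.
have cg := C1_cont C1g; have cg' := C1_cont C1g'.
have [_ cJ] := C1g.
pose v y := g' y *m 'J g (g' y).
have cv : continuous v.
  apply: (@cont_mulmx R V _ _ _ g' (fun y => 'J g (g' y))); first exact: cg'.
  by move=> y; apply: (@continuous_comp _ _ _ g' (fun z => 'J g z)); [exact: cg'|exact: cJ].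
have eT t : 0 <= t <= T -> 0 < expR t <= expR T.
  by move=> /andP[_ tT]; rewrite expR_gt0 ler_expR.
have [m1 m10 g'm1] := ball_bound cg' rho.
have [K0 K00 gK0] := ball_bound cg (expR T * m1).
pose K := Num.max K0 rho.
have [m2 m20 g'm2] := ball_bound cg' (K + 1).
have [L1 L10 gL1] := C1_lipschitz C1g (expR T * m2).
have [L2 L20 gL2] := C1_lipschitz C1g' (K + 1).
have eb t z m : 0 <= t <= T -> `|z| <= m -> `|expR t *: z| <= expR T * m.
  move=> /eT /andP[e0 eTT] zm; rewrite normrZ gtr0_norm//.
  by rewrite ler_pM// ltW.
apply: (@vel_reach _ _ _ H_id H_comp (fun t y => g (expR t *: g' y)) v rho K T
  (1 + L1 * (expR T * L2))) => //.
- by rewrite lerDl !mulr_ge0// ?expR_ge0// ltW.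
- by rewrite le_max lexx orbT.
- by move=> y _; rewrite expR0 scale1r g'K.
- by move=> s t y *; rewrite gK scalerA -expRD addrC.
- move=> t y tT yr; rewrite le_max; apply/orP; left; apply: gK0.
  by apply: eb => //; exact: g'm1.
- move=> t y z tT yK zK.
  apply: le_trans (gL1 _ _ _ _) _; [by apply: eb => //; exact: g'm2|
    by apply: eb => //; exact: g'm2|].
  apply: (@le_trans _ _ (L1 * (expR T * L2 * `|y - z|))); last first.
    by rewrite mulrA ler_wpM2r// lerDr.
  rewrite ler_pM2l// -scalerBr normrZ -mulrA; apply: ler_pM => //.
    by rewrite gtr0_norm ?expR_gt0// ler_expR; case/andP: tT.
  exact: gL2.
- move=> eps e0.
  have [M M0 JM] := ball_bound cJ m2.
  pose k := m2 * 2 + d%:R * m2 * M + 1.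
  have k0 : 0 < k.
    by rewrite ltr_wpDl// addr_ge0// !mulr_ge0// ltW.
  have e'0 : 0 < eps / k by rewrite divr_gt0.
  have [dl dl0 hg] := C1_expand C1g m2 e'0.
  have [t1 t10 ht1] := expR_small e'0.
  have [t2 t20 ht2] := @expR_small R 1 ltr01.
  exists (Num.min (Num.min t1 t2) (dl / (2 * m2))).
    by rewrite !lt_min t10 t20 divr_gt0// mulr_gt0.
  move=> t /andP[t0]; rewrite !le_min => /andP[/andP[tt1 tt2]].
  rewrite ler_pdivlMr ?mulr_gt0// => tdl y yK.
  pose z := g' y; have zm : `|z| <= m2 by exact: g'm2.
  have h1 : `|expR t - 1 - t| <= eps / k * t.
    by rewrite -[X in _ * X]gtr0_norm// ht1// gtr0_norm.
  have h2 : `|expR t - 1| <= 2 * t.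
    have : `|expR t - 1 - t| <= 1 * t by rewrite -[X in _ * X]gtr0_norm// ht2// gtr0_norm.
    by rewrite !ler_norml => /andP[]; lra.
  have hn : `|(expR t - 1) *: z| <= 2 * t * m2 by rewrite normrZ ler_pM.
  have := hg z ((expR t - 1) *: z) zm.
  rewrite (_ : z + (expR t - 1) *: z = expR t *: z); last first.
    by rewrite scalerBl scale1r addrC subrK.
  have hdl : `|(expR t - 1) *: z| <= dl by rewrite (le_trans hn)// (_ : 2 * t * m2 = t * (2 * m2))//; ring.
  move=> /(_ hdl) h3.
  rewrite -/z /v -/z -[y in X in _ - X]g'K -/z.
  rewrite (_ : _ - _ = (g (expR t *: z) - g z - (expR t - 1) *: z *m 'J g z)
     + (expR t - 1 - t) *: (z *m 'J g z)); last first.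
    rewrite -scalemxAl; apply/rowP => i; rewrite !mxE; ring.
  rewrite (le_trans (ler_normD _ _))// normrZ.
  have h4 : `|z *m 'J g z| <= d%:R * m2 * M.
    by rewrite (le_trans (norm_mulmx _ _))// ler_pM// ?mulr_ge0// ?JM// ler_wpM2l.
  have h5 : eps / k * `|(expR t - 1) *: z| <= eps / k * (2 * t * m2) by rewrite ler_pM2l.
  have h6 : `|expR t - 1 - t| * `|z *m 'J g z| <= eps / k * t * (d%:R * m2 * M) by rewrite ler_pM.
  apply: (@le_trans _ _ (eps / k * (2 * t * m2) + eps / k * t * (d%:R * m2 * M))).
    by rewrite lerD// (le_trans h3).
  rewrite (_ : _ + _ = (eps / k * t) * (k - 1)); last by rewrite /k; ring.
  rewrite (_ : eps * t = (eps / k * t) * k); last by field; rewrite gt_eqF.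
  by apply: ler_wpM2l; [rewrite mulr_ge0// ltW|rewrite lerBlDr lerDl].
exact: vel_cont.
Qed.

(** Write [g x] as the image of [g (expR (- T) *: x)] under the conjugated dilation
    of time [T]. Near the origin [g] is affine up to an error [o(expR (- T))], and
    the conjugated dilation multiplies errors by a multiple of [expR T]. The affine
    part has linear part [expR (- T) *: 'J g 0], of positive determinant. *)
Theorem reach_diffeo (g : V -> V) : Diff0 g -> forall rho, reach H g rho.
Proof.
move=> [C1g [g' [gK g'K C1g']] detg] rho.
wlog rho0 : rho / 0 < rho.
  move=> h; apply: (@reachS _ _ _ _ _ (Num.max rho 1)); first by rewrite le_max lexx.
  by apply: h; rewrite lt_max ltr01 orbT.
have cg := C1_cont C1g; have cg' := C1_cont C1g'.
apply: reach_closed => eps e0.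
have [L1 L10 gL1] := C1_lipschitz C1g (rho + 1).
have [L2 L20 gL2] := C1_lipschitz C1g' (`|g 0| + 1).
pose e1 := Num.min 1 eps / ((L1 + 1) * L2 * (rho + 1)).
have me : 0 < Num.min 1 eps by rewrite lt_min ltr01.
have e10 : 0 < e1 by rewrite divr_gt0// !mulr_gt0//; lra.
have e1E : (L1 + 1) * (L2 * (e1 * (rho + 1))) = Num.min 1 eps.
  by rewrite /e1; field; rewrite !gt_eqF//; lra.
have [dl dl0 hg] := C1_expand C1g 0 e10.
have [dl2 dl20 hc] := ball_unif_cont cg 0 ltr01.
(* [m] bounds [q *: x]; the three constraints make the expansion of [g] at [0]
   valid there and keep [a x] and [g (q *: x)] in the cube of radius [`|g 0| + 1],
   on which [g'] is [L2]-Lipschitz. *)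
pose m := Num.min (Num.min dl dl2) (`|'J g 0| * d%:R + 1)^-1.
have JJ : 0 < `|'J g 0| * d%:R + 1 by rewrite ltr_wpDl// mulr_ge0.
have m0 : 0 < m by rewrite !lt_min dl0 dl20/= invr_gt0.
have [mdl mdl2 mJ] : [/\ m <= dl, m <= dl2 & m <= (`|'J g 0| * d%:R + 1)^-1].
  by split; rewrite !ge_min lexx ?orbT.
pose T := ln (1 + rho / m).
have rm0 : 0 < rho / m by rewrite divr_gt0.
have T0 : 0 < T by rewrite ln_gt0// ltrDl.
have eT : expR T = 1 + rho / m by rewrite lnK// posrE; lra.
pose q := (expR T)^-1; have q0 : 0 < q by rewrite invr_gt0 expR_gt0.
have qm (x : V) : `|x| <= rho -> `|q *: x| <= m.
  move=> xr; rewrite normrZ gtr0_norm// mulrC /q ler_pdivrMr ?expR_gt0// eT.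
  rewrite (_ : m * _ = m + rho); first lra.
  by field; rewrite gt_eqF.
pose a x := x *m (q *: 'J g 0) + g 0.
exists (fun x => g (expR T *: g' (a x))).
  have ra := @reach_affine _ _ _ H_id H_comp vel_affine (q *: 'J g 0) (g 0).
  apply: (@reach_comp_cont _ _ _ H_comp a (fun y => g (expR T *: g' y))).
  - move=> x; apply: (@continuousD R V V (fun x => x *m (q *: 'J g 0)) (fun=> g 0));
      last exact: cst_continuous.
    by apply: (@cont_mulmx R V _ _ _ id (fun=> q *: 'J g 0)); [move=> y|exact: cst_continuous].
  - apply: (@cont_comp _ _ _ (fun y => expR T *: g' y) g); last exact: cg.
    by apply: contZ; [exact: cst_continuous|exact: cg'].
  - by apply: ra; rewrite detZ mulr_gt0// exprn_gt0.
  by move=> r; exact: reach_conj_dilation.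
move=> x xr.
have qx := qm x xr.
have agq : `|a x - g (q *: x)| <= e1 * (q * (rho + 1)).
  have := hg 0 (q *: x); rewrite normr0 lexx => /(_ isT (le_trans qx mdl)).
  rewrite add0r -normrN; move=> h.
  rewrite (_ : a x - g (q *: x) = - (g (q *: x) - g 0 - (q *: x) *m 'J g 0)); last first.
    by rewrite /a -scalemxAl -scalemxAr; apply/rowP => i; rewrite !mxE; ring.
  apply: le_trans h _; rewrite ler_pM2l// normrZ gtr0_norm// ler_pM2l//; lra.
have a0 : `|a x| <= `|g 0| + 1.
  rewrite /a addrC (le_trans (ler_normD _ _))// lerD2l -scalemxAr scalemxAl.
  rewrite (le_trans (norm_mulmx _ _))//.
  apply: (@le_trans _ _ (m * (`|'J g 0| * d%:R + 1))); last first.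
    by rewrite -ler_pdivlMr// mul1r.
  rewrite (_ : _ * _ * _ = `|q *: x| * (`|'J g 0| * d%:R)); last by ring.
  apply: ler_pM => //; rewrite ?mulr_ge0//.
  by rewrite lerDl.
have gq0 : `|g (q *: x)| <= `|g 0| + 1.
  rewrite -[g (q *: x)](subrK (g 0)) (le_trans (ler_normD _ _))// addrC lerD2l.
  rewrite -normrN opprB; apply: hc; first by rewrite normr0.
  by rewrite sub0r normrN (le_trans qx).
have zx : `|expR T *: g' (a x) - x| <= L2 * (e1 * (rho + 1)).
  have -> : expR T *: g' (a x) - x = expR T *: (g' (a x) - g' (g (q *: x))).
    by rewrite gK scalerBr scalerA /q divff ?scale1r// gt_eqF// expR_gt0.
  rewrite normrZ gtr0_norm ?expR_gt0//.
  have h := le_trans (gL2 _ _ a0 gq0) (ler_wpM2l (ltW L20) agq).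
  apply: (@le_trans _ _ (expR T * (L2 * (e1 * (q * (rho + 1)))))).
    by rewrite ler_pM2l ?expR_gt0.
  rewrite /q (_ : expR T * _ = L2 * (e1 * (rho + 1))) //.
  by field; rewrite gt_eqF// expR_gt0.
have c0 : 0 <= L2 * (e1 * (rho + 1)) by do 2?[apply: mulr_ge0]; rewrite ?addr_ge0// ltW.
have small : L2 * (e1 * (rho + 1)) <= 1 /\ L1 * (L2 * (e1 * (rho + 1))) <= eps.
  have h1 : L2 * (e1 * (rho + 1)) <= Num.min 1 eps.
    by rewrite -e1E ler_peMl//; lra.
  have h2 : L1 * (L2 * (e1 * (rho + 1))) <= Num.min 1 eps.
    by rewrite -e1E ler_wpM2r//; lra.
  by move: h1 h2; rewrite !le_min => /andP[? _] /andP[_ ?].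
have [s1 s2] := small.
apply: le_trans s2.
apply: le_trans (gL1 _ _ _ _) _; last by rewrite ler_pM2l.
  rewrite -[expR T *: _](subrK x) (le_trans (ler_normD _ _))//; lra.
lra.
Qed.

End diffeomorphisms.

(** * The vector space of reversible velocities *)

Section fields.
Context {R : realType} {d : nat}.
Local Notation V := 'rV[R]_d.
Variable H : set (V -> option V).
Hypothesis H_id : H Some.
Hypothesis H_comp : forall h k, H h -> H k -> H (pcomp k h).
Hypothesis vel_affine : forall (A : 'M[R]_d) (b : V) rho,
  vel H (fun x => x *m A + b) rho.

(** Asking for both signs makes these velocities a vector space, and makes the
    inverses of the maps that they generate reachable too. *)
Definition field (v : V -> V) := continuous v /\
  forall rho, vel H v rho /\ vel H (fun x => - v x) rho.

(** The approximating fields are velocities on one cube only: some fields below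
    have poles outside of it. *)
Lemma field_closed_local (v : V -> V) : continuous v ->
  (forall rho eps, 0 < eps -> exists w, [/\ vel H w rho,
    vel H (fun x => - w x) rho & forall x, `|x| <= rho -> `|w x - v x| <= eps]) ->
  field v.
Proof.
move=> cv hv; split=> // rho; split; apply: vel_closed => eps e0;
  have [w [vw vNw wv]] := hv rho _ e0; first by exists w.
exists (fun x => - w x) => // x /wv.
by rewrite -[X in X <= _ -> _]normrN opprD.
Qed.

Lemma field_closed (v : V -> V) : continuous v ->
  (forall rho eps, 0 < eps -> exists2 w, field w &
    forall x, `|x| <= rho -> `|w x - v x| <= eps) -> field v.
Proof.
move=> cv hv; apply: field_closed_local => // rho eps e0.
by have [w [_ /(_ rho)[fw fNw]] wv] := hv rho _ e0; exists w.
Qed.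

Lemma fieldN v : field v -> field (fun x => - v x).
Proof.
move=> [cv fv]; split => [|rho]; first exact: contN.
have [v1 v2] := fv rho; split => //.
by rewrite (_ : (fun x => _) = v)//; apply/funext => x; rewrite opprK.
Qed.

Lemma fieldD v w : field v -> field w -> field (fun x => v x + w x).
Proof.
move=> [cv fv] [cw fw]; split => [|rho]; first exact: contD.
have rr : rho < rho + 1 by rewrite ltrDl.
have [v1 v2] := fv rho; have [w1 w2] := fw (rho + 1); split.
  by apply: (vel_add H_comp rr) => //; exact: ball_bound.
rewrite (_ : (fun x => _) = (fun x => - v x + - w x)); last first.
  by apply/funext => x; rewrite opprD.
apply: (vel_add H_comp rr) => //; last exact: contN.
exact: ball_bound (contN cv) rho.
Qed.

Lemma fieldB v w : field v -> field w -> field (fun x => v x - w x).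
Proof. by move=> fv fw; apply: fieldD => //; exact: fieldN. Qed.

Lemma field_affine A b : field (fun x => x *m A + b).
Proof.
split=> [|rho].
  apply: (@contD _ _ _ (fun x : V => x *m A) (fun=> b)); last exact: cst_continuous.
  by apply: (@cont_mulmx R V _ _ _ id (fun=> A)); [move=> x|exact: cst_continuous].
split; first exact: vel_affine.
rewrite (_ : (fun x => _) = (fun x => x *m (- A) + (- b))); first exact: vel_affine.
by apply/funext => x; rewrite opprD mulmxN.
Qed.

Lemma field0 : field (fun=> 0).
Proof.
have := field_affine 0 0; rewrite (_ : (fun x => _) = (fun=> 0))//.
by apply/funext => x; rewrite mulmx0 addr0.
Qed.

Lemma fieldZ c v : field v -> field (fun x => c *: v x).
Proof.
have pos a (w : V -> V) : 0 < a -> field w -> field (fun x => a *: w x).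
  move=> a0 [cw fw]; split => [|rho].
    by apply: contZ => //; exact: cst_continuous.
  have [w1 w2] := fw rho; split; first exact: vel_scale.
  rewrite (_ : (fun x => _) = (fun x => a *: - w x)); first exact: vel_scale.
  by apply/funext => x; rewrite scalerN.
move=> fv; have [c0|c0|->] := ltgtP c 0.
- rewrite (_ : (fun x => _) = (fun x => (- c) *: - v x)).
    by apply: pos; [rewrite oppr_gt0|exact: fieldN].
  by apply/funext => x; rewrite scalerN scaleNr opprK.
- exact: pos.
rewrite (_ : (fun x => _) = (fun=> 0)); first exact: field0.
by apply/funext => x; rewrite scale0r.
Qed.

Lemma field_sum (I : Type) (r : seq I) (P : pred I) (v : I -> V -> V) :
  (forall i, P i -> field (v i)) -> field (fun x => \sum_(i <- r | P i) v i x).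
Proof.
move=> fv; elim: r => [|i r IH].
  rewrite (_ : (fun x => _) = (fun=> 0)); first exact: field0.
  by apply/funext => x; rewrite big_nil.
rewrite (_ : (fun x => _) = (fun x => (if P i then v i x else 0) +
    \sum_(i <- r | P i) v i x)); last first.
  by apply/funext => x; rewrite big_cons; case: ifP => //; rewrite add0r.
apply: fieldD => //; have := fv i; case: (P i) => [/(_ isT)//|_]; exact: field0.
Qed.

(** The affine map and its inverse are reachable, hence so is the step along [v]
    seen in the new coordinates. *)
Lemma field_conj_affine (P Q : 'M[R]_d) (b : V) v : P *m Q = 1%:M -> 0 < \det P ->
  field v -> field (fun x => v (x *m P + b) *m Q).
Proof.
move=> PQ detP [cv fv].
have QP : Q *m P = 1%:M by exact: mulmx1C.
have detQ : 0 < \det Q.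
  have := congr1 determinant PQ; rewrite det_mulmx det1 => e.
  by rewrite -(pmulr_rgt0 _ detP) e ltr01.
have cphi : continuous (fun x : V => x *m P + b) by have [] := field_affine P b.
have key (w : V -> V) : continuous w -> (forall rho, vel H w rho) -> forall rho,
    vel H (fun x => w (x *m P + b) *m Q) rho.
  move=> cw vw rho; have [M M0 hM] := ball_bound cphi rho.
  apply: (@vel_conj _ _ _ H_comp (fun x => x *m P + b) (fun y => y *m Q + (- (b *m Q)))
    w _ rho (M + 1) 1 (d%:R * `|Q|)) => //.
  - by move=> x xr; rewrite lerD2r; exact: hM.
  - move=> y z _ _; rewrite opprD addrACA subrr addr0 -mulmxBl.
    by rewrite (le_trans (norm_mulmx _ _))// mulrAC.
  - move=> eps e0; exists 1 => // t /andP[t0 _] x _.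
    rewrite (_ : _ - _ = 0); first by rewrite normr0 mulr_ge0// ltW.
    rewrite !mulmxDl -mulmxA PQ mulmx1 -scalemxAl.
    by move: (_ *m Q) => z; apply/rowP => i; rewrite !mxE; ring.
  - exact: reach_affine.
  - exact: reach_affine.
split=> [|rho].
  apply: (@cont_mulmx R V _ _ _ (fun x => v (x *m P + b)) (fun=> Q)).
    by apply: (@cont_comp _ _ _ (fun x : V => x *m P + b) v).
  exact: cst_continuous.
split; first by apply: key => // r; have [] := fv r.
rewrite (_ : (fun x => _) = (fun x => (- v (x *m P + b)) *m Q)); last first.
  by apply/funext => x; rewrite mulNmx.
apply: (key (fun x => - v x)); first exact: contN.
by move=> r; have [] := fv r.
Qed.

Lemma field_dilate (s : R) (b : V) v : 0 < s -> field v ->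
  field (fun x => v (s *: x + b)).
Proof.
move=> s0 fv.
have PQ : s%:M *m s^-1%:M = 1%:M :> 'M[R]_d.
  by rewrite -scalar_mxM divff// gt_eqF.
have detP : 0 < \det (s%:M : 'M[R]_d) by rewrite det_scalar exprn_gt0.
have := fieldZ s (field_conj_affine b PQ detP fv).
rewrite (_ : (fun x => _) = (fun x => v (s *: x + b)))//.
by apply/funext => x; rewrite !mul_mx_scalar scalerA divff ?scale1r// gt_eqF.
Qed.

Lemma field_conj_unip (N : 'M[R]_d) v : N *m N = 0 -> field v ->
  field (fun x => v (x *m (1%:M + N)) *m (1%:M - N)).
Proof.
move=> N0 fv; have := @field_conj_affine (1%:M + N) (1%:M - N) 0 v.
rewrite (_ : (fun x => _) = (fun x => v (x *m (1%:M + N)) *m (1%:M - N))); last first.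
  by apply/funext => x; rewrite addr0.
apply=> //; last exact: det_unip.
by rewrite mulmxDl mul1mx mulmxBr mulmx1 N0 subr0 subrK.
Qed.

Lemma coord_delta (i j : 'I_d) : (delta_mx 0 i : V) 0 j = (i == j)%:R.
Proof. by rewrite mxE eqxx /= eq_sym. Qed.

Lemma norm_delta (i : 'I_d) : `|delta_mx 0 i : V| <= 1.
Proof.
apply: norm_le_coord => // k j; rewrite ord1 coord_delta.
by case: (i == j); rewrite ?normr1 ?normr0.
Qed.

Lemma real_bound (f : R -> R) : continuous f -> forall rho, exists2 M, 0 < M &
  forall x, `|x| <= rho -> `|f x| <= M.
Proof.
move=> cf rho.
have [M M0 h] := compact_bound (@seg_compact R rho) (fun x _ => cf x).
by exists M.
Qed.

Lemma real_unif_cont (f : R -> R) : continuous f -> forall rho eps, 0 < eps ->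
  exists2 dlt, 0 < dlt &
  forall x y, `|x| <= rho -> `|x - y| <= dlt -> `|f x - f y| <= eps.
Proof.
move=> cf rho eps /(compact_unif_cont (@seg_compact R rho) (fun x _ => cf x)).
by case=> dl d0 h; exists dl => // x y; exact: h.
Qed.

Lemma MVT_unordered (f df : R -> R) (a b : R) : (forall t : R, is_derive t 1 f (df t)) ->
  exists2 c, `|c - a| <= `|b - a| & f b - f a = df c * (b - a).
Proof.
move=> fd; have [ab|/ltW ba] := leP a b.
  have [c /andP[ac cb] e] := @MVT_real R f df a b ab (fun t _ => fd t).
  by exists c; rewrite // !ger0_norm ?subr_ge0// lerD2r.
have [c /andP[ac cb] e] := @MVT_real R f df b a ba (fun t _ => fd t).
exists c; last by rewrite -opprB e -mulrN opprB.
by rewrite !ler0_norm ?subr_le0// lerN2 lerD2r.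
Qed.

(** The shears [shear t] are the flow of the field [th (x_j) e_i]; if this field is
    available in both directions, then other fields can be conjugated by
    [shear 1]. *)
Section shear.
Variables (i j : 'I_d) (th dth : R -> R).
Hypothesis ij : i != j.
Hypothesis dthP : forall t : R, is_derive t 1 th (dth t).
Hypothesis cdth : continuous dth.

Definition shear (t : R) (x : V) : V := x + (t * th (x 0 j)) *: delta_mx 0 i.

Let cth : continuous th.
Proof. by move=> t; exact: is_derive_cont (dthP t). Qed.

Lemma shear_coord t x : shear t x 0 j = x 0 j.
Proof. by rewrite !mxE eqxx /= eq_sym (negPf ij) mulr0 addr0. Qed.

Lemma shearD s t x : shear t (shear s x) = shear (s + t) x.
Proof. by rewrite {1}/shear shear_coord /shear -addrA -scalerDl -mulrDl. Qed.

Lemma shear0 x : shear 0 x = x.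
Proof. by rewrite /shear mul0r scale0r addr0. Qed.

Lemma shear_lip rho : exists2 L, 1 <= L & forall t x y, `|t| <= 1 ->
  `|x| <= rho -> `|y| <= rho -> `|shear t x - shear t y| <= L * `|x - y|.
Proof.
have [M M0 hM] := real_bound cdth (3 * `|rho|).
exists (1 + M); first by lra.
move=> t x y t1 xr yr; rewrite /shear.
rewrite (_ : _ - _ = (x - y) + (t * (th (x 0 j) - th (y 0 j))) *: delta_mx 0 i); last first.
  by apply/rowP => k; rewrite !mxE; ring.
rewrite (le_trans (ler_normD _ _))// mulrDl mul1r lerD2l normrZ.
have xy : `|x 0 j - y 0 j| <= `|x - y|.
  by have := coord_le_norm (x - y) 0 j; rewrite !mxE.
have [c cy ->] := MVT_unordered (y 0 j) (x 0 j) dthP.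
have cM : `|dth c| <= M.
  apply: hM; rewrite -[c](subrK (y 0 j)) (le_trans (ler_normD _ _))//.
  have := ler_normB (x 0 j) (y 0 j); have := coord_le_norm x 0 j.
  have := coord_le_norm y 0 j; have := ler_norm rho; lra.
rewrite -[leRHS]mulr1 ler_pM//; last exact: norm_delta.
rewrite !normrM -[leRHS]mul1r ler_pM// ?mulr_ge0//.
by rewrite ler_pM.
Qed.

Lemma th_expand rho eps : 0 < eps -> exists2 dlt, 0 < dlt &
  forall y h, `|y| <= rho -> `|h| <= dlt ->
  `|th (y + h) - th y - h * dth y| <= eps * `|h|.
Proof.
move=> e0; have [dl dl0 hd] := real_unif_cont cdth rho e0.
exists dl => // y h yr hdl.
have [c] := MVT_unordered y (y + h) dthP.
rewrite [y + h]addrC addrK => cy ->.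
rewrite (_ : _ - _ = (dth c - dth y) * h); last by ring.
rewrite normrM ler_wpM2r// -normrN opprB; apply: hd => //.
by rewrite -normrN opprB (le_trans cy).
Qed.

Lemma cont_shear t : continuous (shear t).
Proof.
apply: (@contD R V V id (fun x => (t * th (x 0 j)) *: delta_mx 0 i)); first by move=> x.
apply: contZ; last exact: cst_continuous.
apply: contM; first exact: cst_continuous.
apply: (@cont_comp _ _ _ (fun x : V => x 0 j) th) => //.
exact: coord_continuous.
Qed.

Hypothesis fth : field (fun x => th (x 0 j) *: delta_mx 0 i).

Lemma reach_shear c rho : `|c| <= 1 -> reach H (shear c) rho.
Proof.
move=> c1; rewrite -[c]mul1r.
pose th' (x : V) : V := th (x 0 j) *: delta_mx 0 i.
have [_ vth] := fieldZ c fth.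
have [M M0 hM] := real_bound cth rho.
pose K := `|rho| + M.
have [L L1 hL] := shear_lip (K + 1).
have tc t : 0 <= t <= 1 -> `|t * c| <= 1.
  move=> /andP[t0 t1]; rewrite normrM (ger0_norm t0) -[leRHS]mul1r.
  by apply: ler_pM.
apply: (@vel_reach _ _ _ H_id H_comp (fun t => shear (t * c)) (fun x => c *: th' x)
  rho K 1 L) => //.
- by rewrite /K; have := ler_norm rho; lra.
- by move=> x _; rewrite mul0r; exact: shear0.
- by move=> s t x *; rewrite mulrDl; exact: shearD.
- move=> t x t1 xr; rewrite (le_trans (ler_normD _ _))// lerD//.
    by rewrite (le_trans xr)// ler_norm.
  rewrite normrZ -[leRHS]mulr1 ler_pM//; last exact: norm_delta.
  rewrite normrM -[leRHS]mul1r ler_pM//; first exact: tc.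
  by apply: hM; rewrite (le_trans (coord_le_norm _ _ _)).
- by move=> t x y t1 *; apply: hL => //; exact: tc.
- move=> eps e0; exists 1 => // t /andP[t0 _] x _.
  rewrite /shear /th' !scalerA !mulrA subrr normr0 mulr_ge0//; exact: ltW.
by have [] := vth (K + 1).
Qed.

(** The differential of [shear (- 1)] subtracts [dth (x_j)] times the [j]-th
    component along [e_i]. *)
Lemma field_conj_shear w : field w -> field (fun x =>
  w (shear 1 x) - (dth (x 0 j) * w (shear 1 x) 0 j) *: delta_mx 0 i).
Proof.
move=> [cw fw].
have cconj (u : V -> V) : continuous u -> continuous (fun x =>
    u (shear 1 x) - (dth (x 0 j) * u (shear 1 x) 0 j) *: (delta_mx 0 i : V)).
  move=> cu; have cus : continuous (fun x => u (shear 1 x)).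
    by apply: (@cont_comp _ _ _ (shear 1) u) => //; exact: cont_shear.
  apply: contB => //; apply: contZ; last exact: cst_continuous.
  apply: contM; last exact: cont_coord.
  apply: (@cont_comp _ _ _ (fun x : V => x 0 j) dth) => //.
  exact: coord_continuous.
have key (u : V -> V) : continuous u -> (forall rho, vel H u rho) -> forall rho,
    vel H (fun x => u (shear 1 x) - (dth (x 0 j) * u (shear 1 x) 0 j) *: delta_mx 0 i) rho.
  move=> cu vu rho; have [M M0 hM] := ball_bound (@cont_shear 1) rho.
  have [L L1 hL] := shear_lip (M + 1).
  apply: (@vel_conj _ _ _ H_comp (shear 1) (shear (-1)) u _ rho (M + 1) 1 L) => //.
  - by lra.
  - by move=> x xr; rewrite lerD2r; exact: hM.
  - by move=> y z yM zM; apply: hL; rewrite // normrN1.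
  - move=> eps e0.
    have [B B0 hB] := ball_bound cu M.
    have [|dl dl0 hd] := @th_expand rho (eps / B); first exact: divr_gt0.
    exists (dl / B); first exact: divr_gt0.
    move=> t /andP[t0]; rewrite ler_pdivlMr// => tdl x xr.
    set y := shear 1 x; have yM : `|y| <= M by exact: hM.
    have uj : `|u y 0 j| <= B by rewrite (le_trans (coord_le_norm _ _ _))// hB.
    have hj : `|t * u y 0 j| <= t * B by rewrite normrM gtr0_norm// ler_pM2l.
    have := hd (x 0 j) (t * u y 0 j).
    move=> /(_ (le_trans (coord_le_norm _ _ _) xr) (le_trans hj tdl)) h.
    rewrite (_ : _ - _ = (- (th (x 0 j + t * u y 0 j) - th (x 0 j)
        - t * u y 0 j * dth (x 0 j))) *: (delta_mx 0 i : V)); last first.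
      have yj : y 0 j = x 0 j by exact: shear_coord.
      rewrite {1}/shear (_ : (y + t *: u y) 0 j = x 0 j + t * u y 0 j); last first.
        by rewrite -yj !mxE.
      move: (u y) => uy; rewrite /y /shear.
      by apply/rowP => k; rewrite !mxE; ring.
    rewrite normrZ normrN -[leRHS]mulr1 ler_pM//; last exact: norm_delta.
    apply: le_trans h _; rewrite (_ : eps * t = eps / B * (t * B)).
      by rewrite ler_wpM2l// divr_ge0// ltW.
    by field; rewrite gt_eqF.
  - by apply: reach_shear; rewrite normr1.
  - by apply: reach_shear; rewrite normrN1.
split; first exact: cconj.
move=> rho; split; first by apply: key => // r; have [] := fw r.
have h : forall r, vel H (fun x => - w x) r by move=> r; have [] := fw r.
have := key (fun x => - w x) (contN cw) h rho.
rewrite (_ : (fun x => _) = (fun x => - (w (shear 1 x) -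
  (dth (x 0 j) * w (shear 1 x) 0 j) *: delta_mx 0 i)))//.
by apply/funext => x; apply/rowP => k; rewrite !mxE; ring.
Qed.

End shear.

End fields.

(** * Density of polynomials *)

Section density.
Context {R : realType} {d : nat}.
Local Notation V := 'rV[R]_d.
Implicit Types (f g p : V -> R) (rho : R).

Inductive polyfun : (V -> R) -> Prop :=
| polyfun_cst c : polyfun (fun=> c)
| polyfun_coord i : polyfun (fun x => x 0 i)
| polyfunD p q : polyfun p -> polyfun q -> polyfun (fun x => p x + q x)
| polyfunM p q : polyfun p -> polyfun q -> polyfun (fun x => p x * q x).

Lemma polyfun_cont p : polyfun p -> continuous p.
Proof.
elim=> [c|i|p1 p2 _ c1 _ c2|p1 p2 _ c1 _ c2].
- exact: cst_continuous.
- exact: coord_continuous.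
- exact: contD.
- exact: contM.
Qed.

Definition poly_approx rho f := forall eps, 0 < eps ->
  exists2 p, polyfun p & forall x, `|x| <= rho -> `|p x - f x| <= eps.

Lemma poly_approx_poly rho p : polyfun p -> poly_approx rho p.
Proof. by move=> pp eps e0; exists p => // x _; rewrite subrr normr0 ltW. Qed.

Lemma poly_approx_closed rho f :
  (forall eps, 0 < eps -> exists2 g, poly_approx rho g &
     forall x, `|x| <= rho -> `|g x - f x| <= eps) -> poly_approx rho f.
Proof.
move=> hf eps e0; have e20 : 0 < eps / 2 by lra.
have [g ag gf] := hf _ e20; have [p pp pg] := ag _ e20.
exists p => // x xr; have := pg x xr; have := gf x xr.
have := ler_normD (p x - g x) (g x - f x); rewrite subrKA; lra.
Qed.

Lemma poly_approx_ext rho f g : (forall x, `|x| <= rho -> f x = g x) ->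
  poly_approx rho f -> poly_approx rho g.
Proof.
move=> fg hf; apply: poly_approx_closed => eps e0; exists f => // x /fg ->.
by rewrite subrr normr0 ltW.
Qed.

Lemma poly_approx_bound rho f : poly_approx rho f ->
  exists2 M, 0 < M & forall x, `|x| <= rho -> `|f x| <= M.
Proof.
move=> /(_ 1 ltr01)[p pp pf].
have [M M0 hM] := ball_bound (polyfun_cont pp) rho.
exists (M + 1); first lra.
move=> x xr; have := hM x xr; have := pf x xr.
have := ler_normB (p x) (p x - f x); rewrite opprB addrC subrK; lra.
Qed.

Lemma poly_approxD rho f g : poly_approx rho f -> poly_approx rho g ->
  poly_approx rho (fun x => f x + g x).
Proof.
move=> hf hg eps e0; have e20 : 0 < eps / 2 by lra.
have [p pp pf] := hf _ e20; have [q pq qg] := hg _ e20.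
exists (fun x => p x + q x); first exact: polyfunD.
move=> x xr; have := pf x xr; have := qg x xr.
have := ler_normD (p x - f x) (q x - g x); rewrite opprD addrACA; lra.
Qed.

Lemma poly_approxM rho f g : poly_approx rho f -> poly_approx rho g ->
  poly_approx rho (fun x => f x * g x).
Proof.
move=> hf hg.
have [M M0 fM] := poly_approx_bound hf; have [N N0 gN] := poly_approx_bound hg.
apply: poly_approx_closed => eps e0.
have [|p pp pf] := hf (Num.min 1 (eps / (2 * N))).
  by rewrite lt_min ltr01 divr_gt0// mulr_gt0.
have [|q pq qg] := hg (eps / (2 * (M + 1))); first by rewrite divr_gt0// mulr_gt0//; lra.
exists (fun x => p x * q x); first by apply: poly_approx_poly; exact: polyfunM.
move=> x xr.
have := pf x xr; rewrite le_min => /andP[p1 p2].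
have pM : `|p x| <= M + 1.
  by have := ler_normD (p x - f x) (f x); rewrite subrK; have := fM x xr; lra.
rewrite (_ : _ - _ = p x * (q x - g x) + g x * (p x - f x)); last by ring.
rewrite (le_trans (ler_normD _ _))// !normrM.
have h1 : `|p x| * `|q x - g x| <= (M + 1) * (eps / (2 * (M + 1))).
  by rewrite ler_pM// qg.
have h2 : `|g x| * `|p x - f x| <= N * (eps / (2 * N)) by rewrite ler_pM// gN.
apply: le_trans (lerD h1 h2) _.
rewrite [leLHS](_ : _ = eps)//.
by field; rewrite !gt_eqF//; lra.
Qed.

Lemma poly_approx_cst rho c : poly_approx rho (fun=> c).
Proof. by apply: poly_approx_poly; exact: polyfun_cst. Qed.

Lemma poly_approx_sum rho (I : Type) (r : seq I) (F : I -> V -> R) :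
  (forall i, poly_approx rho (F i)) -> poly_approx rho (fun x => \sum_(i <- r) F i x).
Proof.
move=> hF; elim: r => [|i r IH].
  by apply: poly_approx_ext (poly_approx_cst rho 0) => x _; rewrite big_nil.
by apply: poly_approx_ext (poly_approxD (hF i) IH) => x _; rewrite big_cons.
Qed.

Lemma poly_approx_prod rho (I : Type) (r : seq I) (F : I -> V -> R) :
  (forall i, poly_approx rho (F i)) -> poly_approx rho (fun x => \prod_(i <- r) F i x).
Proof.
move=> hF; elim: r => [|i r IH].
  by apply: poly_approx_ext (poly_approx_cst rho 1) => x _; rewrite big_nil.
by apply: poly_approx_ext (poly_approxM (hF i) IH) => x _; rewrite big_cons.
Qed.

(** The Newton-type iteration for the positive root [`|t|] of [r ^+ 2 = t ^+ 2];
    its values are polynomials in [t] that increase to [`|t|] on [[-1, 1]]. *)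
Fixpoint abs_approx (n : nat) (t : R) : R :=
  if n is m.+1 then abs_approx m t + (t ^+ 2 - abs_approx m t ^+ 2) / 2 else 0.

(** The error is multiplied at each step by at most [1 - `|t| / 2], so it decays like
    [1 / (n * `|t|)] relative to [`|t|]; the resulting bound is uniform in [t]. *)
Lemma abs_approxP n t : `|t| <= 1 ->
  [/\ 0 <= abs_approx n t, abs_approx n t <= `|t| &
    (`|t| - abs_approx n t) * (1 + n%:R * (`|t| / 2)) <= `|t|].
Proof.
move=> t1; have t0 := normr_ge0 t.
have tt : t ^+ 2 = `|t| ^+ 2 by rewrite real_normK// num_real.
elim: n => [|n [r0 rt h]] /=; first by split => //; rewrite mul0r subr0 addr0 mulr1.
set r := abs_approx n t in r0 rt h *; rewrite tt; set s := `|t| in t0 t1 rt h *.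
have hr : r + (s ^+ 2 - r ^+ 2) / 2 = s - (s - r) * (1 - (s + r) / 2) by field.
rewrite hr; have e0 : 0 <= s - r by lra.
split.
- rewrite -hr; have : 0 <= (s - r) * (s + r) by apply: mulr_ge0; lra.
  by rewrite -subr_sqr; lra.
- have : 0 <= (s - r) * (1 - (s + r) / 2) by apply: mulr_ge0; lra.
  lra.
rewrite opprB addrC subrK.
have n0 : 0 <= n%:R :> R by [].
have ns : 0 <= n%:R * (s / 2) by apply: mulr_ge0 => //; lra.
apply: le_trans h; rewrite -mulrA; apply: ler_wpM2l => //.
apply: (@le_trans _ _ ((1 - s / 2) * (1 + n.+1%:R * (s / 2)))).
  apply: ler_wpM2r; first by rewrite addr_ge0// mulr_ge0//; lra.
  lra.
rewrite -natr1.
have : 0 <= s / 2 * (n%:R * (s / 2)) by apply: mulr_ge0 => //; lra.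
have : 0 <= s / 2 * (s / 2) by apply: mulr_ge0 => //; lra.
set a := s / 2; lra.
Qed.

Lemma poly_approx_abs rho f : poly_approx rho f -> poly_approx rho (fun x => `|f x|).
Proof.
move=> hf; have [M M0 fM] := poly_approx_bound hf.
have hfM : poly_approx rho (fun x => M^-1 * f x).
  by apply: poly_approxM => //; exact: poly_approx_cst.
have habs n : poly_approx rho (fun x => abs_approx n (M^-1 * f x)).
  elim: n => [|n IH] /=; first exact: poly_approx_cst.
  apply: poly_approxD => //.
  apply: poly_approx_ext (poly_approxM (poly_approx_cst rho 2^-1)
    (poly_approxD (poly_approxM hfM hfM)
     (poly_approxM (poly_approx_cst rho (-1)) (poly_approxM IH IH)))) => x _.
  by rewrite !expr2 mulrC mulN1r.
apply: poly_approx_closed => eps e0.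
pose n := (Num.truncn (2 * M / eps)).+1.
exists (fun x => M * abs_approx n (M^-1 * f x)).
  by apply: poly_approxM => //; exact: poly_approx_cst.
move=> x xr; set t := M^-1 * f x.
have ft : `|f x| = M * `|t|.
  by rewrite /t normrM gtr0_norm ?invr_gt0// mulrA divff ?mul1r// gt_eqF.
have t1 : `|t| <= 1 by rewrite -(ler_pM2l M0) -ft mulr1 fM.
have [r0 rt h] := abs_approxP n t1.
rewrite ft -mulrBr normrM gtr0_norm// -normrN opprB ger0_norm ?subr_ge0//.
have n2 : 2 * M / eps <= n%:R by apply: ltW; exact: truncnS_gt.
have n0 : 0 < n%:R :> R by rewrite ltr0n.
have en : 2 * M <= n%:R * eps by move: n2; rewrite ler_pdivrMr.
have [t0|t0] := eqVneq `|t| 0.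
  by move: r0 rt; rewrite t0 => r0 rt; rewrite (_ : abs_approx n t = 0) ?subr0 ?mulr0 1?ltW//; lra.
have tp : 0 < `|t| by rewrite lt_neqAle eq_sym t0/=.
have : (`|t| - abs_approx n t) * (n%:R * (`|t| / 2)) <= `|t|.
  by apply: le_trans h; rewrite ler_wpM2l ?subr_ge0// lerDr.
rewrite (_ : _ * _ = ((`|t| - abs_approx n t) * n%:R / 2) * `|t|); last by ring.
rewrite -[leRHS]mul1r ler_pM2r// ler_pdivrMr// mul1r => hh.
rewrite -(ler_pM2r n0); apply: (@le_trans _ _ (M * 2)).
  by rewrite -mulrA ler_pM2l.
by rewrite mulrC [eps * _]mulrC.
Qed.

Definition tent (u : R) : R := Num.max 0 (1 - `|u|).

Lemma tent_ge0 u : 0 <= tent u. Proof. by rewrite /tent le_max lexx. Qed.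

Lemma tent_neq0 u : tent u != 0 -> `|u| <= 1.
Proof.
apply: contraNle => u1; rewrite /tent max_l//; lra.
Qed.

(** The positive part of [u] is [(u + `|u|) / 2]. *)
Lemma poly_approx_tent rho f : poly_approx rho f -> poly_approx rho (fun x => tent (f x)).
Proof.
move=> hf.
have h1 : poly_approx rho (fun x => 1 + -1 * `|f x|).
  apply: poly_approxD; first exact: poly_approx_cst.
  by apply: poly_approxM; [exact: poly_approx_cst|exact: poly_approx_abs].
apply: poly_approx_ext (poly_approxM (poly_approx_cst rho 2^-1)
  (poly_approxD h1 (poly_approx_abs h1))) => x _.
rewrite mulN1r /tent; have [u0|u0] := leP 0 (1 - `|f x|).
  by rewrite (ger0_norm u0); field.
by rewrite (ltr0_norm u0) subrr mulr0.
Qed.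

Lemma sum_tent n (u : R) : 0 <= u ->
  \sum_(k < n.+1) tent (u - k%:R) = Num.min 1 (Num.max 0 (n%:R + 1 - u)).
Proof.
move=> u0; elim: n => [|n IH].
  rewrite big_ord_recl big_ord0 /= addr0 subr0 /tent add0r ger0_norm//.
  by rewrite min_r// ge_max ler01/=; lra.
rewrite big_ord_recr /= IH /tent -natr1.
have n0 : 0 <= n%:R :> R by [].
set m := n%:R in n0 *.
have [h1|h1] := leP u m.
  rewrite (_ : Num.max 0 (m + 1 - u) = m + 1 - u); last by rewrite max_r//; lra.
  rewrite (_ : Num.max 0 (m + 1 + 1 - u) = m + 1 + 1 - u); last by rewrite max_r//; lra.
  rewrite ler0_norm; last lra.
  rewrite max_l; last lra.
  by rewrite !min_l; lra.
have [h2|h2] := leP u (m + 1).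
  rewrite (_ : Num.max 0 (m + 1 - u) = m + 1 - u); last by rewrite max_r//; lra.
  rewrite (_ : Num.max 0 (m + 1 + 1 - u) = m + 1 + 1 - u); last by rewrite max_r//; lra.
  rewrite ler0_norm; last lra.
  rewrite max_r; last lra.
  by rewrite min_r ?min_l; lra.
rewrite (_ : Num.max 0 (m + 1 - u) = 0); last by rewrite max_l//; lra.
rewrite ger0_norm; last lra.
rewrite min_r// add0r (_ : 1 - _ = m + 1 + 1 - u); last by ring.
by rewrite min_r// ge_max ler01/=; lra.
Qed.

(** Interpolation of the values of [g] on a fine lattice by products of tents,
    which form a partition of unity. *)
Theorem poly_dense g rho : continuous g -> poly_approx rho g.
Proof.
move=> cg.
wlog r0 : rho / 0 < rho.
  move=> h eps e0; have [|p pp pg] := h (Num.max rho 1) _ eps e0.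
    by rewrite lt_max ltr01 orbT.
  by exists p => // x xr; apply: pg; rewrite le_max xr.
apply: poly_approx_closed => eps e0.
have [dl dl0 hd] := ball_unif_cont cg rho e0.
pose N : R := dl^-1; have N0 : 0 < N by rewrite invr_gt0.
pose n := (Num.truncn (N * (2 * rho))).+1.
have nN : N * (2 * rho) <= n%:R by apply: ltW; exact: truncnS_gt.
pose y (k : {ffun 'I_d -> 'I_n.+1}) : V := \row_i ((k i)%:R / N - rho).
pose w (k : {ffun 'I_d -> 'I_n.+1}) (x : V) :=
  \prod_(i < d) tent (N * (x 0 i + rho) - (k i)%:R).
exists (fun x => \sum_k g (y k) * w k x).
  apply: poly_approx_sum => k; apply: poly_approxM; first exact: poly_approx_cst.
  apply: poly_approx_prod => i; apply: poly_approx_tent.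
  apply: poly_approxD; last exact: poly_approx_cst.
  apply: poly_approxM; first exact: poly_approx_cst.
  apply: poly_approxD; last exact: poly_approx_cst.
  by apply: poly_approx_poly; exact: polyfun_coord.
move=> x xr.
have w0 k : 0 <= w k x by apply: prodr_ge0 => i _; exact: tent_ge0.
have w1 : \sum_k w k x = 1.
  rewrite /w -(bigA_distr_bigA (fun i (j : 'I_n.+1) => tent (N * (x 0 i + rho) - j%:R))).
  rewrite big1// => i _.
  have := le_trans (coord_le_norm x 0 i) xr; rewrite ler_norml => /andP[x1 x2].
  rewrite sum_tent; last by rewrite mulr_ge0//; lra.
  have : N * (x 0 i + rho) <= n%:R by apply: le_trans nN; rewrite ler_pM2l//; lra.
  by move=> h; rewrite min_l// le_max; apply/orP; right; lra.
rewrite -[g x]mulr1 -w1 mulr_sumr -sumrB.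
apply: (@le_trans _ _ (\sum_k eps * w k x)); last by rewrite -mulr_sumr w1 mulr1.
rewrite (le_trans (ler_norm_sum _ _ _))//; apply: ler_sum => k _.
rewrite -mulrBl normrM (ger0_norm (w0 k)).
have [->|wk] := eqVneq (w k x) 0; first by rewrite !mulr0.
rewrite ler_wpM2r// -normrN opprB; apply: hd => //.
apply: norm_le_coord => [|i j]; first exact: ltW.
rewrite ord1 !mxE.
have : tent (N * (x 0 j + rho) - (k j)%:R) != 0.
  by move: wk; rewrite /w (bigD1 j)//= mulf_eq0 negb_or => /andP[].
move=> /tent_neq0 h.
rewrite (_ : _ - _ = (N * (x 0 j + rho) - (k j)%:R) * dl).
  by rewrite normrM (gtr0_norm dl0) ler_piMl// ltW.
by rewrite /N; field; rewrite gt_eqF.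
Qed.

End density.

(** * From powers of the coordinates to all continuous fields *)

Section directions.
Context {R : realType} {d : nat}.
Local Notation V := 'rV[R]_d.
Variable H : set (V -> option V).
Hypothesis H_id : H Some.
Hypothesis H_comp : forall h k, H h -> H k -> H (pcomp k h).
Hypothesis vel_affine : forall (A : 'M[R]_d) (b : V) rho,
  vel H (fun x => x *m A + b) rho.
Implicit Types (q : V -> R) (k : 'I_d).

Definition field_along (k : 'I_d) (q : V -> R) :=
  field H (fun x => q x *: delta_mx 0 k).

Lemma field_along_ext k q q' : q =1 q' -> field_along k q -> field_along k q'.
Proof. by move=> /funext ->. Qed.

Lemma field_alongD k q q' : field_along k q -> field_along k q' ->
  field_along k (fun x => q x + q' x).
Proof.
move=> h h'; have := fieldD H_comp h h'.
by rewrite /field_along; under [X in field H X -> _]funext do rewrite -scalerDl.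
Qed.

Lemma field_alongZ k c q : field_along k q -> field_along k (fun x => c * q x).
Proof.
move=> h; have := fieldZ vel_affine c h.
by rewrite /field_along; under [X in field H X -> _]funext do rewrite scalerA.
Qed.

Lemma field_alongB k q q' : field_along k q -> field_along k q' ->
  field_along k (fun x => q x - q' x).
Proof.
move=> h h'; apply: (field_along_ext _ (field_alongD h (field_alongZ (-1) h'))).
by move=> x; rewrite mulN1r.
Qed.

Lemma field_along_closed k q : continuous q ->
  (forall rho eps, 0 < eps -> exists2 q', field_along k q' &
    forall x, `|x| <= rho -> `|q' x - q x| <= eps) -> field_along k q.
Proof.
move=> cq hq; apply: field_closed.
  by apply: contZ => //; exact: cst_continuous.
move=> rho eps e0; have [q' fq' qq'] := hq rho _ e0.
exists (fun x => q' x *: delta_mx 0 k) => // x xr.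
rewrite -scalerBl normrZ -[leRHS]mulr1 ler_pM//; last exact: norm_delta.
exact: qq'.
Qed.

Lemma field_along_cst k c : field_along k (fun=> c).
Proof.
have := field_affine vel_affine 0 (c *: delta_mx 0 k).
rewrite /field_along (_ : (fun x => _) = (fun=> c *: delta_mx 0 k))//.
by apply/funext => x; rewrite mulmx0 add0r.
Qed.

Lemma mul_rV_delta (x : V) (i j : 'I_d) :
  x *m delta_mx i j = x 0 i *: (delta_mx 0 j : V).
Proof.
apply/rowP => l; rewrite !mxE (bigD1 i)//= big1 => [|m mi].
  by rewrite addr0 !mxE eqxx.
by rewrite mxE (negPf mi) mulr0.
Qed.

Lemma field_along_coord k j : field_along k (fun x => x 0 j).
Proof.
have := field_affine vel_affine (delta_mx j k) 0.
rewrite /field_along (_ : (fun x => _) = (fun x : V => x 0 j *: delta_mx 0 k))//.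
by apply/funext => x; rewrite addr0 mul_rV_delta.
Qed.

(** The uniformity of [C] in [u] and [h] is what makes the difference
    quotients in [polarization] converge uniformly on cubes. *)
Lemma pow_expand (m : nat) (M : R) : 0 <= M -> exists2 C, 0 < C &
  forall u h, `|u| <= M -> `|h| <= 1 ->
    `|(u + h) ^+ m - u ^+ m - m%:R * h * u ^+ m.-1| <= C * `|h| ^+ 2.
Proof.
move=> M0; elim: m => [|m [C C0 IH]].
  by exists 1 => // u h _ _; rewrite !expr0 !mul0r subrr subr0 normr0 mul1r exprn_ge0.
exists ((M + 1) * C + m%:R * M ^+ m.-1).
  by rewrite ltr_wpDr ?mulr_ge0 ?exprn_ge0// mulr_gt0//; lra.
move=> u h uM h1; have := IH u h uM h1; set E := (_ - _ - _) => hE.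
rewrite [X in `|X|](_ : _ = (u + h) * E + m%:R * h ^+ 2 * u ^+ m.-1).
  rewrite (le_trans (ler_normD _ _))// [leRHS]mulrDl; apply: lerD.
    rewrite normrM -mulrA ler_pM//.
    by rewrite (le_trans (ler_normD _ _))// lerD.
  rewrite !normrM (ger0_norm (ler0n R m)) !normrX mulrAC ler_wpM2r ?exprn_ge0//.
  by rewrite ler_wpM2l// lerXn2r// nnegrE.
rewrite /E; case: (m) => [|n] /=; first by rewrite !expr0; ring.
by rewrite -!natr1 !exprS; ring.
Qed.

Definition dot (a x : V) : R := \sum_i a 0 i * x 0 i.

Lemma dotE a x : dot a x = (x *m a^T) 0 0.
Proof. by rewrite mxE; apply: eq_bigr => i _; rewrite mxE mulrC. Qed.

Lemma cont_dot a : continuous (dot a).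
Proof.
apply: cont_sum => i; apply: contM; [exact: cst_continuous|exact: coord_continuous].
Qed.

Lemma dotD a b x : dot (a + b) x = dot a x + dot b x.
Proof. by rewrite /dot -big_split; apply: eq_bigr => i _; rewrite mxE mulrDl. Qed.

Lemma dotZ c a x : dot (c *: a) x = c * dot a x.
Proof. by rewrite /dot mulr_sumr; apply: eq_bigr => i _; rewrite mxE mulrA. Qed.

Lemma dot_delta i x : dot (delta_mx 0 i) x = x 0 i.
Proof.
rewrite /dot (bigD1 i)//= big1 => [|j ji]; first by rewrite coord_delta eqxx mul1r addr0.
by rewrite coord_delta eq_sym (negPf ji) mul0r.
Qed.

Hypothesis powers : forall k n, field_along k (fun x => x 0 k ^+ n).

(** If [b 0 k != 0], write [b = b 0 k (e_k + c)] with [c . e_k = 0]; the unipotent map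
    [x + (c . x) e_k] fixes [e_k] and takes [x_k] to [(b . x) / b 0 k]. The other
    directions are limits of these. *)
Lemma ridge_power k n (a : V) : field_along k (fun x => dot a x ^+ n).
Proof.
have nz (b : V) : b 0 k != 0 -> field_along k (fun x => dot b x ^+ n).
  move=> bk; pose c := (b 0 k)^-1 *: b - delta_mx 0 k.
  have ck : dot c (delta_mx 0 k) = 0.
    rewrite /c dotD dotZ -scaleN1r dotZ dot_delta coord_delta eqxx.
    rewrite /dot (bigD1 k)//= big1 => [|j jk].
      by rewrite coord_delta eqxx mulr1 addr0 mulVf// mulr1 subrr.
    by rewrite coord_delta eq_sym (negPf jk) mulr0.
  pose N : 'M[R]_d := c^T *m delta_mx 0 k.
  have xN (x : V) : x *m N = dot c x *: delta_mx 0 k.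
    rewrite /N mulmxA (_ : x *m c^T = (dot c x)%:M) ?mul_scalar_mx//.
    by apply/matrixP => i j; rewrite !ord1 -dotE mxE eqxx.
  have N0 : N *m N = 0.
    by rewrite {1}/N -mulmxA xN ck scale0r mulmx0.
  have := field_conj_unip H_id H_comp vel_affine N0 (powers k n).
  rewrite (_ : (fun x => _) = (fun x => (b 0 k ^- n * dot b x ^+ n) *: delta_mx 0 k)).
    move=> /(@field_alongZ k (b 0 k ^+ n)) h; apply: field_along_ext h => x.
    by rewrite mulrA divff ?mul1r// expf_neq0.
  apply/funext => x; rewrite -scalemxAl mulmxBr mulmx1 xN ck scale0r subr0.
  rewrite mulmxDr mulmx1 xN !mxE !eqxx mulr1 /c dotD dotZ -scaleN1r dotZ dot_delta.
  by rewrite mulN1r addrC subrK exprMn exprVn.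
have [ak|/nz//] := eqVneq (a 0 k) 0.
apply: field_along_closed; first by apply: contX; exact: cont_dot.
move=> rho eps e0; have [M M0 hM] := ball_bound (@cont_dot a) rho.
have cX : continuous (fun u : R => u ^+ n) by apply: contX => x.
have [dl dl0 hd] := real_unif_cont cX M e0.
have r0 : 0 < `|rho| + 1 by rewrite ltr_wpDl.
pose t := dl / (`|rho| + 1); have t0 : 0 < t by rewrite divr_gt0.
exists (fun x => dot (a + t *: delta_mx 0 k) x ^+ n).
  by apply: nz; rewrite !mxE ak !eqxx mulr1 add0r gt_eqF.
move=> x xr; rewrite dotD dotZ dot_delta -normrN opprB; apply: hd; first exact: hM.
rewrite opprD addrA subrr sub0r normrN normrM gtr0_norm// mulrAC ler_pdivrMr//.
rewrite ler_pM2l// (le_trans (coord_le_norm _ _ _))// (le_trans xr)//.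
by have := ler_norm rho; lra.
Qed.

(** Differentiating [dot a x ^+ n.+1] in [a] along the [i]-th basis vector brings
    out a factor [x 0 i]; the difference quotients stay in the space of fields,
    which is closed. *)
Lemma polarization k q : continuous q ->
  (forall a n, field_along k (fun x => q x * dot a x ^+ n)) ->
  forall i a n, field_along k (fun x => (x 0 i * q x) * dot a x ^+ n).
Proof.
move=> cq hq i a n; apply: field_along_closed.
  apply: contM; last by apply: contX; exact: cont_dot.
  by apply: contM => //; exact: coord_continuous.
move=> rho eps e0.
have [B B0 qB] := ball_bound cq rho.
have [M M0 hM] := ball_bound (@cont_dot a) rho.
have [C C0 hC] := pow_expand n.+1 (ltW M0).
pose r := `|rho| + 1; have r0 : 0 < r by rewrite ltr_wpDl.
pose t := Num.min r^-1 (eps / (B * C * r ^+ 2)).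
have BC : 0 < B * C * r ^+ 2 by rewrite !mulr_gt0// exprn_gt0.
have t0 : 0 < t by rewrite lt_min invr_gt0 r0/= divr_gt0.
have [t1 t2] : t <= r^-1 /\ t <= eps / (B * C * r ^+ 2) by rewrite !ge_min !lexx orbT.
pose s := (n.+1%:R * t)^-1.
have n0 : 1 <= n.+1%:R :> R by rewrite ler1n.
exists (fun x => s * (q x * dot (a + t *: delta_mx 0 i) x ^+ n.+1 - q x * dot a x ^+ n.+1)).
  by apply: field_alongZ; apply: field_alongB; exact: hq.
move=> x xr; rewrite dotD dotZ dot_delta; set u := dot a x.
have xi : `|x 0 i| <= r.
  rewrite (le_trans (coord_le_norm _ _ _))// (le_trans xr)// /r.
  by have := ler_norm rho; lra.
have h1 : `|t * x 0 i| <= 1.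
  rewrite normrM gtr0_norm//.
  by have := ler_pM (ltW t0) (normr_ge0 _) t1 xi; rewrite mulVf// gt_eqF.
rewrite (_ : _ - _ = s * q x * ((u + t * x 0 i) ^+ n.+1 - u ^+ n.+1
    - n.+1%:R * (t * x 0 i) * u ^+ n.+1.-1)); last first.
  by rewrite /s /=; field; rewrite gt_eqF//= pnatr_eq0.
have := hC u (t * x 0 i) (hM x xr) h1; set E := (_ - _ - _) => hE.
have s0 : 0 < s by rewrite invr_gt0 mulr_gt0// (lt_le_trans _ n0).
rewrite !normrM (gtr0_norm s0) -mulrA.
have h2 : `|q x| * `|E| <= B * (C * (t * r) ^+ 2).
  have hx : `|t * x 0 i| <= t * r by rewrite normrM (gtr0_norm t0) ler_pM2l.
  rewrite ler_pM ?qB// (le_trans hE)// ler_pM2l//.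
  by apply: lerXn2r => //; rewrite ?nnegrE//; exact: le_trans hx.
apply: (@le_trans _ _ (t^-1 * (B * (C * (t * r) ^+ 2)))).
  apply: ler_pM; [exact: ltW|exact: mulr_ge0| |exact: h2].
  rewrite /s lef_pV2 ?posrE ?mulr_gt0 ?ltr0n//.
  by rewrite ler_peMl// ltW.
rewrite [leLHS](_ : _ = t * (B * C * r ^+ 2)); last by field; rewrite gt_eqF.
by rewrite -ler_pdivlMr.
Qed.

(** The induction on [p] multiplies by [p] a function [q] for which all the products
    with ridge powers are already available; this stronger property is the one
    preserved by [polarization], and at the end [q] and the ridge power are [1]. *)
Lemma field_along_poly k p : polyfun p -> field_along k p.
Proof.
suff h : polyfun p -> forall q, continuous q ->
    (forall a n, field_along k (fun x => q x * dot a x ^+ n)) ->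
    forall a n, field_along k (fun x => (p x * q x) * dot a x ^+ n).
  move=> pp; have := h pp (fun=> 1) (@cst_continuous _ _ _).
  have h1 a n : field_along k (fun x => 1 * dot a x ^+ n).
    by apply: field_along_ext (ridge_power k n a) => x; rewrite mul1r.
  move=> /(_ h1 0 0%N); apply: field_along_ext => x.
  by rewrite expr0 !mulr1.
elim=> {p} [c|i|p1 p2 _ IH1 _ IH2|p1 p2 pp1 IH1 pp2 IH2] q cq hq a n.
- by apply: field_along_ext (field_alongZ c (hq a n)) => x; rewrite mulrA.
- exact: polarization.
- apply: field_along_ext (field_alongD (IH1 q cq hq a n) (IH2 q cq hq a n)) => x.
  by rewrite -mulrDl -mulrDl.
apply: field_along_ext (IH1 (fun x => p2 x * q x) _ (IH2 q cq hq) a n) => [x|].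
  by rewrite mulrA.
by apply: contM => //; exact: polyfun_cont.
Qed.

Lemma field_along_continuous k q : continuous q -> field_along k q.
Proof.
move=> cq; apply: field_along_closed => // rho eps e0.
have [p pp pq] := poly_dense rho cq e0.
by exists p => //; exact: field_along_poly.
Qed.

End directions.

Lemma field_of_along {R : realType} {d : nat}
    (H : set ('rV[R]_d -> option 'rV[R]_d))
    (H_comp : forall h k, H h -> H k -> H (pcomp k h))
    (vel_affine : forall (A : 'M[R]_d) (b : 'rV[R]_d) rho,
       vel H (fun x => x *m A + b) rho) (v : 'rV[R]_d -> 'rV[R]_d) :
  (forall k, field_along H k (fun x => v x 0 k)) -> field H v.
Proof.
move=> hv; rewrite (_ : v = fun x => \sum_k v x 0 k *: delta_mx 0 k).
  by apply: (field_sum H_comp vel_affine) => k _; exact: hv.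
by apply/funext => x; exact: row_sum_delta.
Qed.

(** * All powers from one square in dimension at least two *)

Section quadratic_fields.
Context {R : realType} {d : nat}.
Local Notation V := 'rV[R]_d.
Variable H : set (V -> option V).
Hypothesis H_id : H Some.
Hypothesis H_comp : forall h k, H h -> H k -> H (pcomp k h).
Hypothesis vel_affine : forall (A : 'M[R]_d) (b : V) rho,
  vel H (fun x => x *m A + b) rho.
Local Notation field_along := (field_along H).

Let alongD := @field_alongD _ _ _ H_comp.
Let alongZ := @field_alongZ _ _ _ vel_affine.
Let alongB := @field_alongB _ _ _ H_comp vel_affine.

Lemma dotC (a x : V) : dot a x = dot x a.
Proof. by apply: eq_bigr => i _; rewrite mulrC. Qed.

(** Conjugation by the linear shear [1%:M + t *: delta_mx a b] acts on the covector
    [al] and on the vector [w] of a ridge field separately, and leaves the profile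
    [th] unchanged. *)
Lemma ridge_conj (th : R -> R) (al w : V) (a b : 'I_d) (t : R) : a != b ->
  field H (fun x => th (dot al x) *: w) ->
  field H (fun x => th (dot (al + (t * al 0 b) *: delta_mx 0 a) x) *:
    (w - (t * w 0 a) *: delta_mx 0 b)).
Proof.
move=> ab hf; pose N : 'M[R]_d := t *: delta_mx a b.
have N0 : N *m N = 0 by exact: mul_delta_mx_neq.
have xN (x : V) : x *m N = (t * x 0 a) *: delta_mx 0 b.
  by rewrite /N -scalemxAr mul_rV_delta scalerA.
have := field_conj_unip H_id H_comp vel_affine N0 hf.
rewrite (_ : (fun x => _) = (fun x => th (dot (al + (t * al 0 b) *: delta_mx 0 a) x) *:
    (w - (t * w 0 a) *: delta_mx 0 b)))//.
apply/funext => x; rewrite -scalemxAl mulmxBr mulmx1 xN; congr (th _ *: _).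
rewrite mulmxDr mulmx1 xN [dot al (_ + _)]dotC dotD dotZ dot_delta [dot x al]dotC.
rewrite dotD dotZ dot_delta.
by congr (_ + _); ring.
Qed.

(** The product of three linear shears is a quarter turn in the plane of the two
    coordinates, which takes [x_k ^ 2 e_k] to [x_l ^ 2 e_l]. *)
Lemma square_swap k l : k != l -> field_along k (fun x => x 0 k ^+ 2) ->
  field_along l (fun x => x 0 l ^+ 2).
Proof.
move=> kl hk; pose sq (u : R) := u ^+ 2.
have lk : l != k by rewrite eq_sym.
have h0 : field H (fun x => sq (dot (delta_mx 0 k) x) *: (delta_mx 0 k : V)).
  move: hk; rewrite /field_along (_ : (fun x : V => _) = (fun x => sq (dot (delta_mx 0 k) x) *: (delta_mx 0 k : V)))//.
  by apply/funext => x; rewrite dot_delta.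
(* The covector and the vector of the ridge field are followed through the shears
   [1], [- 1], [1]: both become the [l]-th basis vector. *)
have := ridge_conj 1 lk h0; rewrite !coord_delta (negPf kl) eqxx mulr1 mulr0 scale1r scale0r subr0.
move=> /(ridge_conj (-1) kl); rewrite !mxE !eqxx /= [l == k]eq_sym (negPf kl).
rewrite add0r !mulr1 !scaleN1r opprK [delta_mx 0 k + _ - _]addrAC subrr add0r.
move=> /(ridge_conj 1 lk); rewrite !mxE !eqxx /= (negPf kl) [l == k]eq_sym (negPf kl).
rewrite add0r mulr0 scale0r addr0 mulr1 scale1r addrAC subrr add0r.
rewrite (_ : (fun x => _) = (fun x : V => x 0 l ^+ 2 *: delta_mx 0 l))//.
by apply/funext => x; rewrite dot_delta.
Qed.

Section one_direction.
Variables (i j : 'I_d).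
Hypothesis ij : i != j.
Hypothesis sq : field_along i (fun x => x 0 i ^+ 2).

Section profile.
Variables (th dth : R -> R).
Hypothesis dthP : forall t : R, is_derive t 1 th (dth t).
Hypothesis cdth : continuous dth.

Lemma square_shear : field_along i (fun x => th (x 0 j)) ->
  field_along i (fun x => (x 0 i + th (x 0 j)) ^+ 2).
Proof.
move=> hth; have := field_conj_shear H_id H_comp vel_affine ij dthP cdth hth sq.
rewrite /field_along (_ : (fun x => _) =
  (fun x : V => (x 0 i + th (x 0 j)) ^+ 2 *: delta_mx 0 i))//.
apply/funext => x /=; rewrite [X in dth _ * X]mxE coord_delta (negPf ij) !mulr0 scale0r subr0.
by rewrite /shear !mxE !eqxx /= mul1r mulr1.
Qed.

End profile.

(** The shears with profiles [th] and [- th] take [x_i ^ 2] to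
    [(x_i + th (x_j)) ^ 2] and [(x_i - th (x_j)) ^ 2]; half the sum and half the
    difference isolate the square and the product. *)
Lemma shear_profileM (th dth : R -> R) :
  (forall t : R, is_derive t 1 th (dth t)) -> continuous dth ->
  field_along i (fun x => th (x 0 j)) ->
  field_along i (fun x => th (x 0 j) ^+ 2) /\
  field_along i (fun x => x 0 i * th (x 0 j)).
Proof.
move=> dthP cdth hth.
have h1 := square_shear dthP cdth hth.
have dN (t : R) : is_derive t 1 (fun t => - th t) (- dth t) by exact: is_deriveN.
have hN : field_along i (fun x => - th (x 0 j)).
  by apply: field_along_ext (alongZ (-1) hth) => x; rewrite mulN1r.
have h2 := square_shear dN (contN cdth) hN.
split.
  apply: field_along_ext (alongZ (1 / 2) (alongB (alongD h1 h2) (alongZ 2 sq))) => x.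
  by field.
apply: field_along_ext (alongZ (1 / 4) (alongB h1 h2)) => x.
by field.
Qed.

Lemma is_derive_pow m (t : R) : is_derive t 1 (fun y : R => y ^+ m) (m%:R * t ^+ m.-1).
Proof.
rewrite (_ : (fun y : R => y ^+ m) = (id : R -> R) ^+ m); last first.
  by apply/funext => y; rewrite exprfctE.
have := @is_deriveX R R id m t 1 1 (is_derive_id _ _).
by rewrite /GRing.scale/= mulr1.
Qed.

Lemma cont_dpow m : continuous (fun t : R => m%:R * t ^+ m.-1).
Proof.
apply: contM; first exact: cst_continuous.
by apply: contX => x.
Qed.

(** Squares of profiles are profiles, hence so are products, by polarization: from
    [x_j ^ m] and [x_j] one gets [x_j ^ m.+1]. *)
Lemma shear_monomial m : field_along i (fun x => x 0 j ^+ m) /\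
  field_along i (fun x => x 0 i * x 0 j ^+ m).
Proof.
suff h : field_along i (fun x => x 0 j ^+ m).
  split; first exact: h.
  by have [] := shear_profileM (is_derive_pow m) (@cont_dpow m) h.
elim: m => [|[|m] IH].
- apply: field_along_ext (field_along_cst vel_affine i 1) => x; by rewrite expr0.
- apply: field_along_ext (field_along_coord vel_affine i j) => x; by rewrite expr1.
have hj : field_along i (fun x => x 0 j) by exact: field_along_coord.
have [h1 _] := shear_profileM (is_derive_pow m.+1) (@cont_dpow m.+1) IH.
have [h2 _] := @shear_profileM id (fun=> 1) (fun t => is_derive_id _ _)
  (@cst_continuous _ _ _) hj.
have dD (t : R) : is_derive t 1 (fun y : R => y ^+ m.+1 + y) (m.+1%:R * t ^+ m.+1.-1 + 1).
  apply: is_deriveD; exact: is_derive_pow.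
have cD : continuous (fun t : R => m.+1%:R * t ^+ m.+1.-1 + 1).
  by apply: contD; [exact: cont_dpow|exact: cst_continuous].
have [h3 _] := shear_profileM dD cD (alongD IH hj).
apply: field_along_ext (alongZ (1 / 2) (alongB h3 (alongD h1 h2))) => x.
by rewrite !exprS; field.
Qed.

End one_direction.

(** Conjugating the field [x_i x_j e_i] by the shear [x_j + x_i ^ m] adds the field
    [x_i ^ m.+1 e_i], up to fields along [e_j] of the kind found in
    [shear_monomial]. *)
Lemma quadratic_powers k l : k != l -> field_along k (fun x => x 0 k ^+ 2) ->
  forall i n, field_along i (fun x => x 0 i ^+ n).
Proof.
move=> kl sqk.
have sq i : field_along i (fun x => x 0 i ^+ 2).
  by have [<-//|ki] := eqVneq k i; exact: square_swap sqk.
move=> i n.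
have [j ij] : exists j, i != j.
  have [->|ik] := eqVneq i k; first by exists l.
  by exists k.
have ji : j != i by rewrite eq_sym.
case: n => [|m].
  by apply: field_along_ext (field_along_cst vel_affine i 1) => x; rewrite expr0.
have [_ xy] := shear_monomial ij (sq i) 1%N.
have [xm yxm] := shear_monomial ji (sq j) m.
have [x2m _] := shear_monomial ji (sq j) (2 * m)%N.
have := field_conj_shear H_id H_comp vel_affine ji (is_derive_pow m) (@cont_dpow m) xm xy.
set u := (X in field H X) => hu.
have h : field H (fun x => u x - (x 0 i * x 0 j ^+ 1) *: delta_mx 0 i +
    ((m%:R * (x 0 j * x 0 i ^+ m)) *: delta_mx 0 j +
     (m%:R * x 0 i ^+ (2 * m)) *: delta_mx 0 j)).
  apply: (fieldD H_comp).
    by apply: (fieldB H_comp); [exact: hu|exact: xy].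
  by apply: (fieldD H_comp); [exact: (alongZ m%:R yxm)|exact: (alongZ m%:R x2m)].
move: h; set U := (X in field H X) => h.
suff e : (fun x : V => x 0 i ^+ m.+1 *: (delta_mx 0 i : V)) = U.
  by rewrite /field_along e.
apply/funext => x; rewrite /U; rewrite /u /shear.
apply/rowP => c; rewrite !mxE !eqxx /=.
rewrite (negPf ij) !mul1r !mulr1 !mulr0 !addr0 !expr1 mul2n -addnn exprD.
case: (m) => [|p] /=; first by rewrite !mul0r !expr0 !expr1; ring.
by rewrite !exprS; ring.
Qed.

End quadratic_fields.

(** * All powers from the square and the cube in dimension one *)

Section moebius.
Context {R : realType}.
Local Notation V := 'rV[R]_1.
Variable H : set (V -> option V).
Hypothesis H_id : H Some.
Hypothesis H_comp : forall h k, H h -> H k -> H (pcomp k h).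
Hypothesis vel_affine : forall (A : 'M[R]_1) (b : V) rho,
  vel H (fun x => x *m A + b) rho.
Local Notation field_along := (field_along H).

(** The flow of the field [x ^+ 2] at time [c]. *)
Definition moebius (c u : R) : R := u / (1 - c * u).

(** On this range the denominator of [moebius c] stays away from [0], so that the flow
    of [x ^+ 2] has not yet blown up. *)
Lemma half_den (c u r : R) : `|u| <= r -> `|c| * r <= 1 / 4 ->
  1 / 2 <= 1 - c * u.
Proof.
move=> ur cr; have : `|c * u| <= 1 / 4.
  by rewrite normrM (le_trans _ cr)// ler_wpM2l.
by rewrite ler_norml => /andP[]; lra.
Qed.

Lemma inv_half (y : R) : 1 / 2 <= y -> 0 < y^-1 <= 2.
Proof.
move=> y2; have y0 : 0 < y by lra.
rewrite invr_gt0 y0/= -[leRHS]invrK lef_pV2 ?posrE ?invr_gt0//; lra.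
Qed.

Lemma moebius_bound c u r : `|u| <= r -> `|c| * r <= 1 / 4 -> `|moebius c u| <= 2 * r.
Proof.
move=> ur cr; have /inv_half/andP[i0 i2] := half_den ur cr.
by rewrite /moebius normrM (gtr0_norm i0) mulrC ler_pM// ltW.
Qed.

Lemma moebius_lip c u v r : `|u| <= r -> `|v| <= r -> `|c| * r <= 1 / 4 ->
  `|moebius c u - moebius c v| <= 4 * `|u - v|.
Proof.
move=> ur vr cr; have hu := half_den ur cr; have hv := half_den vr cr.
have /andP[i0 i2] := inv_half hu; have /andP[j0 j2] := inv_half hv.
rewrite (_ : _ - _ = ((1 - c * u)^-1 * (1 - c * v)^-1) * (u - v)); last first.
  by rewrite /moebius; field; apply/andP; split; rewrite gt_eqF//; lra.
rewrite normrM ler_wpM2r// normrM (gtr0_norm i0) (gtr0_norm j0).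
have -> : 4 = 2 * 2 :> R by ring.
by rewrite ler_pM// ltW.
Qed.

Definition moebius_map (c : R) (x : V) : V := moebius c (x 0 0) *: delta_mx 0 0.

Lemma norm_rV1 (x : V) : `|x| = `|x 0 0|.
Proof.
apply/eqP; rewrite eq_le coord_le_norm andbT; apply: norm_le_coord => // i j.
by rewrite !ord1.
Qed.

Lemma coord_rV1 (s : R) : (s *: delta_mx 0 0 : V) 0 0 = s.
Proof. by rewrite !mxE eqxx /= mulr1. Qed.

Hypothesis sq : field_along 0 (fun x => x 0 0 ^+ 2).

Lemma reach_moeb c rho : 0 < rho -> `|c| * (2 * rho + 1) <= 1 / 4 ->
  reach H (moebius_map c) rho.
Proof.
move=> r0 cr.
have crt t : 0 <= t <= 1 -> `|t * c| * (2 * rho + 1) <= 1 / 4.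
  move=> /andP[t0 t1]; apply: le_trans cr; rewrite ler_wpM2r//; first lra.
  by rewrite normrM ger0_norm// ler_piMl.
have cden t u : 0 <= t <= 1 -> `|u| <= 2 * rho + 1 -> 1 / 2 <= 1 - t * c * u.
  by move=> t1 ur; apply: (half_den ur); exact: crt.
rewrite -[c]mul1r.
apply: (@vel_reach _ _ _ H_id H_comp (fun t => moebius_map (t * c))
  (fun x => (c * x 0 0 ^+ 2) *: delta_mx 0 0) rho (2 * rho) 1 4).
- exact: ltr01.
- lra.
- lra.
- move=> x _; rewrite mul0r /moebius_map /moebius mul0r subr0 divr1.
  by apply/rowP => i; rewrite !ord1 coord_rV1.
- move=> s t x s0 t0 st; rewrite norm_rV1 => xr.
  rewrite /moebius_map coord_rV1; congr (_ *: _).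
  have h1 := cden s _ _ xr; have h2 := cden (s + t) _ _ xr.
  have s1 : 0 <= s <= 1 by apply/andP; split; lra.
  have st1 : 0 <= s + t <= 1 by apply/andP; split; lra.
  have {}h1 := h1 s1; have {}h2 := h2 st1.
  by rewrite /moebius; field; do ?[apply/andP; split]; rewrite gt_eqF//; lra.
- move=> t x t1; rewrite !norm_rV1 coord_rV1 => xr; apply: (moebius_bound xr).
  by apply: le_trans (crt t t1); rewrite ler_wpM2l//; lra.
- move=> t x y t1; rewrite !norm_rV1 => xr yr.
  rewrite (_ : (moebius_map (t * c) x - moebius_map (t * c) y) 0 0 =
    moebius (t * c) (x 0 0) - moebius (t * c) (y 0 0)); last first.
    by rewrite -scalerBl coord_rV1.
  rewrite (_ : (x - y) 0 0 = x 0 0 - y 0 0); last by rewrite !mxE.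
  by apply: (moebius_lip xr yr); exact: crt.
- move=> eps e0; pose k := 2 * (2 * rho + 1) ^+ 3 * c ^+ 2 + 1.
  have k0 : 0 < k.
    by rewrite ltr_wpDl// mulr_ge0 ?sqr_ge0// mulr_ge0// exprn_ge0//; lra.
  exists (Num.min 1 (eps / k)); first by rewrite lt_min ltr01 divr_gt0.
  move=> t /andP[t0]; rewrite le_min ler_pdivlMr// => /andP[t1 tk] x.
  rewrite !norm_rV1 => xr; set u := x 0 0 in xr *.
  have t01 : 0 <= t <= 1 by rewrite t1 ltW.
  have hd := cden t u t01 xr; have /andP[i0 i2] := inv_half hd.
  rewrite [X in `|X| <= _](_ : _ = (u ^+ 3 * c ^+ 2 * (1 - t * c * u)^-1) * t ^+ 2); last first.
    rewrite /moebius_map !mxE !eqxx /= !mulr1 -/u /moebius; field.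
    by rewrite gt_eqF//; lra.
  rewrite normrM (ger0_norm (sqr_ge0 t)) expr2 mulrA ler_pM2r//.
  apply: (@le_trans _ _ (k * t)); last by rewrite mulrC.
  rewrite ler_pM2r// normrM (gtr0_norm i0) [`|_ * c ^+ 2|]normrM (ger0_norm (sqr_ge0 c)) normrX.
  apply: (@le_trans _ _ ((2 * rho + 1) ^+ 3 * c ^+ 2 * 2)).
    apply: ler_pM; [by apply: mulr_ge0; [exact: exprn_ge0|exact: sqr_ge0]|exact: ltW| |exact: i2].
    by rewrite ler_wpM2r ?sqr_ge0// lerXn2r// nnegrE; lra.
  by rewrite /k; lra.
by have [_ /(_ (2 * rho + 1))[]] := field_alongZ vel_affine c sq.
Qed.

Hypothesis cube : field_along 0 (fun x => x 0 0 ^+ 3).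

(** The cubic field conjugated by [moebius_map a] is [x ^+ 3 / (1 - a x)]: at
    [p = moebius a x] it is [p ^+ 3], and the inverse map has derivative
    [1 / (1 + a p) ^+ 2] there. The sign [sg] gives the opposite field. *)
Lemma vel_geometric a rho sg : 0 < rho -> 0 < a -> a * (4 * rho + 3) <= 1 / 4 ->
  vel H (fun x => (sg * (x 0 0 ^+ 3 / (1 - a * x 0 0))) *: delta_mx 0 0) rho.
Proof.
move=> r0 a0 ar.
pose w (x : V) : V := (sg * x 0 0 ^+ 3) *: delta_mx 0 0.
have [cw vw] : field H w by exact: (field_alongZ vel_affine sg cube).
have aa : `|a| = a by rewrite gtr0_norm.
have ar1 : `|a| * (2 * rho + 1) <= 1 / 4.
  by rewrite aa; apply: le_trans ar; rewrite ler_pM2l//; lra.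
have ar0 : `|a| * rho <= 1 / 4.
  by apply: le_trans ar1; rewrite aa ler_pM2l//; lra.
apply: (@vel_conj _ _ _ H_comp (moebius_map a) (moebius_map (- a)) w _ rho (2 * rho + 1) 1 4).
- exact: ltr01.
- by [].
- by move=> x; rewrite !norm_rV1 coord_rV1 => xr; rewrite lerD2r; exact: moebius_bound.
- move=> y z; rewrite !norm_rV1 => yr zr.
  rewrite -scalerBl coord_rV1 (_ : (y - z) 0 0 = y 0 0 - z 0 0); last by rewrite !mxE.
  by apply: (moebius_lip yr zr); rewrite normrN.
- exact: cw.
- move=> eps e0.
  pose B := 2 * rho; have B0 : 0 < B by rewrite /B; lra.
  pose k := 8 * (a * sg ^+ 2 * B ^+ 6) + 1.
  have asg : 0 <= a * sg ^+ 2 by apply: mulr_ge0; [exact: ltW|exact: sqr_ge0].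
  have asgB : 0 <= a * sg ^+ 2 * B ^+ 6.
    by apply: mulr_ge0 => //; apply: exprn_ge0; exact: ltW.
  have k0 : 0 < k.
    by rewrite ltr_wpDl// mulr_ge0.
  pose k' := `|sg| * B ^+ 3 + 1.
  have k'0 : 0 < k' by rewrite ltr_wpDl// mulr_ge0// exprn_ge0// ltW.
  exists (Num.min k'^-1 (eps / k)); first by rewrite lt_min invr_gt0 k'0 divr_gt0.
  move=> t /andP[t0]; rewrite le_min ler_pdivlMr// => /andP[tk' tk] x.
  rewrite !norm_rV1 => xr; set u := x 0 0 in xr *.
  pose p := moebius a u; have pB : `|p| <= B by exact: moebius_bound.
  have hu := half_den xr ar0.
  pose y := p + t * (sg * p ^+ 3).
  have yr : `|y| <= 2 * rho + 1.
    rewrite (le_trans (ler_normD _ _))// lerD// normrM gtr0_norm//.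
    apply: (@le_trans _ _ (k'^-1 * k')); last by rewrite mulVf// gt_eqF.
    apply: ler_pM => //; first exact: ltW.
    rewrite normrM normrX (@le_trans _ _ (`|sg| * B ^+ 3))//.
      by rewrite ler_wpM2l// lerXn2r// nnegrE ltW.
    by rewrite /k' lerDl.
  have Nar : `|- a| * (2 * rho + 1) <= 1 / 4 by rewrite normrN.
  have hy := half_den yr Nar.
  have hp : 1 / 2 <= 1 - - a * p.
    by apply: (@half_den _ _ (2 * rho + 1)) => //; rewrite (le_trans pB)// /B; lra.
  have /andP[i0 i2] := inv_half hy; have /andP[j0 j2] := inv_half hp.
  have pu : u = p / (1 + a * p).
    by rewrite /p /moebius; field; do ?[apply/andP; split]; rewrite gt_eqF//; lra.
  rewrite [X in `|X| <= _](_ : _ = (- a * sg ^+ 2 * p ^+ 6 *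
     ((1 - - a * y)^-1 * (1 - - a * p)^-1 * (1 - - a * p)^-1)) * t ^+ 2); last first.
    rewrite /moebius_map /w !mxE !eqxx /= !mulr1 -/u -/p -/(moebius _ _) -/y /moebius.
    rewrite {1}pu.
    have -> : u ^+ 3 / (1 - a * u) = p ^+ 3 / (1 + a * p) ^+ 2.
      by rewrite pu; field; do ?[apply/andP; split]; rewrite gt_eqF//; lra.
    by rewrite /y; field; do ?[apply/andP; split]; rewrite gt_eqF//;
      move: hy hp; rewrite /y; lra.
  rewrite normrM (ger0_norm (sqr_ge0 t)) expr2 mulrA ler_pM2r//.
  apply: (@le_trans _ _ (k * t)); last by rewrite mulrC.
  rewrite ler_pM2r// normrM; have -> : `|- a * sg ^+ 2 * p ^+ 6| = a * sg ^+ 2 * `|p| ^+ 6.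
    by rewrite mulNr mulNr normrN normrM (ger0_norm asg) normrX.
  rewrite ger0_norm; last by rewrite !mulr_ge0// ltW.
  apply: (@le_trans _ _ (a * sg ^+ 2 * B ^+ 6 * (2 * 2 * 2))).
    apply: ler_pM.
    + by apply: mulr_ge0 => //; exact: exprn_ge0.
    + by rewrite !mulr_ge0// ltW.
    + apply: ler_wpM2l; first exact: asg.
      by rewrite lerXn2r// nnegrE ltW.
    + by apply: ler_pM => //; [rewrite mulr_ge0// ltW|exact: ltW|apply: ler_pM => //; exact: ltW].
  by rewrite /k; lra.
- exact: reach_moeb.
- apply: reach_moeb; first lra.
  by rewrite normrN aa (_ : 2 * _ + 1 = 4 * rho + 3)//; ring.
by have [] := vw (2 * rho + 1).
Qed.

Lemma geometric_remainder (a u : R) n : 1 - a * u != 0 ->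
  u ^+ 3 / (1 - a * u) - \sum_(k < n) a ^+ k * u ^+ (3 + k) =
  a ^+ n * (u ^+ (3 + n) / (1 - a * u)).
Proof.
move=> den; elim: n => [|n IH]; first by rewrite big_ord0 subr0 expr0 mul1r addn0.
rewrite big_ord_recr /= opprD addrA IH addnS !exprS.
by field.
Qed.

(** The expansion of [x ^+ 3 / (1 - a x)] in powers of [a] has the coefficients
    [x ^+ (3 + k)]. Once those with [k < n] are available, subtracting them, dividing
    by [a ^+ n] and letting [a] tend to [0] gives the next one. For fixed [a] the
    field has a pole, but outside of the cube under consideration when [a] is
    small. *)
Lemma cubic_powers n : field_along 0 (fun x => x 0 0 ^+ n).
Proof.
have [n3|] := ltnP n 3.
  case: n n3 => [_|[_|[_|n /notF[]]]].
  - by apply: field_along_ext (field_along_cst vel_affine 0 1) => x; rewrite expr0.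
  - by apply: field_along_ext (field_along_coord vel_affine 0 0) => x; rewrite expr1.
  exact: sq.
move=> /subnKC <-; move: (n - 3)%N => {}n.
elim/ltn_ind: n => n IH.
apply: field_closed_local.
  apply: contZ; last exact: cst_continuous.
  by apply: contX; exact: coord_continuous.
move=> rho0 eps e0.
pose rho := Num.max rho0 1; have r0 : 0 < rho by rewrite lt_max ltr01 orbT.
have r0r : rho0 <= rho by rewrite le_max lexx.
pose K := 2 * rho ^+ (3 + n).+1.
have K0 : 0 < K by rewrite mulr_gt0// exprn_gt0.
pose a := Num.min (1 / (4 * (4 * rho + 3))) (eps / K).
have a0 : 0 < a by rewrite lt_min !divr_gt0//; lra.
have [a1 a2] : a <= 1 / (4 * (4 * rho + 3)) /\ a <= eps / K.
  by rewrite !ge_min !lexx orbT.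
have ar : a * (4 * rho + 3) <= 1 / 4.
  move: a1; rewrite ler_pdivlMr; last lra.
  by lra.
have ar0 : `|a| * rho <= 1 / 4.
  by rewrite gtr0_norm//; apply: le_trans ar; rewrite ler_pM2l//; lra.
pose q (x : V) := \sum_(k < n) a ^+ k * x 0 0 ^+ (3 + k).
have hq : field_along 0 q.
  rewrite /field_along /q.
  rewrite (_ : (fun x : V => _) = (fun x : V => \sum_(k < n)
     (a ^+ k * x 0 0 ^+ (3 + k)) *: (delta_mx 0 0 : V))).
    apply: (field_sum H_comp vel_affine) => k _.
    by apply: (field_alongZ vel_affine); exact: IH.
  by apply/funext => x; rewrite scaler_suml.
pose g (x : V) := x 0 0 ^+ 3 / (1 - a * x 0 0).
pose w (x : V) : V := (a ^- n * (g x - q x)) *: delta_mx 0 0.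
have bnd sg : exists2 M, 0 < M &
    forall x : V, `|x| <= rho -> `|(sg * g x) *: (delta_mx 0 0 : V)| <= M.
  exists (`|sg| * (rho ^+ 3 * 2) + 1).
    rewrite ltr_wpDl//; apply: mulr_ge0 => //; apply: mulr_ge0 => //.
    by apply: exprn_ge0; exact: ltW.
  move=> x; rewrite !norm_rV1 coord_rV1 => xr; rewrite normrM.
  apply: (@le_trans _ _ (`|sg| * (rho ^+ 3 * 2))); last by rewrite lerDl.
  rewrite ler_wpM2l// /g normrM normrX.
  have /inv_half/andP[i0 i2] := half_den xr ar0.
  rewrite (gtr0_norm i0); apply: ler_pM; [exact: exprn_ge0|exact: ltW| |exact: i2].
  by apply: lerXn2r; rewrite ?nnegrE// ltW.
have vw sg : vel H (fun x => (a ^- n * (sg * g x - sg * q x)) *: delta_mx 0 0) rho.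
  have an : 0 < a ^- n by rewrite invr_gt0 exprn_gt0.
  rewrite (_ : (fun x => _) = (fun x => a ^- n *:
     ((sg * g x) *: delta_mx 0 0 + (- sg * q x) *: delta_mx 0 0))); last first.
    by apply/funext => x; rewrite -scalerDl scalerA mulNr.
  apply: vel_scale => //.
  have [cq vq] : field_along 0 (fun x => - sg * q x) by exact: field_alongZ.
  apply: (@vel_add _ _ _ H_comp _ _ rho (rho + 1)) => //; first by rewrite ltrDl.
    exact: vel_geometric.
  by have [] := vq (rho + 1).
exists w; split.
- apply: velS r0r _; have := vw 1.
  by rewrite (_ : (fun x => _) = w)//; apply/funext => x; rewrite !mul1r.
- apply: velS r0r _; have := vw (-1).
  rewrite (_ : (fun x => _) = (fun x => - w x))//; apply/funext => x.
  by apply/rowP => i; rewrite /w !mxE; ring.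
move=> x; rewrite !norm_rV1 => /le_trans/(_ r0r) xr; set u := x 0 0 in xr *.
have hd := half_den xr ar0; have /andP[i0 i2] := inv_half hd.
have nz : 1 - a * u != 0 by rewrite gt_eqF//; lra.
rewrite -scalerBl coord_rV1 /g /q -/u geometric_remainder// mulKf; last first.
  by rewrite expf_neq0// gt_eqF.
rewrite (_ : _ - _ = a * (u ^+ (3 + n).+1 * (1 - a * u)^-1)); last first.
  by rewrite exprS; field.
rewrite normrM (gtr0_norm a0); apply: (@le_trans _ _ (a * K)); last by rewrite -ler_pdivlMr.
rewrite ler_pM2l// normrM (gtr0_norm i0) normrX /K mulrC.
apply: ler_pM; [exact: ltW|exact: exprn_ge0|exact: i2|].
by apply: lerXn2r; rewrite ?nnegrE// ltW.
Qed.

End moebius.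

(** * Finite differences, averages and blow-ups *)

Section finite_differences.
Context {R : realType}.
Implicit Types (f g : R -> R) (h x t : R).

Definition fdiff h f : R -> R := fun x => f (x + h) - f x.

Lemma cont_fdiff h f : continuous f -> continuous (fdiff h f).
Proof.
move=> cf; apply: contB => //.
apply: (@cont_comp _ _ _ (fun x => x + h) f) => //.
by apply: (@contD R R R id (fun=> h)) => [x|]; [|exact: cst_continuous].
Qed.

Lemma is_derive_fdiff h f df : (forall t : R, is_derive t 1 f (df t)) ->
  forall t : R, is_derive t 1 (fdiff h f) (fdiff h df t).
Proof.
move=> hf t; apply: is_deriveB.
have hs : is_derive t 1 (fun x => x + h) (1 : R).
  rewrite -[X in is_derive _ _ _ X]addr0.
  by apply: is_deriveD.
by have := @is_derive1_comp R f (fun x => x + h) t _ _ (hf (t + h)) hs; rewrite mulr1.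
Qed.

Lemma cont_iter_fdiff n h f : continuous f -> continuous (iter n (fdiff h) f).
Proof. by move=> cf; elim: n => [//|n IH] /=; exact: cont_fdiff. Qed.

Lemma is_derive_iter_fdiff n h f df : (forall t : R, is_derive t 1 f (df t)) ->
  forall t : R, is_derive t 1 (iter n (fdiff h) f) (iter n (fdiff h) df t).
Proof. by move=> hf; elim: n => [//|n IH] /=; exact: is_derive_fdiff. Qed.

(** [F i] stands for the [i]-th derivative; the remainder is [o(`|t| ^+ n)] without
    any derivative of [F n], by integration of the expansion of [F 1]. *)
Lemma taylor n (F : nat -> R -> R) x0 :
  (forall i, (i < n)%N -> forall t : R, is_derive t 1 (F i) (F i.+1 t)) ->
  continuous (F n) -> forall eps, 0 < eps -> exists2 dlt, 0 < dlt &
  forall t, `|t| <= dlt ->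
  `|F 0%N (x0 + t) - \sum_(i < n.+1) F i x0 * t ^+ i / (i`!)%:R| <= eps * `|t| ^+ n.
Proof.
elim: n F => [|n IH] F dF cF eps e0.
  have [dl dl0 hd] := real_unif_cont cF `|x0| e0.
  exists dl => // t tdl; rewrite big_ord_recl big_ord0 /= addr0 !expr0 !mulr1 divr1.
  rewrite -normrN opprB; apply: hd; first by [].
  by rewrite opprD addrA subrr sub0r normrN.
have [dl dl0 hd] := IH (fun i => F i.+1) (fun i ni => dF i.+1 ni) cF eps e0.
exists dl => // t tdl.
pose P s := \sum_(i < n.+2) F i x0 * s ^+ i / (i`!)%:R.
pose dP s := \sum_(i < n.+1) F i.+1 x0 * s ^+ i / (i`!)%:R.
have hP (s : R) : is_derive s 1 P (dP s).
  rewrite (_ : P = \sum_(i < n.+2) (fun s => F i x0 * s ^+ i / (i`!)%:R)); last first.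
    by apply/funext => u; rewrite fct_sumE.
  rewrite (_ : dP s = \sum_(i < n.+2) (F i x0 / (i`!)%:R * (i%:R * s ^+ i.-1))); last first.
    rewrite big_ord_recl /= mul0r mulr0 add0r; apply: eq_bigr => i _ /=.
    rewrite /bump /= add1n factS natrM; field.
    by rewrite pnatr_eq0 -lt0n fact_gt0 nat1r pnatr_eq0.
  apply: is_derive_sum => i.
  rewrite (_ : (fun s => _) = (F i x0 / (i`!)%:R) \*: (fun u : R => u ^+ i)).
    have hp : is_derive s 1 (fun y : R => y ^+ i) (i%:R * s ^+ i.-1).
      rewrite (_ : (fun y : R => y ^+ i) = (id : R -> R) ^+ i); last first.
        by apply/funext => y; rewrite exprfctE.
      have := @is_deriveX R R id i s 1 1 (is_derive_id _ _).
      by rewrite /GRing.scale/= mulr1.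
    exact: is_deriveZ.
  by apply/funext => u; rewrite /= /GRing.scale/=; ring.
pose G s := F 0%N (x0 + s) - P s.
have hG (s : R) : is_derive s 1 G (F 1%N (x0 + s) - dP s).
  apply: is_deriveB.
  have hs : is_derive s 1 (fun u => x0 + u) (1 : R).
    rewrite -[X in is_derive _ _ _ X]add0r.
    by apply: is_deriveD.
  by have := @is_derive1_comp R (F 0%N) (fun u => x0 + u) s _ _ (dF 0%N isT (x0 + s)) hs;
    rewrite mulr1.
have G0 : G 0 = 0.
  rewrite /G /P big_ord_recl big1 => [|i _]; last by rewrite expr0n mulr0 mul0r.
  by rewrite addr0 expr0 mulr1 divr1 addr0 subrr.
have [c] := MVT_unordered 0 t hG; rewrite G0 !subr0 => ct; rewrite -/(G t) => ->.
rewrite normrM exprSr mulrA ler_wpM2r//.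
apply: le_trans (hd c (le_trans ct tdl)) _.
by rewrite ler_pM2l// lerXn2r// nnegrE.
Qed.

Lemma quadratic_sequence (a : nat -> R) :
  (forall k, a k.+3 - 3 * a k.+2 + 3 * a k.+1 - a k = 0) ->
  exists al be ga : R, forall k, a k = al * k%:R ^+ 2 + be * k%:R + ga.
Proof.
move=> ha.
exists ((a 2%N - 2 * a 1%N + a 0%N) / 2), ((- a 2%N + 4 * a 1%N - 3 * a 0%N) / 2), (a 0%N).
suff h k : [/\ a k = (a 2%N - 2 * a 1%N + a 0%N) / 2 * k%:R ^+ 2 +
      (- a 2%N + 4 * a 1%N - 3 * a 0%N) / 2 * k%:R + a 0%N,
    a k.+1 = (a 2%N - 2 * a 1%N + a 0%N) / 2 * k.+1%:R ^+ 2 +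
      (- a 2%N + 4 * a 1%N - 3 * a 0%N) / 2 * k.+1%:R + a 0%N &
    a k.+2 = (a 2%N - 2 * a 1%N + a 0%N) / 2 * k.+2%:R ^+ 2 +
      (- a 2%N + 4 * a 1%N - 3 * a 0%N) / 2 * k.+2%:R + a 0%N].
  by move=> k; have [] := h k.
elim: k => [|k [h0 h1 h2]]; first by split; field.
split => //.
have : a k.+3 = 3 * a k.+2 - 3 * a k.+1 + a k by have := ha k; lra.
by rewrite h0 h1 h2 => ->; rewrite -!natr1; field.
Qed.

(** After subtraction of the quadratic polynomial with the same values at [-1], [0] and
    [1], the restriction to a lattice of mesh [1 / m] is a quadratic sequence with
    three zeros, hence vanishes; all such lattices together are dense. *)
Lemma third_difference f : continuous f ->
  (forall h x, iter 3 (fdiff h) f x = 0) ->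
  exists a b c, forall x, f x = a * x ^+ 2 + b * x + c.
Proof.
move=> cf hf.
pose a := (f 1 + f (-1) - 2 * f 0) / 2; pose b := (f 1 - f (-1)) / 2.
exists a, b, (f 0) => x; apply/eqP; rewrite -subr_eq0; apply/eqP.
pose g y := f y - (a * y ^+ 2 + b * y + f 0).
have cg : continuous g.
  apply: contB => //; apply: contD; last exact: cst_continuous.
  apply: contD; apply: contM; try exact: cst_continuous.
    by apply: contX => y.
  by move=> y.
have g3 h y : g (y + h + h + h) - 3 * g (y + h + h) + 3 * g (y + h) - g y = 0.
  by have := hf h y; rewrite /= /fdiff /g => e; lra.
have g0 : g 0 = 0 by rewrite /g; ring.
have g1 : g 1 = 0 by rewrite /g /a /b; field.
have gN1 : g (-1) = 0 by rewrite /g /a /b; field.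
(* The lattices start at [- B], so that they can be indexed by natural numbers. *)
pose B := (Num.truncn `|x|).+2.
have xB : `|x| + 1 < B%:R by rewrite -natr1 ltrD2r; exact: truncnS_gt.
have lattice m k : (0 < m)%N -> g (k%:R / m%:R - B%:R) = 0.
  move=> m0; have mR : m%:R != 0 :> R by rewrite pnatr_eq0 -lt0n.
  have [|al [be [ga hq]]] := @quadratic_sequence (fun k => g (k%:R / m%:R - B%:R)).
    move=> j; have := g3 (m%:R^-1) (j%:R / m%:R - B%:R).
    have e i : i%:R / m%:R - B%:R + m%:R^-1 = i.+1%:R / m%:R - B%:R :> R.
      by rewrite -[in RHS]natr1; field.
    by rewrite !e.
  have B0 : (0 < B)%N by [].
  have z0 := hq (B * m)%N; have zm := hq (B.+1 * m)%N; have zn := hq (B.-1 * m)%N.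
  rewrite natrM mulfK// subrr g0 in z0.
  rewrite natrM mulfK// -natr1 addrC addKr g1 in zm.
  have BB : B.-1%:R = B%:R - 1 :> R by rewrite -[B in RHS]prednK// -natr1 addrK.
  rewrite natrM mulfK// BB addrAC subrr sub0r gN1 in zn.
  rewrite hq.
  have m2 : m%:R ^+ 2 != 0 :> R by rewrite expf_neq0.
  have al0 : al = 0.
    apply: (mulIf m2); rewrite mul0r; lra.
  have be0 : be = 0.
    apply: (mulIf mR); rewrite mul0r; move: z0 zm zn; rewrite al0; lra.
  by move: z0; rewrite al0 be0 !mul0r !add0r => <-.
apply/eqP; rewrite -normr_le0; apply/ler_addgt0Pl => eps e0; rewrite addr0.
have [dl dl0 hd] := real_unif_cont cg `|x| e0.
pose m := (Num.truncn dl^-1).+1; have m0 : 0 < m%:R :> R by rewrite ltr0n.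
have mdl : m%:R^-1 <= dl.
  by rewrite -[leRHS]invrK lef_pV2 ?posrE ?invr_gt0//; apply: ltW; exact: truncnS_gt.
pose k := Num.truncn ((x + B%:R) * m%:R).
have xB0 : 0 <= (x + B%:R) * m%:R.
  by rewrite mulr_ge0//; have := ler_norm (- x); rewrite normrN; lra.
have /andP[k1 k2] : k%:R <= (x + B%:R) * m%:R < k.+1%:R by exact: truncn_itv.
have := hd x (k%:R / m%:R - B%:R); rewrite lattice// subr0 -/(g x); apply => //.
apply: le_trans mdl; rewrite (_ : x - _ = ((x + B%:R) * m%:R - k%:R) / m%:R); last first.
  by field; rewrite gt_eqF.
rewrite normrM ger0_norm; last by rewrite subr_ge0.
have mi : 0 < m%:R^-1 :> R by rewrite invr_gt0.
rewrite (gtr0_norm mi) ler_piMl ?(ltW mi)//.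
by move: k2; rewrite -natr1; lra.
Qed.

End finite_differences.

(** [S] abstracts the set of functions [psi] for which the field [psi (x_k) e_k] is
    available: a closed vector space stable under increasing affine changes of the
    variable. *)
Section profile_class.
Context {R : realType}.
Variable S : (R -> R) -> Prop.
Hypothesis S_ext : forall f g, f =1 g -> S f -> S g.
Hypothesis S_cont : forall f, S f -> continuous f.
Hypothesis S_D : forall f g, S f -> S g -> S (fun x => f x + g x).
Hypothesis S_Z : forall c f, S f -> S (fun x => c * f x).
Hypothesis S_affine : forall l b f, 0 < l -> S f -> S (fun x => f (l * x + b)).
Hypothesis S_closed : forall f, continuous f ->
  (forall rho eps, 0 < eps -> exists2 g, S g &
     forall x, `|x| <= rho -> `|g x - f x| <= eps) -> S f.

Lemma S_sum n (F : nat -> R -> R) : S (fun=> 0) -> (forall i, (i < n)%N -> S (F i)) ->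
  S (fun x => \sum_(i < n) F i x).
Proof.
move=> S0; elim: n => [|n IH] hF.
  by apply: S_ext S0 => x; rewrite big_ord0.
have h : S (fun x => \sum_(i < n) F i x) by apply: IH => i ni; apply: hF; exact: ltnW.
by apply: S_ext (S_D h (hF n (leqnn _))) => x; rewrite big_ord_recr.
Qed.

(** Averages over a segment are limits of Riemann sums. *)
Lemma S_average f A h : S f -> (forall t : R, is_derive t 1 A (f t)) -> S (fdiff h A).
Proof.
move=> Sf dA; have cf := S_cont Sf.
have S0 : S (fun=> 0) by apply: S_ext (S_Z 0 Sf) => x; rewrite mul0r.
have cA : continuous A by move=> t; exact: is_derive_cont (dA t).
apply: S_closed; first exact: cont_fdiff.
move=> rho eps e0.
have e'0 : 0 < eps / (`|h| + 1) by rewrite divr_gt0// ltr_wpDl.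
have [dl dl0 hd] := real_unif_cont cf (`|rho| + `|h|) e'0.
pose n := (Num.truncn (`|h| / dl)).+1; have n0 : 0 < n%:R :> R by rewrite ltr0n.
have ni0 : 0 < n%:R^-1 :> R by rewrite invr_gt0.
have hn : `|h / n%:R| <= dl.
  rewrite normrM (gtr0_norm ni0) ler_pdivrMr// mulrC.
  by rewrite -ler_pdivrMr//; apply: ltW; exact: truncnS_gt.
set s := h / n%:R in hn.
exists (fun x => \sum_(j < n) s * f (1 * x + j%:R * s)).
  by apply: (@S_sum n (fun j x => s * f (1 * x + j%:R * s))) => // j _; apply: S_Z; exact: S_affine.
move=> x xr.
have -> : fdiff h A x = \sum_(j < n) (A (x + j.+1%:R * s) - A (x + j%:R * s)).
  rewrite -(big_mkord predT (fun j => A (x + j.+1%:R * s) - A (x + j%:R * s))).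
  rewrite (telescope_sumr (fun j => A (x + j%:R * s))) // mul0r addr0 /fdiff.
  by rewrite /s mulrC divfK// gt_eqF.
rewrite -sumrB (le_trans (ler_norm_sum _ _ _))//.
apply: (@le_trans _ _ (\sum_(j < n) eps / n%:R)); last first.
  by rewrite sumr_const card_ord -[_ *+ n]mulr_natr divfK// gt_eqF.
apply: ler_sum => j _.
have [c] := MVT_unordered (x + j%:R * s) (x + j.+1%:R * s) dA.
rewrite (_ : x + j.+1%:R * s - (x + j%:R * s) = s); last by rewrite -natr1; ring.
move=> cj ->; rewrite mul1r mulrC -mulrBl normrM.
apply: (@le_trans _ _ (eps / (`|h| + 1) * `|s|)).
  rewrite ler_wpM2r//; apply: hd; last by rewrite -normrN opprB (le_trans cj).
  rewrite (le_trans (ler_normD _ _))// lerD//; first by rewrite (le_trans xr)// ler_norm.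
  rewrite /s mulrCA normrM ler_piMr// ger0_norm ?divr_ge0// ler_pdivrMr// mul1r.
  by rewrite ler_nat ltnW.
rewrite /s normrM (gtr0_norm ni0) mulrA ler_pM2r//.
by rewrite mulrAC ler_pdivrMr ?ltr_wpDl// ler_pM2l// lerDl.
Qed.

(** After [n] averages, [eta] becomes [n] times differentiable, with [n]-th
    derivative the [n]-th difference of [eta]; blowing up at a point where it does
    not vanish leaves the leading term of the Taylor expansion. *)
Lemma S_power n eta h x0 : S eta -> iter n (fdiff h) eta x0 != 0 ->
  (forall i, (i < n)%N -> S (fun x => x ^+ i)) -> S (fun x => x ^+ n).
Proof.
move=> Seta hx Spow.
have /choice [I hI] : forall f : R -> R, exists A : R -> R, continuous f ->
    forall t : R, is_derive t 1 A (f t).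
  move=> f; have [cf|ncf] := pselect (continuous f); last by exists f.
  by have [A _ dA] := antiderivative cf; exists A.
pose M f := fdiff h (I f).
have SM f : S f -> S (M f).
  by move=> Sf; apply: S_average (Sf) _; apply: hI; exact: S_cont.
pose e i := iter i M eta.
have Se i : S (e i) by elim: i => [|i IH] //=; exact: SM.
(* The derivative of the average [M f] is the first difference of [f], so the [i]-th
   derivative of the [n]-fold average of [eta] is the [i]-th difference of the
   [n - i]-fold average. *)
pose F i := iter i (fdiff h) (e (n - i)%N).
have dF i : (i < n)%N -> forall t : R, is_derive t 1 (F i) (F i.+1 t).
  move=> ni t; have nE : (n - i = (n - i.+1).+1)%N by rewrite subnSK.
  rewrite /F nE iterSr; set g := e (n - i.+1)%N.
  apply: is_derive_iter_fdiff => {}t.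
  change (is_derive t (1 : R) (fdiff h (I g)) (fdiff h g t)).
  apply: is_derive_fdiff; apply: hI.
  by apply: S_cont; exact: Se.
have Fn : F n = iter n (fdiff h) eta by rewrite /F subnn.
have cF : continuous (F n) by rewrite Fn; apply: cont_iter_fdiff; exact: S_cont.
pose c := F n x0 / (n`!)%:R.
have nf0 : (n`!)%:R != 0 :> R by rewrite pnatr_eq0 -lt0n fact_gt0.
have c0 : c != 0 by rewrite /c mulf_neq0 ?invr_eq0// Fn.
have cN0 : 0 < `|c| by rewrite normr_gt0.
apply: S_closed; first by apply: contX => x.
move=> rho eps e0; pose r := `|rho| + 1.
have r0 : 0 < r by rewrite ltr_wpDl.
have r0n : 0 < r ^+ n by rewrite exprn_gt0.
have e'0 : 0 < eps * `|c| / r ^+ n by rewrite divr_gt0// mulr_gt0.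
have [dl dl0 hd] := taylor x0 dF cF e'0.
pose l := dl / r; have l0 : 0 < l by rewrite divr_gt0.
have S0 : S (fun=> 0) by apply: S_ext (S_Z 0 Seta) => x; rewrite mul0r.
exists (fun x => (c * l ^+ n)^-1 * (F 0%N (l * x + x0) +
    -1 * \sum_(i < n) (F i x0 * l ^+ i / (i`!)%:R) * x ^+ i)).
  apply: S_Z; apply: S_D; first by apply: S_affine => //; rewrite /F subn0; exact: Se.
  apply: S_Z.
  apply: (@S_sum n (fun i x => (F i x0 * l ^+ i / (i`!)%:R) * x ^+ i)) => // i ni.
  by apply: S_Z; exact: Spow.
move=> x xr.
have xr' : `|x| <= r by rewrite (le_trans xr)// /r; have := ler_norm rho; lra.
have lx : `|l * x| <= dl.
  by rewrite normrM gtr0_norm// /l mulrAC ler_pdivrMr// ler_pM2l.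
have ln0 : l ^+ n != 0 by rewrite expf_neq0// gt_eqF.
have := hd (l * x) lx; rewrite big_ord_recr /= -/c.
rewrite [x0 + _]addrC; set s := \sum_(i < n) _; set s' := \sum_(i < n) _.
have <- : s = s' by apply: eq_bigr => i _; rewrite exprMn; ring.
rewrite (_ : F n x0 * (l * x) ^+ n / (n`!)%:R = c * l ^+ n * x ^+ n); last first.
  by rewrite /c exprMn; field.
move=> hh.
rewrite (_ : _ - _ = (c * l ^+ n)^-1 * (F 0%N (l * x + x0) - (s + c * l ^+ n * x ^+ n))); last first.
  by field; rewrite c0 ln0.
rewrite normrM; apply: le_trans (ler_wpM2l (normr_ge0 _) hh) _.
have -> : `|(c * l ^+ n)^-1| = (`|c| * l ^+ n)^-1.
  by rewrite normfV normrM normrX (gtr0_norm l0).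
have -> : `|l * x| ^+ n = l ^+ n * `|x| ^+ n by rewrite normrM (gtr0_norm l0) exprMn.
rewrite [leLHS](_ : _ = eps * (`|x| ^+ n / r ^+ n)); last first.
  by field; rewrite !gt_eqF//= exprn_gt0.
apply: ler_piMr; first exact: ltW.
by rewrite ler_pdivrMr// mul1r; apply: lerXn2r; rewrite ?nnegrE// ltW.
Qed.

End profile_class.

(** * Coordinate-separable fields *)

Section separable_fields.
Context {R : realType} {d : nat}.
Local Notation V := 'rV[R]_d.
Variable H : set (V -> option V).
Hypothesis H_id : H Some.
Hypothesis H_comp : forall h k, H h -> H k -> H (pcomp k h).
Hypothesis vel_affine : forall (A : 'M[R]_d) (b : V) rho,
  vel H (fun x => x *m A + b) rho.
Local Notation field_along := (field_along H).

Definition profile (k : 'I_d) (psi : R -> R) :=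
  continuous psi /\ field_along k (fun x => psi (x 0 k)).

Lemma profile_ext k f g : f =1 g -> profile k f -> profile k g.
Proof. by move=> /funext ->. Qed.

Lemma profileD k f g : profile k f -> profile k g -> profile k (fun x => f x + g x).
Proof.
by move=> [cf hf] [cg hg]; split; [exact: contD|exact: (field_alongD H_comp hf hg)].
Qed.

Lemma profileZ k c f : profile k f -> profile k (fun x => c * f x).
Proof.
move=> [cf hf]; split; last exact: (field_alongZ vel_affine c hf).
by apply: contM => //; exact: cst_continuous.
Qed.

Lemma profile_affine k l b f : 0 < l -> profile k f -> profile k (fun x => f (l * x + b)).
Proof.
move=> l0 [cf hf]; split.
  apply: (@cont_comp _ _ _ (fun x => l * x + b) f) => //.
  apply: (@contD R R R (fun x => l * x) (fun=> b)); last exact: cst_continuous.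
  by apply: (@contM R R (fun=> l) id) => [|x]; first exact: cst_continuous.
have := field_dilate H_id H_comp vel_affine (b *: delta_mx 0 k) l0 hf.
rewrite /field_along (_ : (fun x => _) = (fun x : V => f (l * x 0 k + b) *: delta_mx 0 k))//.
by apply/funext => x; rewrite !mxE !eqxx mulr1.
Qed.

Lemma profile_closed k f : continuous f ->
  (forall rho eps, 0 < eps -> exists2 g, profile k g &
     forall x, `|x| <= rho -> `|g x - f x| <= eps) -> profile k f.
Proof.
move=> cf hf; split => //; apply: field_along_closed.
  by apply: (@cont_comp _ _ _ (fun x : V => x 0 k) f) => //; exact: coord_continuous.
move=> rho eps e0; have [g [cg hg] gf] := hf rho _ e0.
exists (fun x => g (x 0 k)) => // x xr; apply: gf.
exact: le_trans (coord_le_norm _ _ _) xr.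
Qed.

Lemma profile_power k n eta h x0 : profile k eta -> iter n (fdiff h) eta x0 != 0 ->
  (forall i, (i < n)%N -> profile k (fun x => x ^+ i)) -> profile k (fun x => x ^+ n).
Proof.
apply: S_power.
- exact: profile_ext.
- by move=> f [].
- exact: profileD.
- exact: profileZ.
- exact: profile_affine.
- exact: profile_closed.
Qed.

Lemma profile_lin k i : (i < 2)%N -> profile k (fun x => x ^+ i).
Proof.
case: i => [_|[_|i /notF[]]]; split.
- by apply: contX => x.
- by apply: field_along_ext (field_along_cst vel_affine k 1) => x; rewrite expr0.
- by apply: contX => x.
- by apply: field_along_ext (field_along_coord vel_affine k k) => x; rewrite expr1.
Qed.

Lemma profile_square k eta h x0 : profile k eta ->
  iter 2 (fdiff h) eta x0 != 0 -> profile k (fun x => x ^+ 2).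
Proof. by move=> pe hx; apply: profile_power pe hx _ => i; exact: profile_lin. Qed.

Lemma fdiff2E (h x : R) g : iter 2 (fdiff h) g x = g (x + h + h) - 2 * g (x + h) + g x.
Proof. by rewrite /= /fdiff; ring. Qed.

Variables (f : V -> V) (phi : 'I_d -> R -> R).
Hypothesis fE : forall x, f x = \row_i phi i (x 0 i).
Hypothesis hf : field H f.

Lemma cont_component k : continuous (phi k).
Proof.
have [cf _] := hf.
rewrite (_ : phi k = fun t => f (t *: delta_mx 0 k) 0 k); last first.
  by apply/funext => t; rewrite fE !mxE !eqxx mulr1.
apply: cont_coord; apply: (@cont_comp _ _ _ (fun t : R => t *: (delta_mx 0 k : V)) f) => //.
by apply: (@contZ R R V id (fun=> delta_mx 0 k)) => [x|]; [|exact: cst_continuous].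
Qed.

(** An affine change of the [k]-th coordinate alone leaves the other components of
    [f] unchanged, so they cancel in the difference with [f]. *)
Lemma isolate_component k l b : 0 < l ->
  profile k (fun x => l^-1 * phi k (l * x + b) - phi k x).
Proof.
move=> l0; split.
  apply: contB; last exact: cont_component.
  apply: contM; first exact: cst_continuous.
  apply: (@cont_comp _ _ _ (fun x => l * x + b) (phi k)); last exact: cont_component.
  apply: (@contD R R R (fun x => l * x) (fun=> b)); last exact: cst_continuous.
  by apply: (@contM R R (fun=> l) id) => [|x]; first exact: cst_continuous.
pose r (c : R) : V := \row_j (if j == k then c else 1).
have PQ : diag_mx (r l) *m diag_mx (r l^-1) = 1%:M.
  rewrite mulmx_diag -diag_const_mx; congr diag_mx; apply/rowP => j; rewrite !mxE.
  by case: (j == k); rewrite ?mulr1// divff// gt_eqF.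
have detP : 0 < \det (diag_mx (r l)).
  by rewrite det_diag prodr_gt0// => j _; rewrite mxE; case: (j == k).
have := fieldB H_comp
  (field_conj_affine H_id H_comp vel_affine (b *: delta_mx 0 k) PQ detP hf) hf.
rewrite /field_along (_ : (fun x => _) =
  (fun x : V => (l^-1 * phi k (l * x 0 k + b) - phi k (x 0 k)) *: delta_mx 0 k))//.
apply/funext => x; apply/rowP => j.
rewrite !mul_mx_diag !fE !mxE eqxx /=.
have [->|jk] := eqVneq j k.
  by rewrite !mulr1 [phi k _ * _]mulrC [x 0 k * l]mulrC.
by rewrite !mulr1 !mulr0 addr0 subrr.
Qed.

(** If one of the profiles of [isolate_component] has a nonzero second difference, then
    averaging and blowing up gives the square. Otherwise the second differences of
    [phi k] are the same at all points and proportional to the step. But the one of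
    step [s] is a sum of total weight [4] of those of step [s / 2], so it equals
    twice itself and vanishes. *)
Lemma nonaffine_square k : (exists h x, iter 2 (fdiff h) (phi k) x != 0) ->
  profile k (fun x => x ^+ 2).
Proof.
move=> [s [x1 hs]]; apply: contrapT => nsq.
have key l b : 0 < l ->
    l^-1 * (iter 2 (fdiff (l * s)) (phi k) (l * x1 + b)) = iter 2 (fdiff s) (phi k) x1.
  move=> l0; apply/eqP; rewrite -subr_eq0; apply/negP => /negP hn.
  apply: nsq; apply: (profile_square (isolate_component k b l0) (h := s) (x0 := x1)).
  apply: contra hn => /eqP e; apply/eqP; rewrite -[RHS]e !fdiff2E.
  rewrite (_ : l * (x1 + s) + b = l * x1 + b + l * s); last by ring.
  rewrite (_ : l * (x1 + s + s) + b = l * x1 + b + l * s + l * s); last by ring.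
  by ring.
set c := iter 2 (fdiff s) (phi k) x1 in hs key.
have k1 y : iter 2 (fdiff s) (phi k) y = c.
  by have := key 1 (y - x1) ltr01; rewrite invr1 !mul1r addrC subrK.
have k2 y : iter 2 (fdiff (s / 2)) (phi k) y = c / 2.
  have h2 : 0 < 1 / 2 :> R by lra.
  have := key (1 / 2) (y - 1 / 2 * x1) h2; rewrite addrC subrK.
  rewrite (_ : 1 / 2 * s = s / 2); last by field.
  by move=> <-; field.
have h0 := k1 0; have h1 := k2 0; have h2 := k2 (s / 2); have h3 := k2 (s / 2 + s / 2).
have ss : s / 2 + s / 2 = s by field.
have ss2 : s / 2 + s / 2 + s / 2 + s / 2 = s + s by field.
rewrite !fdiff2E !add0r in h0 h1 h2 h3.
rewrite ss2 ss in h3; rewrite ss in h2; rewrite ss in h1.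
by move/eqP: hs; apply; lra.
Qed.

(** A nonaffine component gives a square, by [nonaffine_square]. In dimension one a
    function that is not quadratic has a nonzero third difference, which gives the
    cube as well. *)
Lemma separable_powers : nonlinear f ->
  (d = 1%N -> ~ exists a b c : R, forall (x : V) (i : 'I_d),
      f x 0 i = a * x 0 i ^+ 2 + b * x 0 i + c) ->
  forall k n, field_along k (fun x => x 0 k ^+ n).
Proof.
move=> [k nl] nq.
have quad : (forall h x, iter 2 (fdiff h) (phi k) x = 0) ->
    exists a b c, forall x, phi k x = a * x ^+ 2 + b * x + c.
  move=> h2; apply: third_difference; first exact: cont_component.
  by move=> h x; rewrite iterS /fdiff !h2 subrr.
have hk : exists h x, iter 2 (fdiff h) (phi k) x != 0.
  apply: contrapT => no.
  have h2 h x : iter 2 (fdiff h) (phi k) x = 0.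
    by apply/eqP/negPn/negP => hx; apply: no; exists h, x.
  have [a [b [c hq]]] := quad h2.
  have a0 : a = 0 by have := h2 1 0; rewrite fdiff2E !hq; lra.
  apply: nl; exists (b *: delta_mx 0 k), c => x.
  rewrite fE mxE hq a0 mul0r add0r; congr (_ + _).
  by rewrite -/(dot _ _) dotZ dot_delta.
have [_ sq] := nonaffine_square hk.
have [[l kl]|one] := pselect (exists l, k != l).
  exact: (quadratic_powers H_id H_comp vel_affine kl).
have allk i : i = k.
  by apply/eqP; rewrite eq_sym; apply: contrapT => /negP ik; apply: one; exists i.
have d1 : d = 1%N.
  apply/eqP; rewrite eqn_leq; apply/andP; split; last exact: leq_trans (ltn_ord k).
  rewrite leqNgt; apply/negP => d2.
  have := congr1 val (etrans (allk (Ordinal (ltnW d2))) (esym (allk (Ordinal d2)))).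
  by [].
have pphi : profile k (phi k).
  split; first exact: cont_component.
  rewrite /field_along (_ : (fun x : V => _) = f)//.
  apply/funext => x; apply/rowP => j.
  by rewrite fE !mxE (allk j) !eqxx mulr1.
have [h [x0 h3]] : exists h x, iter 3 (fdiff h) (phi k) x != 0.
  apply: contrapT => no; apply: (nq d1).
  have [|a [b [c hq]]] := @third_difference _ (phi k) (@cont_component k).
    by move=> h x; apply/eqP/negPn/negP => hx; apply: no; exists h, x.
  by exists a, b, c => x i; rewrite fE mxE (allk i) hq.
have psq := nonaffine_square hk.
have [_ cube] : profile k (fun x => x ^+ 3).
  apply: profile_power pphi h3 _ => i; rewrite ltnS leq_eqVlt => /orP[/eqP -> //|].
  exact: profile_lin.
move=> i n; rewrite (allk i) {i}.
clear -H_id H_comp vel_affine sq cube d1.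
subst d; rewrite (ord1 k) in sq cube *.
exact: (cubic_powers H_id H_comp vel_affine).
Qed.

End separable_fields.

(** * Riemann sums for integrals over a measure space *)

Section riemann_sums.
Context {dd : measure_display} {T : measurableType dd} {R : realType}.
Variable mu : {measure set T -> \bar R}.
Local Notation itg f := (mu.-integrable setT (EFin \o f)).

Lemma itgZ (c : R) (f : T -> R) : itg f -> itg (fun t => c * f t).
Proof.
by move=> h; exact: (integrableZl measurableT c h).
Qed.

Lemma itgD (f g : T -> R) : itg f -> itg g -> itg (fun t => f t + g t).
Proof. by move=> hf hg; exact: (integrableD measurableT hf hg). Qed.

Lemma itg_sum (I : Type) (r : seq I) (f : I -> T -> R) : (forall i, itg (f i)) ->
  itg (fun t => \sum_(i <- r) f i t) /\
  \int[mu]_t (\sum_(i <- r) f i t) = \sum_(i <- r) \int[mu]_t f i t.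
Proof.
move=> hf; elim: r => [|i r [IH1 IH2]].
  rewrite big_nil; under [X in itg X]funext do rewrite big_nil.
  split; first exact: integrable0.
  under eq_Rintegral do rewrite big_nil.
  by rewrite Rintegral_cst// mul0r.
under [X in itg X]funext do rewrite big_cons.
under eq_Rintegral do rewrite big_cons.
split; first exact: itgD.
by rewrite big_cons RintegralD// IH2.
Qed.

Lemma itg_indic (Q : set T) (m : R) : measurable Q -> mu Q = m%:E ->
  itg (\1_Q : T -> R) /\ \int[mu]_t (\1_Q t : R) = m.
Proof.
move=> mQ muQ; split.
  apply/integrableP; split; first by apply/measurable_realfun.measurable_EFinP; exact: measurable_realfun.measurable_indic.
  under eq_integral => t _ do rewrite /= ger0_norm ?indicE//.
  rewrite (eq_integral (fun t => (\1_Q t)%:E)) => [|t _]; last by rewrite indicE.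
  by rewrite integral_indic// setIT muQ ltry.
by rewrite /Rintegral integral_indic// setIT muQ.
Qed.

Lemma itg_norm (f : T -> R) : itg f -> itg (fun t => `|f t|).
Proof. by move=> h; exact: integrable_norm. Qed.

Lemma itg_normM_indic (f : T -> R) (A : set T) : measurable A -> itg f ->
  itg (fun t => `|f t| * \1_A t).
Proof.
move=> mA hf; have hn := itg_norm hf.
apply: (le_integrable measurableT _ _ hn).
  apply/measurable_realfun.measurable_EFinP; apply: measurable_realfun.measurable_funM.
    by have /integrableP[/measurable_realfun.measurable_EFinP] := hn.
  exact: measurable_realfun.measurable_indic.
move=> t _ /=; rewrite lee_fin normrM ler_piMr// indicE.
by case: (t \in A); rewrite ?normr1 ?normr0.
Qed.

(** Dominated convergence: the sets [A n] leave every point. *)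
Lemma tail_small (f : T -> R) (A : (set T)^nat) : (forall n, measurable (A n)) ->
  (forall t, exists n0, forall n, (n0 <= n)%N -> ~ A n t) -> itg f ->
  forall eps, 0 < eps -> exists n, \int[mu]_t (`|f t| * \1_(A n) t) <= eps.
Proof.
move=> mA hA hf eps e0.
have [|||||_ _ cv] := @dominated_convergence _ T R mu setT measurableT
    (fun n t => (`|f t| * \1_(A n) t)%:E) (cst 0%E) (fun t => `|f t|%:E).
- by move=> n; have /integrableP[] := itg_normM_indic (mA n) hf.
- exact: measurable_cst.
- apply: aeW => t _; have [n0 hn0] := hA t.
  apply: cvg_near_cst; exists n0 => // n /= /hn0 nA.
  by rewrite indicE memNset// mulr0.
- exact: itg_norm.
- apply: aeW => t n _ /=; rewrite lee_fin normrM normr_id ler_piMr// indicE.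
  by case: (t \in A n); rewrite ?normr1 ?normr0.
move: cv; rewrite integral0 => /fine_cvgP[_ /cvgrPdist_le /(_ _ e0)[n _ /(_ n (leqnn n))]].
rewrite sub0r normrN => h; exists n; apply: le_trans h; exact: ler_norm.
Qed.

(** The sum is the integral of the step function [ga k * c k] on the cells, which is
    compared with [ga0 * f] pointwise: off [A] both factors are close, and on [A]
    the trivial bound [2 * G * `|f|] is used; it is harmless when [A] carries little of
    the integral of [f]. *)
Lemma weighted_riemann_sum (K : finType) (Q : K -> set T) (m : R) (f : T -> R)
    (A : set T) (c ga : K -> R) (ga0 G eta eps : R) :
  (forall k, measurable (Q k)) -> (forall k, mu (Q k) = m%:E) ->
  (forall j k t, Q j t -> Q k t -> j = k) ->
  measurable A -> itg f ->
  0 <= G -> 0 <= eta -> 0 <= eps ->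
  (forall k t, Q k t -> `|c k - f t| <= eta) ->
  (forall k, `|ga k| <= G) -> `|ga0| <= G ->
  (forall k t, Q k t -> ~ A t -> `|ga k - ga0| <= eps) ->
  (forall t, ~ A t -> exists k, Q k t) ->
  `|\sum_k ga k * c k * m - ga0 * \int[mu]_t f t| <=
    G * eta * (#|K|%:R * m) + eps * \int[mu]_t `|f t|
    + 2 * G * \int[mu]_t (`|f t| * \1_A t).
Proof.
move=> mQ muQ disj mA hf G0 eta0 eps0 hc hga hga0 hnear hcov.
have hQ k := itg_indic (mQ k) (muQ k).
pose h t := \sum_k (ga k * c k) * \1_(Q k) t.
have [ih inth] : itg h /\ \int[mu]_t h t = \sum_k ga k * c k * m.
  have [i1 i2] := @itg_sum _ (index_enum K) (fun k t => (ga k * c k) * \1_(Q k) t)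
    (fun k => itgZ _ (hQ k).1).
  split => //; rewrite i2; apply: eq_bigr => k _.
  by rewrite RintegralZl//; [rewrite (hQ k).2|exact: (hQ k).1].
pose u t := \sum_k (G * eta) * \1_(Q k) t.
have [iu intu] : itg u /\ \int[mu]_t u t = G * eta * (#|K|%:R * m).
  have [i1 i2] := @itg_sum _ (index_enum K) (fun k t => (G * eta) * \1_(Q k) t)
    (fun k => itgZ _ (hQ k).1).
  split => //; rewrite i2 (eq_bigr (fun=> G * eta * m)) => [|k _]; last first.
    by rewrite RintegralZl//; [rewrite (hQ k).2|exact: (hQ k).1].
  by rewrite sumr_const -mulr_natl; ring.
have if1 := itgZ eps (itg_norm hf).
have if2 := itgZ (2 * G) (itg_normM_indic mA hf).
have if3 := itgZ (- ga0) hf.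
have e1 : \int[mu]_t (eps * `|f t|) = eps * \int[mu]_t `|f t|.
  by apply: RintegralZl => //; exact: itg_norm.
have e2 : \int[mu]_t (2 * G * (`|f t| * \1_A t)) =
    2 * G * \int[mu]_t (`|f t| * \1_A t).
  by apply: RintegralZl => //; exact: itg_normM_indic.
have e3 : \int[mu]_t (- ga0 * f t) = - ga0 * \int[mu]_t f t by exact: RintegralZl.
have e4 : \int[mu]_t (h t + - ga0 * f t) =
    \sum_k ga k * c k * m - ga0 * \int[mu]_t f t.
  by rewrite (RintegralD measurableT ih if3) inth e3 mulNr.
have e5 : \int[mu]_t (u t + eps * `|f t| + 2 * G * (`|f t| * \1_A t)) =
    G * eta * (#|K|%:R * m) + eps * \int[mu]_t `|f t|
    + 2 * G * \int[mu]_t (`|f t| * \1_A t).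
  rewrite (RintegralD measurableT (itgD iu if1) if2) (RintegralD measurableT iu if1).
  by rewrite intu e1 e2.
rewrite -e4 -e5.
apply: le_trans (le_normr_Rintegral measurableT (itgD ih if3)) _.
apply: le_Rintegral => //.
- exact: itg_norm (itgD ih if3).
- exact: itgD (itgD iu if1) if2.
move=> t _ /=.
have indic0 k : ~ Q k t -> \1_(Q k) t = 0 :> R.
  by move=> nQ; rewrite indicE memNset.
have [[k Qk]|noQ] := pselect (exists k, Q k t).
  have other j : j != k -> \1_(Q j) t = 0 :> R.
    by move=> jk; apply: indic0 => Qj; move/eqP: jk; apply; exact: disj Qj Qk.
  have one : \1_(Q k) t = 1 :> R by rewrite indicE mem_set.
  rewrite /h /u (bigD1 k)//= big1 => [|j jk]; last by rewrite other// mulr0.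
  rewrite [X in _ <= X + _ + _](bigD1 k)//= [X in _ <= _ + X + _ + _]big1 => [|j jk]; last first.
    by rewrite other// mulr0.
  rewrite one !mulr1 !addr0.
  rewrite (_ : _ + - ga0 * f t = ga k * (c k - f t) + (ga k - ga0) * f t); last by ring.
  rewrite (le_trans (ler_normD _ _))// !normrM -addrA lerD//; first by rewrite ler_pM// hc.
  have [At|nAt] := pselect (A t).
    rewrite (_ : \1_A t = 1) ?mulr1; last by rewrite indicE mem_set.
    apply: (@le_trans _ _ (2 * G * `|f t|)); last by rewrite lerDr mulr_ge0.
    rewrite ler_wpM2r// (le_trans (ler_normB _ _))//; have := hga k; lra.
  rewrite (_ : \1_A t = 0) ?mulr0 ?addr0; last by rewrite indicE memNset.
  by rewrite ler_wpM2r// (hnear k t).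
have At : A t by apply: contrapT => nA; apply: noQ; exact: hcov.
rewrite /h /u !big1 => [|k _|k _]; last 2 first.
- by rewrite indic0 ?mulr0// => Qk; apply: noQ; exists k.
- by rewrite indic0 ?mulr0// => Qk; apply: noQ; exists k.
rewrite !add0r normrM normrN (_ : \1_A t = 1) ?mulr1; last by rewrite indicE mem_set.
apply: (@le_trans _ _ (2 * G * `|f t|)); last by rewrite lerDr mulr_ge0.
by rewrite ler_wpM2r//; lra.
Qed.

End riemann_sums.

(** * Integrable fields *)

Section integrable_fields.
Context {R : realType} {d : nat}.
Local Notation V := 'rV[R]_d.
Variable H : set (V -> option V).
Hypothesis H_id : H Some.
Hypothesis H_comp : forall h k, H h -> H k -> H (pcomp k h).
Hypothesis vel_affine : forall (A : 'M[R]_d) (b : V) rho,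
  vel H (fun x => x *m A + b) rho.
Local Notation field_along := (field_along H).
Local Notation mu := (@lebesgue_measure_n R d).

Lemma measurable_box (A : 'I_d -> set R) : (forall i, measurable (A i)) ->
  measurable [set t : d.-tuple R | forall i, A i (tnth t i)].
Proof.
move=> mA; rewrite (_ : [set t | _] = \bigcap_(i in [set: 'I_d])
    ((fun t : d.-tuple R => tnth t i) @^-1` A i)); last first.
  by apply/seteqP; split => t /= At i; [move=> _|]; exact: At.
apply: fin_bigcap_measurable; first exact: finite_finset.
by move=> i _; rewrite -[X in measurable X]setTI; exact: measurable_tnth.
Qed.

Lemma measure_cube (a : 'I_d -> R) (c : R) : 0 < c ->
  mu [set t : d.-tuple R | forall i, (`]a i - c, a i]%classic : set R) (tnth t i)]
  = (c ^+ d)%:E.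
Proof.
move=> c0; rewrite (lebesgue_measure_n_box (A := fun i => `]a i - c, a i]%classic)); last first.
  by move=> i; exact: measurable_itv.
rewrite (eq_bigr (fun=> c%:E)) => [|i _]; last first.
  rewrite lebesgue_measure_itv /= lte_fin ltrBlDr ltrDl c0 -EFinB.
  by congr EFin; ring.
elim: (d) => [|n IH]; first by rewrite big_ord0 expr0.
by rewrite big_ord_recr /= IH -EFinM exprSr.
Qed.

(** The cells of a lattice of mesh [del] on the cube of radius [L], seen through
    the change of variables [t = s * (x - y)], which turns the integral of
    [s ^+ d * f (s * (x - y))] in [y] into that of [f]. The reflection makes the
    cells half-open on the left. *)
Section lattice.
Variables (s del L : R) (n : nat).
Hypotheses (s0 : 0 < s) (del0 : 0 < del) (nL : del * n%:R = 2 * L).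

Definition node (k : {ffun 'I_d -> 'I_n}) : V := \row_i (- L + del * (k i)%:R).

Definition cell (x : V) (k : {ffun 'I_d -> 'I_n}) := [set t : d.-tuple R | forall i,
  (`](s * (x 0 i - node k 0 i)) - s * del, s * (x 0 i - node k 0 i)]%classic : set R)
    (tnth t i)].

Lemma norm_node k : 0 <= L -> `|node k| <= L.
Proof.
move=> L0; apply: norm_le_coord => // i j.
rewrite ord1 mxE ler_norml lerDl mulr_ge0 ?(ltW del0)//=.
have : del * (k j)%:R <= del * n%:R by rewrite ler_pM2l// ler_nat ltnW.
by rewrite nL; lra.
Qed.

Lemma measurable_cell x k : measurable (cell x k).
Proof.
apply: (@measurable_box (fun i =>
  `](s * (x 0 i - node k 0 i)) - s * del, s * (x 0 i - node k 0 i)]%classic)) => j.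
exact: measurable_itv.
Qed.

Lemma measure_cell x k : mu (cell x k) = ((s * del) ^+ d)%:E.
Proof.
apply: (@measure_cube (fun i => s * (x 0 i - node k 0 i))); exact: mulr_gt0.
Qed.

Lemma cellP x k t : cell x k t <->
  forall j, node k 0 j <= x 0 j - tnth t j / s < node k 0 j + del.
Proof.
have e j : tnth t j = s * (tnth t j / s) by rewrite mulrC divfK// gt_eqF.
have dE j : s * (x 0 j - node k 0 j) - s * del = s * (x 0 j - node k 0 j - del).
  by rewrite [RHS]mulrBr.
suff cE j : (tnth t j \in `](s * (x 0 j - node k 0 j) - s * del),
    (s * (x 0 j - node k 0 j))]) =
    (node k 0 j <= x 0 j - tnth t j / s < node k 0 j + del).
  by split=> h j; have := h j; [move=> /= h1; rewrite -cE|rewrite -cE].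
rewrite in_itv /= dE {1 2}(e j) ltr_pM2l// ler_pM2l// andbC.
by congr andb; apply/idP/idP; lra.
Qed.

Lemma cell_inj x j k t : cell x j t -> cell x k t -> j = k.
Proof.
move=> /cellP Qj /cellP Qk; apply/ffunP => l; apply/val_inj => /=.
have /andP[a1 a2] := Qj l; have /andP[b1 b2] := Qk l.
rewrite !mxE in a1 a2 b1 b2.
have lt1 (p q : 'I_n) v : - L + del * p%:R <= v -> v < - L + del * q%:R + del ->
    (p <= q)%N.
  move=> h1 h2; rewrite -ltnS -(ltr_nat R) -natr1 -(ltr_pM2l del0) mulrDr mulr1.
  by lra.
by apply/eqP; rewrite eqn_leq (lt1 _ _ _ a1 b2) (lt1 _ _ _ b1 a2).
Qed.

Lemma cell_cover (x : V) t : (forall j, - L <= x 0 j - tnth t j / s < L) ->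
  exists k, cell x k t.
Proof.
move=> h.
pose w j := (x 0 j - tnth t j / s + L) / del.
have w0 j : 0 <= w j.
  by rewrite divr_ge0 ?(ltW del0)//; have := h j => /andP[]; lra.
have kP j : (Num.truncn (w j) < n)%N.
  rewrite -(ltr_nat R); apply: (@le_lt_trans _ _ (w j)); first by rewrite truncn_le.
  by rewrite ltr_pdivrMr// [ltRHS]mulrC nL; have := h j => /andP[]; lra.
exists [ffun j => Ordinal (kP j)]; apply/cellP => j; rewrite mxE ffunE /=.
have /andP[k1 k2] := truncn_itv (w0 j).
set k := Num.truncn _ in k1 k2 *.
rewrite ler_pdivlMr// in k1; rewrite ltr_pdivrMr// -natr1 in k2.
by apply/andP; split; lra.
Qed.

Lemma cell_near x k t : cell x k t ->
  forall j, `|s * (x 0 j - node k 0 j) - tnth t j| <= s * del /\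
    `|node k 0 j - x 0 j| <= del + `|tnth t j| / s.
Proof.
move=> /cellP h j; have /andP[h1 h2] := h j.
have e : tnth t j = s * (tnth t j / s) by rewrite mulrC divfK// gt_eqF.
split.
  rewrite {1}e -mulrBr normrM gtr0_norm// ler_pM2l// ger0_norm; lra.
have -> : `|tnth t j| / s = `|tnth t j / s| by rewrite normrM (gtr0_norm (_ : 0 < s^-1)) ?invr_gt0.
have := ler_norm (tnth t j / s); have := ler_norm (- (tnth t j / s)); rewrite normrN.
by rewrite ler_norml => ? ?; apply/andP; split; lra.
Qed.

End lattice.

Variable f : V -> V.
Hypothesis cf : continuous f.
Hypothesis hf : field H f.
Hypothesis L1f : L1_integrable f.

(** As the scale [s] tends to infinity, the kernels [s ^+ d * f (s * _)] tend to a
    point mass with vector weight [integral_rV f]. Their convolution with [g] is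
    replaced by a finite sum over the nodes of a lattice, which is a combination of
    rescaled translates of [f]. The parameters are chosen in this order: a box
    outside of which [f] has a small integral, then the scale [s], such that this
    box becomes small after division by [s], then the mesh [del] of the
    lattice. *)
Lemma field_integral (g : V -> R) : continuous g ->
  field H (fun x => g x *: integral_rV f).
Proof.
move=> cg; apply: field_closed.
  by apply: contZ => //; exact: cst_continuous.
move=> rho0 eps e0.
pose rho := Num.max rho0 1; have r0 : 0 < rho by rewrite lt_max ltr01 orbT.
have rr : rho0 <= rho by rewrite le_max lexx.
pose L := rho + 1; have L0 : 0 < L by rewrite addr_gt0.
have [G G0 gG] := ball_bound cg L.
pose F i (t : d.-tuple R) := f (rV_of_tuple t) 0 i.
have iF i : mu.-integrable setT (EFin \o F i) by exact: L1f.
pose Fs (t : d.-tuple R) := \sum_i `|F i t|.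
have [iFs _] := itg_sum (index_enum 'I_d) (fun i => itg_norm (iF i)).
have FFs i t : `|F i t| <= Fs t.
  by rewrite /Fs (bigD1 i)//= lerDl sumr_ge0.
have Fs0 t : 0 <= Fs t by rewrite sumr_ge0.
pose E := \int[mu]_t Fs t + 1.
have E0 : 0 < E by rewrite ltr_wpDl// Rintegral_ge0.
have FE i : \int[mu]_t `|F i t| <= E.
  apply: (@le_trans _ _ (\int[mu]_t Fs t)); last by rewrite lerDl.
  by apply: le_Rintegral => //; exact: itg_norm (iF i).
have e1 : 0 < eps / 3 / E by rewrite !divr_gt0.
have [dl dl0 hdl] := ball_unif_cont cg rho e1.
pose box (n : nat) := [set t : d.-tuple R |
  forall i, (`[- n%:R, n%:R]%classic : set R) (tnth t i)].
have mbox n : measurable (box n) 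
  by apply: (@measurable_box (fun=> `[- n%:R, n%:R]%classic)) => i; exact: measurable_itv.
have e2 : 0 < eps / 3 / (2 * G) by rewrite !divr_gt0// mulr_gt0.
have [||N hN] := @tail_small _ _ R mu Fs (fun n => ~` box n) _ _ iFs _ e2.
- by move=> n; exact: measurableC (mbox n).
- move=> t.
  exists (Num.truncn (\sum_i `|tnth t i|)).+1 => n hn; apply; move=> i.
  rewrite /= in_itv /= -ler_norml.
  apply: (@le_trans _ _ (\sum_j `|tnth t j|)).
    by rewrite (bigD1 i)//= lerDl sumr_ge0.
  apply: ltW; apply: lt_le_trans (truncnS_gt _) _; by rewrite ler_nat.
pose s := (N%:R + 1) / Num.min (dl / 2) (1 / 2).
have m20 : 0 < Num.min (dl / 2) (1 / 2) by rewrite lt_min !divr_gt0.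
have s0 : 0 < s by rewrite divr_gt0// ltr_wpDl.
have Ns : N%:R / s <= Num.min (dl / 2) (1 / 2).
  rewrite ler_pdivrMr// mulrC /s divfK ?gt_eqF// lerDl//.
have [Ns1 Ns2] : N%:R / s <= dl / 2 /\ N%:R / s <= 1 / 2.
  by move: Ns; rewrite le_min => /andP.
pose vol := (2 * s * L) ^+ d; have vol0 : 0 < vol 
  by apply: exprn_gt0; apply: mulr_gt0 => //; exact: mulr_gt0.
have e3 : 0 < eps / 3 / (G * vol) by rewrite !divr_gt0// mulr_gt0.
have [df df0 hdf] := ball_unif_cont cf (s * (2 * L)) e3.
pose n := (Num.truncn (2 * L / Num.min (dl / 2) (df / s))).+1.
have n0 : 0 < n%:R :> R by rewrite ltr0n.
pose del := 2 * L / n%:R; have del0 : 0 < del by rewrite divr_gt0// mulr_gt0.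
have hdel : del <= Num.min (dl / 2) (df / s).
  have mm : 0 < Num.min (dl / 2) (df / s) by rewrite lt_min !divr_gt0.
  rewrite ler_pdivrMr// [leRHS]mulrC -ler_pdivrMr//; apply: ltW; exact: truncnS_gt.
have [del1 del2] : del <= dl / 2 /\ s * del <= df.
  by move: hdel; rewrite le_min => /andP[? h]; split => //; rewrite mulrC -ler_pdivlMr.
have nL : del * n%:R = 2 * L by rewrite /del divfK// gt_eqF.
pose y := @node del L n.
have yL k : `|y k| <= L by apply: norm_node => //; exact: ltW.
exists (fun x => \sum_k (g (y k) * (s * del) ^+ d) *: f (s *: (x - y k))).
  apply: (field_sum H_comp vel_affine) => k _.
  apply: (fieldZ vel_affine).
  have := field_dilate H_id H_comp vel_affine (- (s *: y k)) s0 hf.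
  rewrite (_ : (fun x => _) = (fun x => f (s *: (x - y k))))//.
  by apply/funext => x; rewrite scalerBr.
move=> x xr0; have xr : `|x| <= rho by exact: le_trans rr.
apply: norm_le_coord => [|i0 i]; first exact: ltW.
rewrite ord1 {i0} !mxE summxE.
pose Q := @cell s del L n x.
have := @weighted_riemann_sum _ _ R mu _ Q ((s * del) ^+ d) (F i) (~` box N)
  (fun k => f (s *: (x - y k)) 0 i) (fun k => g (y k)) (g x) G
  (eps / 3 / (G * vol)) (eps / 3 / E).
have -> : \sum_k g (y k) * f (s *: (x - y k)) 0 i * (s * del) ^+ d =
    \sum_k ((g (y k) * (s * del) ^+ d) *: f (s *: (x - y k))) 0 i.
  by apply: eq_bigr => k _; rewrite !mxE mulrAC.
have -> : #|{ffun 'I_d -> 'I_n}|%:R * (s * del) ^+ d = vol.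
  rewrite card_ffun !card_ord natrX -exprMn /vol; congr (_ ^+ _).
  by rewrite /del; field; rewrite gt_eqF.
move=> h; apply: le_trans (h _ _ _ _ _ _ _ _ _ _ _ _ _) _; clear h.
- exact: measurable_cell.
- by move=> k; exact: measure_cell.
- by move=> j k t; exact: cell_inj.
- exact: measurableC (mbox N).
- exact: iF.
- exact: ltW.
- exact: ltW.
- exact: ltW.
- move=> k t Qt.
  apply: (@le_trans _ _ `|f (s *: (x - y k)) - f (rV_of_tuple t)|).
    by have := coord_le_norm (f (s *: (x - y k)) - f (rV_of_tuple t)) 0 i; rewrite !mxE.
  apply: hdf.
    rewrite normrZ gtr0_norm// ler_pM2l// (le_trans (ler_normB _ _))//.
    by rewrite mulr_natl mulr2n lerD// (le_trans xr)// /L lerDl.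
  apply: norm_le_coord => [|a j]; first exact: ltW.
  have [h1 _] := cell_near s0 Qt j.
  by apply: le_trans del2; rewrite ord1; move: h1; rewrite !mxE.
- by move=> k; exact: gG.
- by apply: gG; rewrite (le_trans xr)// /L lerDl.
- move=> k t Qt /contrapT bt.
  rewrite -normrN opprB; apply: hdl => //; rewrite -normrN opprB.
  apply: norm_le_coord => [|a j]; first exact: ltW.
  have [_ h2] := cell_near s0 Qt j.
  have := bt j; rewrite /= in_itv /= -ler_norml => tN.
  rewrite ord1 !mxE; rewrite !mxE in h2; apply: le_trans h2 _.
  rewrite [leRHS](splitr dl) lerD// (le_trans _ Ns1)// ler_pM2r// invr_gt0//.
- move=> t /contrapT bt; apply: (cell_cover s0 del0 nL) => j.
  have := bt j; rewrite /= in_itv /= -ler_norml => tN.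
  have : `|tnth t j / s| <= 1 / 2.
    apply: le_trans Ns2; rewrite normrM (gtr0_norm (_ : 0 < s^-1)) ?invr_gt0//.
    by rewrite ler_pM2r// invr_gt0.
  have := le_trans (coord_le_norm x 0 j) xr.
  rewrite !ler_norml /L; clear -r0; move: (tnth t j / s) (x 0 j) => a b.
  by move=> /andP[? ?] /andP[? ?]; apply/andP; split; lra.
have eE : G * (eps / 3 / (G * vol)) * vol + eps / 3 / E * E
    + 2 * G * (eps / 3 / (2 * G)) = eps by field; rewrite !gt_eqF.
rewrite -[leRHS]eE; apply: lerD; last first.
  rewrite ler_pM2l ?mulr_gt0//; apply: le_trans hN.
  apply: le_Rintegral => //.
  - by apply: itg_normM_indic; [exact: measurableC (mbox N)|exact: iF].
  - by apply: itg_normM_indic; [exact: measurableC (mbox N)|exact: iFs].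
  by move=> t _; rewrite ler_wpM2r// (ger0_norm (Fs0 t)).
apply: lerD; first exact: lexx.
by apply: ler_wpM2l; [exact: ltW|exact: FE].
Qed.

(** Let [c] be the integral and [c 0 i != 0]. Conjugating [g x *: c] by a linear shear
    that moves [e_i] by a multiple of [e_j], after composing [g] with its inverse,
    changes only the vector [c]; the difference is a field along [e_j]. The
    component along [e_i] is what remains. *)
Lemma integrable_field_along : integral_rV f != 0 ->
  forall k (g : V -> R), continuous g -> field_along k g.
Proof.
set c := integral_rV f => c0.
have [i ci] : exists i, c 0 i != 0.
  apply: contrapT => no; move/eqP: c0; apply; apply/rowP => i; rewrite [RHS]mxE.
  by apply/eqP/negPn/negP => ci; apply: no; exists i.
have off j g : i != j -> continuous g -> field_along j g.
  move=> ij cg; pose N : 'M[R]_d := 1 *: delta_mx i j.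
  have N0 : N *m N = 0 by exact: mul_delta_mx_neq.
  have cg' : continuous (fun x : V => g (x *m (1%:M - N))).
    apply: (@cont_comp _ _ _ (fun x : V => x *m (1%:M - N)) g) => //.
    by apply: (@cont_mulmx R V _ _ _ id (fun=> 1%:M - N)); [move=> x|exact: cst_continuous].
  have h1 := field_conj_unip H_id H_comp vel_affine N0 (field_integral cg').
  have h2 := fieldZ vel_affine (c 0 i)^-1 (fieldB H_comp (field_integral cg) h1).
  move: h2; rewrite /field_along (_ : (fun x => _) = (fun x => g x *: delta_mx 0 j))//.
  apply/funext => x.
  rewrite -mulmxA (_ : (1%:M + N) *m (1%:M - N) = 1%:M); last first.
    by rewrite mulmxDl mul1mx mulmxBr mulmx1 N0 subr0 subrK.
  rewrite mulmx1 -/c mulmxBr mulmx1 /N scale1r mul_rV_delta.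
  rewrite subKr scalerA [(g x *: c) 0 i]mxE; congr (_ *: _).
  by field.
move=> k g cg; have [ki|ki] := eqVneq i k; last exact: off.
rewrite -ki.
have h1 := field_integral cg.
have h2 : field H (fun x => \sum_(j < d | j != i) (c 0 j * g x) *: delta_mx 0 j).
  apply: (field_sum H_comp vel_affine) => j ji.
  by apply: (field_alongZ vel_affine); apply: off => //; rewrite eq_sym.
have := fieldZ vel_affine (c 0 i)^-1 (fieldB H_comp h1 h2).
rewrite /field_along (_ : (fun x => _) = (fun x => g x *: delta_mx 0 i))//.
apply/funext => x; rewrite -/c.
have -> : g x *: c - \sum_(j < d | j != i) (c 0 j * g x) *: delta_mx 0 j =
    (c 0 i * g x) *: (delta_mx 0 i : V).
  rewrite [in g x *: c](row_sum_delta c) scaler_sumr (bigD1 i)//= -addrA.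
  rewrite (eq_bigr (fun j => (c 0 j * g x) *: (delta_mx 0 j : V))) => [|j _].
    by rewrite subrr addr0 scalerA mulrC.
  by rewrite scalerA mulrC.
by rewrite scalerA; congr (_ *: _); field.
Qed.

End integrable_fields.

(** * Local Lipschitz conditions on the control *)

Section lipschitz_fields.
Context {R : realType} {d : nat}.
Local Notation V := 'rV[R]_d.

Lemma lipschitz_bound (f : V -> V) (U : set V) : [lipschitz f y | y in U] ->
  exists2 L, 0 < L & forall x y, U x -> U y -> `|f x - f y| <= L * `|x - y|.
Proof.
move=> [M [_ hM]]; pose L := `|M| + 1.
have L0 : 0 < L by rewrite ltr_wpDl.
exists L => // x y Ux Uy.
have ML : M < L by rewrite /L (le_lt_trans (ler_norm _))// ltrDl.
exact: (hM _ ML (x, y) (conj Ux Uy)).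
Qed.

Lemma lipschitz_locally (f : V -> V) : lipschitz f -> locally_lipschitz f.
Proof. by move=> lf x; exists setT => //; exact: filterT. Qed.

(** Compactness gives one constant and one radius [r / 2] such that the estimate holds
    for pairs at distance at most [r / 2]; pairs further apart are covered by the
    boundedness of [f]. *)
Lemma locally_lipschitz_on_balls (f : V -> V) : continuous f ->
  locally_lipschitz f -> lipschitz_on_balls f.
Proof.
move=> cf lf rho.
have [G G0 fG] := ball_bound cf rho.
have cB := @ball_compact R d rho.
pose P (e : R) (x : V) := forall y, `|x - y| <= e -> `|f x - f y| <= e^-1 * `|x - y|.
have /compact_near_coveringP/(_ R (0^'+) P) := cB.
case.
  move=> x _; have [U Ux lU] := lf x.
  have [L L0 hL] := lipschitz_bound lU.
  move: Ux => /nbhs_ballP[r /= r0 rU]; have r20 : 0 < r / 2 by lra.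
  exists (ball x (r / 2), [set e : R | 0 < e /\ e < Num.min (r / 2) L^-1]) => /=.
    split; first exact: nbhsx_ballx.
    near=> e; split; near: e; first exact: nbhs_right_gt.
    by apply: nbhs_right_lt; rewrite lt_min r20 invr_gt0.
  move=> [x' e] /=; rewrite -!ball_normE /= lt_min => -[xx' [e0 /andP[er eL]]] y xy.
  have Ux' : U x' by apply: rU; rewrite -ball_normE /= (lt_le_trans xx')//; lra.
  have Uy : U y.
    apply: rU; rewrite -ball_normE /= -(subrKA x').
    by rewrite (le_lt_trans (ler_normD _ _))//; lra.
  apply: le_trans (hL _ _ Ux' Uy) _; apply: ler_wpM2r => //.
  by rewrite -[L]invrK lef_pV2 ?posrE ?invr_gt0// ltW.
move=> r /= r0 /(_ (r / 2)); rewrite /ball_ /= => h.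
have r20 : 0 < r / 2 by lra.
exists (Num.max (r / 2)^-1 (2 * G / (r / 2))).
  by rewrite lt_max invr_gt0 r20.
move=> x y xr yr.
have [xy|xy] := leP `|x - y| (r / 2).
  have rr : `|0 - r / 2| < r by rewrite sub0r normrN gtr0_norm//; lra.
  have := h rr r20 x xr y xy; move=> hxy; apply: (le_trans hxy).
  by apply: ler_wpM2r => //; rewrite le_max lexx.
apply: (@le_trans _ _ (2 * G / (r / 2) * `|x - y|)); last first.
  by apply: ler_wpM2r => //; rewrite le_max lexx orbT.
apply: (@le_trans _ _ (2 * G)).
  rewrite (le_trans (ler_normB _ _))//.
  by rewrite mulr_natl mulr2n; apply: lerD; exact: fG.
rewrite mulrAC ler_pdivlMr//; apply: ler_wpM2l; last exact: ltW.
by apply: mulr_ge0 => //; exact: ltW.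
Unshelve. all: by end_near. Qed.

Lemma affine_lipschitz (A : 'M[R]_d) (b : V) :
  lipschitz_on_balls (fun x => x *m A + b).
Proof.
move=> rho; exists (d%:R * `|A| + 1); first by rewrite ltr_wpDl// mulr_ge0.
move=> x y _ _; rewrite opprD addrACA subrr addr0 -mulmxBl.
apply: le_trans (norm_mulmx _ _) _.
by rewrite mulrDl mul1r ler_wpDr// mulrAC.
Qed.

Lemma lipschitz_on_ballsN (f : V -> V) :
  lipschitz_on_balls f -> lipschitz_on_balls (fun x => - f x).
Proof.
move=> lf rho; have [L L0 hL] := lf rho; exists L => // x y xr yr.
by rewrite -normrN opprD !opprK; exact: hL.
Qed.

(** A quadratic function with a nonzero leading coefficient grows faster than
    linearly. This reduces the globally Lipschitz case to the locally Lipschitz one,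
    in dimension one too. *)
Lemma lipschitz_not_quadratic (f : V -> V) : lipschitz f -> nonlinear f ->
  ~ exists a b c : R, forall (x : V) (i : 'I_d),
      f x 0 i = a * x 0 i ^+ 2 + b * x 0 i + c.
Proof.
move=> /lipschitz_bound[L L0 lf] [k nl] [a [b [c fE]]].
suff a0 : a = 0.
  apply: nl; exists (b *: delta_mx 0 k), c => x.
  rewrite fE a0 mul0r add0r (bigD1 k)//= big1 => [|i ik].
    by rewrite !mxE !eqxx mulr1 addr0.
  by rewrite !mxE (negbTE ik) andbF mulr0 mul0r.
apply/eqP/negPn/negP => a0; have na : 0 < `|a| by rewrite normr_gt0.
(* Between [0] and [x = (t, .., t)] the difference quotient is [a * t + b], which
   exceeds [L] for this [t]. *)
pose t := (L + `|b| + 1) / `|a|.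
have t0 : 0 < t by rewrite divr_gt0// ltr_wpDl// addr_ge0// ltW.
pose x : V := \row_ _ t.
have xt : `|x - 0| <= t.
  rewrite subr0; apply: norm_le_coord => [|i j]; first exact: ltW.
  by rewrite mxE gtr0_norm.
have h : `|(a * t + b) * t| <= L * t.
  apply: (@le_trans _ _ (L * `|x - 0|)); last by rewrite ler_pM2l.
  apply: le_trans (lf x 0 _ _) => //.
  have := coord_le_norm (f x - f 0) 0 k; apply: le_trans.
  rewrite !mxE !fE !mxE -/(f x) le_eqVlt; apply/orP; left; apply/eqP.
  by congr `|_|; ring.
move: h; rewrite normrM (gtr0_norm t0) ler_pM2r// => h.
have : `|a * t| <= L + `|b|.
  rewrite -[a * t](addrK b) (le_trans (ler_normB _ _))//.
  by rewrite lerD2r.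
rewrite normrM (gtr0_norm t0) /t mulrC divfK ?gt_eqF//; lra.
Qed.

End lipschitz_fields.

(** * Universal approximation *)

Section conclusion.
Context {R : realType} {d : nat}.
Local Notation V := 'rV[R]_d.
Variable f : V -> V.
Hypothesis cf : continuous f.
Hypothesis lf : lipschitz_on_balls f.
Local Notation H := (hypothesis_space (F_ass f)).

Lemma vel_affine_ass (A : 'M[R]_d) (b : V) rho : vel H (fun x => x *m A + b) rho.
Proof.
apply: vel_of_control; last exact: affine_lipschitz.
by left; exists A^T, b; rewrite trmxK.
Qed.

Lemma field_ass : field H f.
Proof.
split=> // rho; split; apply: vel_of_control => //; [by right; left|by right; right|].
exact: lipschitz_on_ballsN.
Qed.

Lemma UAP_of_field_along :
  (forall k (g : V -> R), continuous g -> field_along H k g) ->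
  forall Omega, compact Omega -> C_UAP Omega H Diff0.
Proof.
move=> all_fields Omega cO g Dg eps e0.
have [rho rho0 Or] : exists2 rho : R, 0 < rho & forall x, Omega x -> `|x| <= rho.
  by apply: (@compact_bound _ V V Omega id cO) => x _; exact: cvg_id.
have hid := hypothesis_space_id (F_ass f).
have hco := @hypothesis_space_comp R d (F_ass f).
have vel_cont (v : V -> V) : continuous v -> forall rho, vel H v rho.
  move=> cv r; have [] := @field_of_along R d H hco vel_affine_ass v _.
    by move=> k; apply: all_fields; apply: cont_coord.
  by move=> _ /(_ r)[].
have [h Hh hg] := reach_diffeo hid hco vel_affine_ass vel_cont Dg rho e0.
exists h => // x Ox; have [y hy yg] := hg x (Or x Ox).
by exists y => //; rewrite -normrN opprB.
Qed.

End conclusion.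

Theorem theorem2p6 (R : realType) (d : nat) (d_ge1 : (1 <= d)%N)
    (f : 'rV[R]_d -> 'rV[R]_d) (f_cont : continuous f) :
  [\/ [/\ coordinate_separable f, lipschitz f & nonlinear f],
      [/\ coordinate_separable f, locally_lipschitz f, nonlinear f
        & d = 1%N -> ~ exists a b c : R, forall (x : 'rV[R]_d) (i : 'I_d),
            f x 0 i = a * x 0 i ^+ 2 + b * x 0 i + c]
    | [/\ C1 f, L1_integrable f,
          exists M : R, forall x : 'rV[R]_d, `|x| ^+ d * `|'J f x| <= M
        & integral_rV f != 0]] ->
  forall Omega : set 'rV[R]_d, compact Omega ->
    C_UAP Omega (hypothesis_space (F_ass f)) Diff0.
Proof.
have hid := hypothesis_space_id (F_ass f).
have hco := @hypothesis_space_comp R d (F_ass f).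
have sep : coordinate_separable f -> locally_lipschitz f -> nonlinear f ->
    (d = 1%N -> ~ exists a b c : R, forall (x : 'rV[R]_d) (i : 'I_d),
       f x 0 i = a * x 0 i ^+ 2 + b * x 0 i + c) ->
    forall Omega : set 'rV[R]_d, compact Omega ->
      C_UAP Omega (hypothesis_space (F_ass f)) Diff0.
  move=> [phi fE] llf nl nq.
  have lf := locally_lipschitz_on_balls f_cont llf.
  have vaff := vel_affine_ass f.
  apply: UAP_of_field_along => k g cg.
  apply: (field_along_continuous hid hco vaff) => //.
  exact: (separable_powers hid hco vaff fE (field_ass f_cont lf) nl nq).
case=> [[sf lf nl]|[sf lf nl nq]|[C1f L1f _ c0]].
- apply: sep => //; first exact: lipschitz_locally.
  by move=> _; exact: lipschitz_not_quadratic.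
- exact: sep.
apply: UAP_of_field_along => k g cg.
have lf := C1_lipschitz C1f.
exact: (integrable_field_along hid hco (vel_affine_ass f) f_cont
  (field_ass f_cont lf) L1f c0).
Qed.
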